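(* Let $\mu\ge-\tfrac12$, let $f\in L^2_\mu(\mathbb{R}^2,\mathbb{H})$, let $\mathcal{M},\mathcal{N}\subseteq\mathbb{R}^2$ be measurable and let $\varepsilon_{\mathcal{M}},\varepsilon_{\mathcal{N}}\ge0$. Assume that $f$ is $\varepsilon_{\mathcal{M}}$-concentrated on $\mathcal{M}$ and that its two-sided quaternion Dunkl transform $\mathcal{D}^{\mathbb{H}}_\mu[f]$ is $\varepsilon_{\mathcal{N}}$-concentrated on $\mathcal{N}$. Then $$|\mathcal{M}|\,|\mathcal{N}|\ge\frac{1}{c_\mu^4}\left(1-\varepsilon_{\mathcal{M}}-\varepsilon_{\mathcal{N}}\right)^2,$$ where $|\mathcal{M}|$ and $|\mathcal{N}|$ denote the measures of $\mathcal{M}$ and $\mathcal{N}$.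
   Context: $\mathbb{H}$ denotes Hamilton's quaternions with units $\mathbf{i},\mathbf{j},\mathbf{k}$ and norm $|q|=\sqrt{q\overline{q}}$. Write $v=(v_1,v_2)$, $w=(w_1,w_2)\in\mathbb{R}^2$. Measure and constant: $d\lambda_\mu(v)=|v_1|^{2\mu+1}|v_2|^{2\mu+1}\,dv_1\,dv_2$ on $\mathbb{R}^2$, $|\mathcal{M}|=\lambda_\mu(\mathcal{M})$ for measurable $\mathcal{M}\subseteq\mathbb{R}^2$, and $c_\mu=\left(\int_{\mathbb{R}}e^{-x^2/2}|x|^{2\mu+1}dx\right)^{-1}$. For $p=1,2$, $L^p_\mu(\mathbb{R}^2,\mathbb{H})$ is the space of measurable $f:\mathbb{R}^2\to\mathbb{H}$ with $\|f\|_{p,\mu}=\left(\int_{\mathbb{R}^2}|f|^p\,d\lambda_\mu\right)^{1/p}<\infty$. Dunkl kernel: $j_\mu(x)=\Gamma(\mu+1)\sum_{n\ge0}\frac{(-1)^n}{n!\,\Gamma(n+\mu+1)}\left(\frac{x}{2}\right)^{2n}$ and, for $\mathbf{q}\in\{\mathbf{i},\mathbf{j}\}$ and $x,y\in\mathbb{R}$, $E_\mu(\mathbf{q}x,y)=j_\mu(xy)+\frac{\mathbf{q}xy}{2(\mu+1)}j_{\mu+1}(xy)$. Two-sided quaternion Dunkl transform: for $f\in L^1_\mu(\mathbb{R}^2,\mathbb{H})$, $\mathcal{D}^{\mathbb{H}}_\mu[f](w)=c_\mu^2\int_{\mathbb{R}^2}E_\mu(-\mathbf{i}w_1,v_1)\,f(v)\,E_\mu(-\mathbf{j}w_2,v_2)\,d\lambda_\mu(v)$;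 on $L^2_\mu(\mathbb{R}^2,\mathbb{H})$ it is understood as the continuous extension from $L^1_\mu\cap L^2_\mu$ (an isometry for $\|\cdot\|_{2,\mu}$). Concentration: $h\in L^2_\mu(\mathbb{R}^2,\mathbb{H})$ is $\varepsilon$-concentrated on a measurable set $\mathcal{A}\subseteq\mathbb{R}^2$ if $\|h-\chi_{\mathcal{A}}h\|_{2,\mu}\le\varepsilon\|h\|_{2,\mu}$, i.e. $\left(\int_{\mathbb{R}^2\setminus\mathcal{A}}|h|^2\,d\lambda_\mu\right)^{1/2}\le\varepsilon\|h\|_{2,\mu}$, where $\chi_{\mathcal{A}}$ is the characteristic function of $\mathcal{A}$.
   Formalization: The formal theorem also assumes that f is not zero in L² and that ε_M + ε_N ≤ 1; without either one, M = N = ∅ is a counterexample (f = 0 with ε's 0, or any f with ε_M = ε_N = 2). *)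

(* Defs.v *)
From HB Require Import structures.
From mathcomp Require Import all_boot all_order all_algebra ring.
From mathcomp Require Import all_classical all_reals all_analysis. 
From mathcomp Require Import measurable_realfun.
Set Implicit Arguments.
Unset Strict Implicit.
Unset Printing Implicit Defensive.
Import Order.TTheory GRing.Theory Num.Theory.
Import numFieldNormedType.Exports.
Local Open Scope classical_set_scope.
Local Open Scope ring_scope.

Record quat (R : Type) := Quat { q0 : R; q1 : R; q2 : R; q3 : R }.
Arguments q0 {R} q.
Arguments q1 {R} q.
Arguments q2 {R} q.
Arguments q3 {R} q.

Section QuatChoice.
Variable R : Type.
Definition quat_tuple (q : quat R) := (q0 q, q1 q, q2 q, q3 q).
Definition tuple_quat (t : R * R * R * R) :=
  let: (a, b, c, d) := t in Quat a b c d.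
Lemma quat_tupleK : cancel quat_tuple tuple_quat.
Proof. by case. Qed.
End QuatChoice.

HB.instance Definition _ (R : eqType) :=
  Equality.copy (quat R) (can_type (@quat_tupleK R)).
HB.instance Definition _ (R : choiceType) :=
  Choice.copy (quat R) (can_type (@quat_tupleK R)).

Section QuatRing.
Variable R : comNzRingType.
Implicit Types p q r : quat R.

Definition quat_real (a : R) : quat R := Quat a 0 0 0.
Definition quat_add p q :=
  Quat (q0 p + q0 q) (q1 p + q1 q) (q2 p + q2 q) (q3 p + q3 q).
Definition quat_opp q := Quat (- q0 q) (- q1 q) (- q2 q) (- q3 q).

Lemma quat_addA : associative quat_add.
Proof. by move=> [????] [????] [????]; rewrite /quat_add /= !addrA. Qed.
Lemma quat_addC : commutative quat_add.
Proof. by move=> [????] [????]; congr Quat; rewrite /= addrC. Qed.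
Lemma quat_add0 : left_id (quat_real 0) quat_add.
Proof. by move=> [????]; rewrite /quat_add /= !add0r. Qed.
Lemma quat_addN : left_inverse (quat_real 0) quat_opp quat_add.
Proof. by move=> [????]; rewrite /quat_add /= !addNr. Qed.

HB.instance Definition _ :=
  GRing.isZmodule.Build (quat R) quat_addA quat_addC quat_add0 quat_addN.

Definition quat_mul p q :=
  Quat (q0 p * q0 q - q1 p * q1 q - q2 p * q2 q - q3 p * q3 q)
       (q0 p * q1 q + q1 p * q0 q + q2 p * q3 q - q3 p * q2 q)
       (q0 p * q2 q - q1 p * q3 q + q2 p * q0 q + q3 p * q1 q)
       (q0 p * q3 q + q1 p * q2 q - q2 p * q1 q + q3 p * q0 q).

Lemma quat_mulA : associative quat_mul.
Proof. by move=> [????] [????] [????]; congr Quat => /=; ring. Qed.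
Lemma quat_mul1l : left_id (quat_real 1) quat_mul.
Proof. by move=> [????]; congr Quat => /=; ring. Qed.
Lemma quat_mul1r : right_id (quat_real 1) quat_mul.
Proof. by move=> [????]; congr Quat => /=; ring. Qed.
Lemma quat_mulDl : left_distributive quat_mul +%R.
Proof. by move=> [????] [????] [????]; congr Quat => /=; ring. Qed.
Lemma quat_mulDr : right_distributive quat_mul +%R.
Proof. by move=> [????] [????] [????]; congr Quat => /=; ring. Qed.
Lemma quat_one_neq0 : quat_real 1 != 0.
Proof. by apply/eqP => -[] /eqP; rewrite oner_eq0. Qed.

HB.instance Definition _ := GRing.Zmodule_isNzRing.Build (quat R)
  quat_mulA quat_mul1l quat_mul1r quat_mulDl quat_mulDr quat_one_neq0.

Definition qi : quat R := Quat 0 1 0 0.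
Definition qj : quat R := Quat 0 0 1 0.
Definition qk : quat R := Quat 0 0 0 1.

Lemma quat_relations : [/\ qi * qi = -1, qj * qj = -1, qk * qk = -1
  & [/\ qi * qj = qk, qj * qk = qi & qk * qi = qj]].
Proof. by split; last split; congr Quat => /=; ring. Qed.

Definition qconj q := Quat (q0 q) (- q1 q) (- q2 q) (- q3 q).

Lemma mul_qconj q :
  q * qconj q = quat_real (q0 q ^+ 2 + q1 q ^+ 2 + q2 q ^+ 2 + q3 q ^+ 2).
Proof. by case: q => ????; congr Quat => /=; ring. Qed.

End QuatRing.
Arguments qi {R}.
Arguments qj {R}.
Arguments qk {R}.

(* [q * qconj q] is real by [mul_qconj], so taking [q0] loses nothing. *)
Definition qnorm (R : rcfType) (q : quat R) : R := Num.sqrt (q0 (q * qconj q)).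

(* The carrier is [measurableTypeR R] and not [R]: [lebesgue_measure] lives on
   the former, and the two have different measurability displays. *)
Notation plane R := (measurableTypeR R * measurableTypeR R)%type.

Section Dunkl.
Variable R : realType.
Implicit Types (mu x y : R) (v w : plane R) (f h F : plane R -> quat R).

Definition dunkl_weight mu v : R :=
  `|v.1 : R| `^ (2 * mu + 1) * `|v.2 : R| `^ (2 * mu + 1).

Lemma dunkl_weight_ge0 mu v : (0 <= (dunkl_weight mu v)%:E)%E.
Proof. by rewrite lee_fin mulr_ge0 ?powR_ge0. Qed.

Lemma measurable_dunkl_weight mu :
  measurable_fun [set: plane R] (EFin \o dunkl_weight mu).
Proof.
apply/measurable_EFinP; apply: measurable_funM.
- by apply: (measurableT_comp (measurable_powR _)); exact: measurableT_comp.
- by apply: (measurableT_comp (measurable_powR _)); exact: measurableT_comp.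
Qed.

Definition dunkl_measure mu (A : set (plane R)) : \bar R :=
  (\int[lebesgue_measure \x lebesgue_measure]_(v in A)
     (dunkl_weight mu v)%:E)%E.

Let dunkl_measure0 mu : dunkl_measure mu set0 = 0%E.
Proof. exact: integral_set0. Qed.

Let dunkl_measure_ge0 mu A : (0 <= dunkl_measure mu A)%E.
Proof. by apply: integral_ge0 => v _; exact: dunkl_weight_ge0. Qed.

Let dunkl_measure_sigma_additive mu : semi_sigma_additive (dunkl_measure mu).
Proof.
rewrite /dunkl_measure; apply: semi_sigma_additive_nng_induced.
- exact: measurable_dunkl_weight.
- exact: dunkl_weight_ge0.
Qed.

HB.instance Definition _ mu := isMeasure.Build _ _ _ (dunkl_measure mu)
  (dunkl_measure0 mu) (dunkl_measure_ge0 mu) (@dunkl_measure_sigma_additive mu).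

Definition dunkl_c mu : R :=
  (\int[lebesgue_measure]_(x in [set: R])
     (expR (- (x ^+ 2 / 2)) * `|x| `^ (2 * mu + 1)))^-1.

Definition Gamma x : R :=
  \int[lebesgue_measure]_(t in `]0, +oo[) (t `^ (x - 1) * expR (- t)).

Definition bessel_j mu x : R :=
  Gamma (mu + 1) * limn (series (fun n : nat =>
    (-1) ^+ n / (n`!%:R * Gamma (n%:R + mu + 1)) * (x / 2) ^+ (2 * n))).

(* [dunkl_E mu q x y] is E_mu(q x, y). *)
Definition dunkl_E mu (q : quat R) x y : quat R :=
  quat_real (bessel_j mu (x * y)) +
  q * quat_real (x * y / (2 * (mu + 1)) * bessel_j (mu + 1) (x * y)).

Definition quat_measurable f :=
  [/\ measurable_fun setT (q0 \o f), measurable_fun setT (q1 \o f),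
      measurable_fun setT (q2 \o f) & measurable_fun setT (q3 \o f)].

Definition dunkl_norm mu (p : \bar R) f : \bar R :=
  ('N[dunkl_measure mu]_p[EFin \o (@qnorm R \o f)])%E.

Definition dunkl_Lp mu (p : \bar R) f :=
  quat_measurable f /\ (dunkl_norm mu p f < +oo)%E.

Definition quat_integral mu f : quat R :=
  Quat (\int[dunkl_measure mu]_v q0 (f v)) (\int[dunkl_measure mu]_v q1 (f v))
       (\int[dunkl_measure mu]_v q2 (f v)) (\int[dunkl_measure mu]_v q3 (f v)).

Definition dunkl_transform mu f w : quat R :=
  quat_real (dunkl_c mu ^+ 2) *
  quat_integral mu (fun v =>
    dunkl_E mu qi (- w.1) v.1 * f v * dunkl_E mu qj (- w.2) v.2).

(* [F] represents the value at [f] of the continuous extension to L^2 of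
   [dunkl_transform] restricted to the intersection of L^1 and L^2; the
   isometry property is not part of the definition. *)
Definition is_dunkl_transform_L2 mu f F :=
  dunkl_Lp mu 2%:E F /\
  exists g : nat -> plane R -> quat R,
    [/\ forall n, dunkl_Lp mu 1%:E (g n) /\ dunkl_Lp mu 2%:E (g n),
        dunkl_norm mu 2%:E (fun v => g n v - f v) @[n --> \oo] --> 0%E
      & dunkl_norm mu 2%:E (fun w => dunkl_transform mu (g n) w - F w)
          @[n --> \oo] --> 0%E].

Definition concentrated mu (e : R) (A : set (plane R)) h :=
  (dunkl_norm mu 2%:E (fun v => (h v - quat_real (\1_A v) * h v)%R)
     <= e%:E * dunkl_norm mu 2%:E h)%E.

End Dunkl.

(* Main.v *)
Require Import Defs.
From HB Require Import structures.
From mathcomp Require Import all_boot all_order all_algebra.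
From mathcomp Require Import ring lra.
From mathcomp Require Import all_classical all_reals all_analysis.
From mathcomp Require Import measurable_realfun.
Set Implicit Arguments.
Unset Strict Implicit.
Unset Printing Implicit Defensive.
Import Order.TTheory GRing.Theory Num.Theory.
Import numFieldNormedType.Exports.
Local Open Scope classical_set_scope.
Local Open Scope ring_scope.

(** The inequality follows from two properties of the transform D, by the
    argument of Donoho and Stark: D preserves the L^2 norm, and |Dh| is at
    most c^2 |h|_1 everywhere, where c = c_mu. Take h to be f cut off to M.
    Since f is concentrated on M, the L^2 norm of Df - Dh is at most eM |f|,
    while Cauchy-Schwarz gives |Dh| <= c^2 |M|^(1/2) |f| everywhere. Cutting
    Df off to N now yields (1 - eN) |Df| <= eM |f| + c^2 |M|^(1/2) |N|^(1/2)
    |f|, and |Df| = |f| > 0 can be divided out ([donoho_stark]). If one of the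
    two sets is null while the other may have infinite measure, the
    concentration hypothesis forces the epsilon of the null set to be at least
    1, so that the right-hand side of the theorem is 0 ([concentrated_null]).

    The pointwise bound rests on |E_mu(q x, y)| <= 1. With A and B the even
    and odd parts of the kernel, |E_mu|^2 = A^2 + B^2, A' = - B and x B' = x A
    - (2 mu + 1) B, so that the derivative of A^2 + B^2 is - 2 (2 mu + 1) B^2
    / x, which is nonpositive on the positive half line ([dunkl_kernel_le1]).
    The relation for B' is the contiguity relation of Bessel functions, and it
    uses the functional equation of Gamma, which is derived here from Gaussian
    moments.

    The isometry is reduced to real functions. Replacing the quaternion units
    by 1 in the kernel gives the scalar transform H with kernel A + B in each
    variable; for mu = - 1/2 this is the Hartley transform, with kernel cos +
    sin. The values of Dg and of H on the four coordinates of g are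
    combinations of the same sixteen integrals, and summing squares over the
    four sign changes of the frequency removes all the cross terms: the sum of
    |Dg|^2 equals the sum of the squares of the four scalar transforms
    ([sum_axis_refl_dunkl]). As the measure is invariant under sign changes,
    the isometry of D follows from that of H ([dunkl_plancherel]).

    H maps x^b e^(- s x^2 / 2), with b = 0 or 1, to a multiple of the same
    function with 1/s in place of s: integrating the Bessel series term by
    term, the Gamma factors cancel and the exponential series remains
    ([hartley_gauss_mono]). Explicit Gaussian integrals then show that H is
    isometric on the span of products of such functions ([gspan_sqint]). This
    span is dense for the sum of the L^1 norm and the squared L^2 norm
    ([gspan_dense]), and H passes to limits by the uniform bound, Fatou's
    lemma and an approximate triangle inequality ([hartley_isometry]).

    For the density, the closure of the span is stable under pointwise limits
    dominated by an integrable and square-integrable function. Difference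
    quotients in s produce all x^n e^(- s x^2 / 2), the exponential series
    produces translated Gaussians u(x) = e^(- s (x - y)^2), and Stone's
    polynomials 1 - (1 - u^n)^(n 2^n) converge to the indicator function of
    the interval where u >= 1/2. A Dynkin class argument extends this to
    bounded Borel sets, first in each variable and then in the plane, and
    simple functions finish the proof. *)

Lemma le_of_eq d (T : porderType d) (x y : T) : x = y -> (x <= y)%O.
Proof. by move=> ->. Qed.

(** * Gaussian moments and the Gamma function *)

Section GaussianMoments.
Variable R : realType.
Implicit Types (p s t d x : R).
Notation leb := (@lebesgue_measure R).

Lemma powR_gt0E p x : 0 < x -> x `^ p = expR (p * ln x).
Proof. by move=> x0; rewrite /powR gt_eqF. Qed.

(** A single term of the exponential series of d x^2 is enough for large x, and
    the constant 1 for small x. *)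
Lemma powR_norm_le_expR p d : 0 <= p -> 0 < d ->
  exists2 C, 0 <= C & forall x, `|x| `^ p <= C * expR (d * x ^+ 2).
Proof.
(* An integer m >= p: for |x| > 1 the power is at most (x^2)^m. *)
move=> p0 d0; set m := (Num.truncn p).+1.
have pm : p <= m%:R by rewrite ltW// truncnS_gt.
have C0 : 0 <= m`!%:R / d ^+ m by rewrite divr_ge0 // exprn_ge0 // ltW.
exists (1 + m`!%:R / d ^+ m); first by rewrite addr_ge0.
move=> x; have e1 : 1 <= expR (d * x ^+ 2).
  by rewrite -expR0 ler_expR mulr_ge0 ?sqr_ge0 // ltW.
have [x1|x1] := leP `|x| 1.
  apply: (@le_trans _ _ 1); last by rewrite -[leLHS]mulr1 ler_pM // lerDl.
  have [->|xn0] := eqVneq x 0.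
    rewrite normr0 /powR eqxx; case: eqP => //.
  have <- : 1 `^ p = 1 :> R by rewrite powR1.
  by apply: ge0_ler_powR; rewrite // ?nnegrE.
have x2 : `|x| `^ p <= (x ^+ 2) ^+ m.
  rewrite (le_trans (ler_powR (ltW x1) pm))// powR_mulrn // -exprM -normrX.
  by rewrite mulnC exprM -[leRHS]ger0_norm ?sqr_ge0 // !normrX -exprM ler_eXn2l // leq_pmulr.
rewrite (le_trans x2)// mulrDl -[leLHS]add0r lerD ?mul1r ?expR_ge0//.
have := @expR_ge1Dxn R (d * x ^+ 2) (Num.truncn p).
rewrite -/m => /(_ (mulr_ge0 (ltW d0) (sqr_ge0 _))) h.
have {}h : (d * x ^+ 2) ^+ m / m`!%:R <= expR (d * x ^+ 2).
  by rewrite (le_trans _ h) // lerDr.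
rewrite (le_trans _ (ler_wpM2l C0 h)) // exprMn le_eqVlt; apply/orP; left.
have dm0 : d ^+ m != 0 by rewrite gt_eqF // exprn_gt0.
have fm0 : m`!%:R != 0 :> R by rewrite pnatr_eq0 -lt0n fact_gt0.
apply/eqP; rewrite (mulrC (_ ^+ m) _^-1) mulrA [_ / _ / _]mulrAC divff // mul1r.
by rewrite exprMn mulrA mulVf // mul1r expr2 exprMn.
Qed.

Lemma integrable_expR_sqr d : 0 < d ->
  leb.-integrable setT (fun x => (expR (- (d * x ^+ 2)))%:E).
Proof.
move=> d0; set s := Num.sqrt ((2 * d)^-1).
have s2 : s ^+ 2 = (2 * d)^-1 by rewrite sqr_sqrtr // invr_ge0 mulr_ge0 // ltW.
have s0 : s != 0 by rewrite gt_eqF // sqrtr_gt0 invr_gt0 mulr_gt0.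
have := integrableZl measurableT (normal_peak s)^-1 (integrable_normal_pdf 0 s).
apply: eq_integrable => // x _; rewrite -EFinM normal_pdfE // mulKf; last first.
  by rewrite gt_eqF // normal_peak_gt0.
rewrite /normal_fun subr0 s2; congr (expR _)%:E.
by field; rewrite gt_eqF.
Qed.

(** The integrands of all the moments below; the weight of the measure is the
    factor with exponent [p = 2 * mu + 1]. *)
Definition absgauss p t x := `|x| `^ p * expR (- (t * x ^+ 2 / 2)).

Lemma absgauss_ge0 p t x : 0 <= absgauss p t x.
Proof. by rewrite mulr_ge0 ?powR_ge0 ?expR_ge0. Qed.

Lemma absgaussN p t x : absgauss p t (- x) = absgauss p t x.
Proof. by rewrite /absgauss normrN sqrrN. Qed.

Lemma measurable_expR_sqr d :
  measurable_fun [set: measurableTypeR R] (fun x : R => expR (- (d * x ^+ 2 / 2))).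
Proof.
apply: measurableT_comp => //; apply: measurableT_comp => //.
by apply: measurable_funM => //; apply: measurable_funM.
Qed.

Lemma measurable_absgauss p t :
  measurable_fun [set: measurableTypeR R] (absgauss p t).
Proof.
apply: measurable_funM; last exact: measurable_expR_sqr.
by apply: (measurableT_comp (measurable_powR _)); exact: normr_measurable.
Qed.

Lemma integrable_absgauss p t : 0 <= p -> 0 < t ->
  leb.-integrable setT (fun x => (absgauss p t x)%:E).
Proof.
move=> p0 t0; have [C C0 hC] := @powR_norm_le_expR p (t / 4) p0 (divr_gt0 t0 (ltr0Sn _ 3)).
have := integrableZl measurableT C (integrable_expR_sqr (divr_gt0 t0 (ltr0Sn _ 3))).
apply: le_integrable => //.
  by apply/measurable_EFinP; exact: measurable_absgauss.
move=> x _; rewrite -EFinM lee_fin !ger0_norm ?absgauss_ge0 ?mulr_ge0 ?expR_ge0 //.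
rewrite /absgauss; have := ler_wpM2r (expR_ge0 (- (t * x ^+ 2 / 2))) (hC x).
move=> h; apply: (le_trans h); rewrite -(mulrA C) -expRD.
by rewrite ler_wpM2l // ler_expR; apply: le_of_eq; field.
Qed.

Lemma ge0_even_integral (f : R -> R) :
  measurable_fun [set: measurableTypeR R] f -> (forall x, 0 <= f x) -> (forall x, f (- x) = f x) ->
  (\int[leb]_x (f x)%:E = 2%:E * \int[leb]_(x in `]0%R, +oo[) (f x)%:E)%E.
Proof.
move=> mf f0 fN.
have mEf (A : set R) : measurable_fun (A : set (measurableTypeR R)) (fun x => (f x)%:E).
  exact/measurable_funTS/measurable_EFinP.
have -> : [set: R] = `]-oo, 0%R[%classic `|` `[0%R, +oo[%classic.
  by apply/seteqP; split => x //= _; rewrite !in_itv /= andbT; apply/orP; case: leP.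
rewrite ge0_integral_setU //=; last 2 first.
  by move=> x _; rewrite lee_fin.
  apply/disj_setPS => x /= []; rewrite !in_itv /= andbT => h1 h2.
  by move: (lt_le_trans h1 h2); rewrite ltxx.
rewrite integral_itv_bndo_bndc; last exact: mEf.
rewrite -(integral_itv_obnd_cbnd (mEf _)).
have := @ge0_integration_by_substitution0 R (fun x => (f x)%:E).
move=> /(_ (mEf _) (fun r => f0 r)).
under [X in _ = X -> _]eq_integral do rewrite fN.
rewrite -(integral_itv_obnd_cbnd (mEf _)) => <-.
by rewrite mule_natl mule2n.
Qed.

Lemma itv0y_bigcup : `]0, +oo[%classic =
  \bigcup_n `[n.+1%:R^-1, n.+1%:R]%classic :> set R.
Proof.
apply/seteqP; split=> x /=; rewrite in_itv /= ?andbT.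
  move=> x0; have ax : 0 <= x + x^-1 by rewrite addr_ge0 // ?invr_ge0 ltW.
  exists (Num.truncn (x + x^-1)) => //=.
  have h := truncnS_gt (x + x^-1).
  rewrite in_itv /=; apply/andP; split; last first.
    by rewrite (le_trans _ (ltW h)) // lerDl invr_ge0 ltW.
  rewrite -[leRHS]invrK lef_pV2 ?posrE ?invr_gt0 ?ltr0Sn //.
  by rewrite (le_trans _ (ltW h)) // lerDr ltW.
move=> [n _] /=; rewrite in_itv /= => /andP[h _].
by rewrite (lt_le_trans _ h) // invr_gt0 ltr0Sn.
Qed.

Lemma nd_itv0y : {homo (fun n => (`[n.+1%:R^-1, n.+1%:R]%classic : set R))
   : n m / (n <= m)%N >-> (n <= m)%O}.
Proof.
move=> n m nm; rewrite subsetEset => x /=; rewrite !in_itv /= => /andP[h1 h2].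
apply/andP; split.
  by rewrite (le_trans _ h1) // lef_pV2 ?posrE ?ltr0Sn // ler_nat.
by rewrite (le_trans h2) // ler_nat.
Qed.

(** Change of variables by the map sending x to [t * x ^+ 2 / 2] on the compact
    intervals from 1/(n+1) to n+1, followed by monotone convergence on both
    sides. *)
Lemma ge0_integral_subst_sqr t (G : R -> R) : 0 < t ->
  measurable_fun [set: measurableTypeR R] G ->
  (forall x, 0 <= G x) -> (forall x, 0 < x -> {for x, continuous G}) ->
  (\int[leb]_(x in `]0%R, +oo[) (G x)%:E =
   \int[leb]_(x in `]0%R, +oo[) (G (t * x ^+ 2 / 2) * (t * x))%:E)%E.
Proof.
move=> t0 mG G0 cG; pose F x := t * x ^+ 2 / 2.
have dF x : is_derive x (1:R) F (t * x).
  by apply: is_derive_eq; rewrite /GRing.scale /= ; field.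
have F' : F^`()%classic = (fun x => t * x).
  by apply/funext => x; rewrite derive1E; have [_ ->] := dF x.
pose H n : set R := `[F n.+1%:R^-1, F n.+1%:R]%classic.
have Finc x y : 0 <= x -> x < y -> F x < F y.
  move=> x0 xy; rewrite ltr_pM2r ?invr_gt0 // ltr_pM2l // ltr_pXn2r //.
  by rewrite nnegrE ltW // (le_lt_trans x0).
have Fle x y : 0 <= x -> x <= y -> F x <= F y.
  by move=> x0; rewrite le_eqVlt => /predU1P[->//|xy]; rewrite ltW // Finc.
have inv0 n : 0 < n.+1%:R^-1 :> R by rewrite invr_gt0 ltr0Sn.
have UH : `]0, +oo[%classic = \bigcup_n H n.
  apply/seteqP; split=> y /=; rewrite in_itv /= ?andbT.
    move=> y0; have : `]0, +oo[%classic (Num.sqrt (2 * y / t)).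
      by rewrite /= in_itv /= andbT sqrtr_gt0 divr_gt0 // mulr_gt0.
    rewrite itv0y_bigcup => -[n _] /=; rewrite in_itv /= => /andP[h1 h2].
    exists n => //; rewrite /H /= in_itv /=.
    have -> : y = F (Num.sqrt (2 * y / t)).
      rewrite /F sqr_sqrtr; first by field; rewrite gt_eqF.
      by rewrite ltW // divr_gt0 // mulr_gt0.
    by rewrite !Fle // ?sqrtr_ge0 // ltW.
  move=> [n _] /=; rewrite /H /= in_itv /= => /andP[h _].
  by rewrite (lt_le_trans _ h) // divr_gt0 // mulr_gt0 // exprn_gt0.
have ndH : {homo H : n m / (n <= m)%N >-> (n <= m)%O}.
  move=> n m nm; rewrite subsetEset => x /=; rewrite /H /= !in_itv /= => /andP[h1 h2].
  apply/andP; split.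
    apply: (le_trans _ h1); apply: Fle; first exact/ltW.
    by rewrite lef_pV2 ?posrE ?ltr0Sn // ler_nat.
  by rewrite (le_trans h2) // Fle // ler_nat.
pose g x := G (t * x ^+ 2 / 2) * (t * x).
have mg : measurable_fun [set: measurableTypeR R] g.
  apply: measurable_funM; last exact: measurable_funM.
  apply: (measurableT_comp mG); apply: measurable_funM => //.
  exact: measurable_funM.
have L1 := @ge0_nondecreasing_set_cvg_integral _ (measurableTypeR R) R H (fun x => (G x)%:E) leb ndH.
have L2 := @ge0_nondecreasing_set_cvg_integral _ (measurableTypeR R) R _ (fun x => (g x)%:E) leb nd_itv0y.
rewrite {1}UH itv0y_bigcup.
have {}L1 := L1 (fun n => measurable_itv _) (fun n => measurable_funTS ((measurable_EFinP _ _).2 mG)) (fun n x _ => G0 x).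
have {}L2 := L2 (fun n => measurable_itv _) (fun n => measurable_funTS ((measurable_EFinP _ _).2 mg)).
have {}L2 : (\int[leb]_(x in `[n.+1%:R^-1%R, n.+1%:R%R]) (g x)%:E)%E @[n --> \oo] -->
    (\int[leb]_(x in \bigcup_n `[n.+1%:R^-1%R, n.+1%:R%R]%classic) (g x)%:E)%E.
  apply: L2 => n x /=; rewrite in_itv /= => /andP[h _].
  by rewrite lee_fin mulr_ge0 // mulr_ge0 ?(ltW t0) // ltW // (lt_le_trans _ h).
apply: (cvg_unique _ L1) => //; apply: cvg_trans L2; apply: near_eq_cvg.
near=> n; have nn : n.+1%:R^-1 <= n.+1%:R :> R.
  by rewrite (@le_trans _ _ 1) ?invf_le1 ?ltr0Sn ?ler1n.
have cF x : {for x, continuous F}.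
  by apply/differentiable_continuous/derivable1_diffP; have [] := dF x.
have cF' x : {for x, continuous (fun y => t * y)}.
  by apply: continuousM => //; exact: cst_continuous.
rewrite /H (integration_by_substitution_increasing nn).
- by apply: eq_integral => x _; rewrite F'.
- move=> x y; rewrite !in_itv /= => /andP[hx _] _ xy; apply: Finc => //.
  by rewrite (le_trans _ hx) // ltW.
- by rewrite F' => x _; exact: cF'.
- by rewrite F'; apply/cvg_ex; exists (t * n.+1%:R^-1); exact/cvg_at_right_filter/cF'.
- by rewrite F'; apply/cvg_ex; exists (t * n.+1%:R); exact/cvg_at_left_filter/cF'.
- split; first by move=> x _; have [] := dF x.
    exact/cvg_at_right_filter/cF.
  exact/cvg_at_left_filter/cF.
- apply: continuous_in_subspaceT => x; rewrite inE /= in_itv /= => /andP[h _].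
  by apply: cG; rewrite (lt_le_trans _ h) // divr_gt0 // mulr_gt0 // exprn_gt0.
Unshelve. all: by end_near.
Qed.

Definition gamma_fun s u := u `^ (s - 1) * expR (- u).

Lemma measurable_gamma_fun s : measurable_fun [set: measurableTypeR R] (gamma_fun s).
Proof.
apply: measurable_funM; first exact: (measurable_powR (s - 1)).
by apply: measurableT_comp => //; exact: measurableT_comp.
Qed.

(** Substituting [u = t * x ^+ 2 / 2] in the Gamma integral gives, up to a power
    of 2 / t, the part of this moment on the positive half line. It makes the
    Gamma function accessible through integrals over the whole line. *)
Lemma integral_absgauss_Gamma s t : 2^-1 <= s -> 0 < t ->
  (\int[leb]_x (absgauss (2 * s - 1) t x)%:E = ((2 / t) `^ s * Gamma s)%:E)%E.
Proof.
move=> s0 t0.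
have s1 : 0 <= 2 * s - 1 by lra.
have G0 x : 0 <= gamma_fun s x by rewrite mulr_ge0 ?powR_ge0 ?expR_ge0.
have E1 : (\int[leb]_x (absgauss (2 * s - 1) t x)%:E =
    ((2 / t) `^ s)%:E * \int[leb]_(u in `]0%R, +oo[) (gamma_fun s u)%:E)%E.
  rewrite (ge0_even_integral (measurable_absgauss _ _) (absgauss_ge0 _ _) (absgaussN _ _)).
  rewrite (ge0_integral_subst_sqr t0 (measurable_gamma_fun s) G0); last first.
    move=> x x0; apply: continuousM.
      apply/differentiable_continuous/derivable1_diffP/derivable_powR.
      by rewrite in_itv /= andbT.
    apply: (@continuous_comp _ _ _ -%R expR); first exact: continuousN.
    exact: continuous_expR.
  rewrite -!ge0_integralZl_EFin ?powR_ge0 //=.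
  - apply: eq_integral => x; rewrite inE /= in_itv /= andbT => x0.
    rewrite -!EFinM; congr EFin; rewrite /gamma_fun /absgauss gtr0_norm //.
    rewrite -(mulrA ((t * x ^+ 2 / 2) `^ _)) (mulrC (expR _)) !mulrA; congr (_ * _).
    have y0 : 0 < t * x ^+ 2 / 2 by rewrite divr_gt0 // mulr_gt0 // exprn_gt0.
    rewrite !powR_gt0E ?divr_gt0 //.
    rewrite (ln_div (_ : 2 \in Num.pos)) ?posrE // ln_div ?posrE ?mulr_gt0 //.
    rewrite !lnM ?posrE ?mulr_gt0 //.
    have E2 : expR (ln 2) = 2 :> R by rewrite lnK // posrE.
    have Et : expR (ln t) = t by rewrite lnK // posrE.
    have Ex : expR (ln x) = x by rewrite lnK // posrE.
    rewrite -[X in X * _ = _]E2 -[X in _ = _ * X * _]Et -[X in _ = _ * X]Ex.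
    rewrite -!expRD; congr expR; ring.
    by rewrite mulr_gt0 // mulr_gt0.
  - by move=> x; rewrite in_itv /= andbT => x0; rewrite lee_fin mulr_ge0 // mulr_ge0 ?ltW.
  - apply/measurable_funTS/measurable_EFinP/measurable_funM; last exact: measurable_funM.
    apply: (measurableT_comp (measurable_gamma_fun s)); apply: measurable_funM => //.
    exact: measurable_funM.
  - by move=> x _; rewrite lee_fin absgauss_ge0.
  - by apply/measurable_funTS/measurable_EFinP; exact: measurable_absgauss.
have fin := integrable_fin_num measurableT (integrable_absgauss s1 t0).
rewrite E1 EFinM; congr (_ * _)%E; rewrite -[LHS]fineK //.
have t2 : 0 < (2 / t) `^ s by rewrite powR_gt0 // divr_gt0.
move: fin; rewrite E1; case: (X in (_ * X)%E) => [r||] //.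
  by rewrite gt0_muley.
by rewrite gt0_muleNy.
Qed.

Lemma gauss_moment_fin p t : 0 <= p -> 0 < t ->
  \int[leb]_x absgauss p t x = ((2 / t) `^ ((p + 1) / 2) * Gamma ((p + 1) / 2)).
Proof.
move=> p0 t0; rewrite /Rintegral -[p in absgauss p](_ : 2 * ((p + 1) / 2) - 1 = p); last by field.
by rewrite integral_absgauss_Gamma //; lra.
Qed.

Lemma gauss_moment_gt0 p t : 0 <= p -> 0 < t -> 0 < \int[leb]_x absgauss p t x.
Proof.
move=> p0 t0.
have mE (A : set R) : measurable_fun (A : set (measurableTypeR R)) (fun x => (absgauss p t x)%:E).
  by apply/measurable_funTS/measurable_EFinP; exact: measurable_absgauss.
(* On the interval from 1 to 2 the integrand is at least exp(- 2 t). *)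
have le1 : ((expR (- (2 * t)))%:E <= \int[leb]_x (absgauss p t x)%:E)%E.
  apply: (@le_trans _ _ (\int[leb]_(x in `[1%R, 2%R]) (absgauss p t x)%:E)%E); last first.
    by apply: ge0_subset_integral => //= x _; rewrite lee_fin absgauss_ge0.
  apply: (@le_trans _ _ (\int[leb]_(x in `[1%R, 2%R]) (expR (- (2 * t)))%:E)%E).
    rewrite integral_cst //= lebesgue_measure_itv /= lte_fin ltr1n.
    have E21 : (2 - 1 : R) = 1 by ring.
    by rewrite -EFinB E21 mule1.
  apply: ge0_le_integral => //=.
  - move=> x; rewrite in_itv /= => /andP[x1 x2]; rewrite lee_fin /absgauss.
    rewrite ger0_norm ?(le_trans ler01) // -[leLHS]mul1r ler_pM ?expR_ge0 //.
      by rewrite -[leLHS](powRr0 x) ler_powR.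
    rewrite ler_expR lerN2 -mulrA mulrC ler_wpM2r ?(ltW t0) //.
    have : x ^+ 2 <= 2 * 2 by rewrite expr2 ler_pM // (le_trans ler01).
    lra.
rewrite -lte_fin fineK; last exact: integrable_fin_num (integrable_absgauss p0 t0).
by rewrite (lt_le_trans _ le1) // lte_fin expR_gt0.
Qed.

(** A Gaussian moment is positive, and it is a positive multiple of Gamma. *)
Lemma Gamma_gt0 s : 2^-1 <= s -> 0 < Gamma s.
Proof.
move=> hs; have p0 : 0 <= 2 * s - 1 by lra.
have := gauss_moment_gt0 p0 (@ltr01 R); rewrite gauss_moment_fin //.
have -> : (2 * s - 1 + 1) / 2 = s by field.
by rewrite pmulr_rgt0 // powR_gt0 // divr_gt0.
Qed.

(** Integration by parts: the difference of the two sides integrates the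
    derivative of [- x `^ (p + 1) * expR (- (x ^+ 2 / 2))], whose boundary terms
    at 1/(n+1) and n+1 tend to 0. *)
Lemma absgauss_rec p : 0 <= p ->
  \int[leb]_x absgauss (p + 2) 1 x = (p + 1) * \int[leb]_x absgauss p 1 x.
Proof.
move=> p0.
(* The factor 1 is the parameter of the Gaussian, kept to match [absgauss]. *)
pose F x := - (x `^ (p + 1) * expR (- (1 * x ^+ 2 / 2))).
pose I n : set R := `[n.+1%:R^-1, n.+1%:R]%classic.
have inv0 n : 0 < n.+1%:R^-1 :> R by rewrite invr_gt0 ltr0Sn.
have int q (q0 : 0 <= q) A : measurable A -> leb.-integrable A (EFin \o absgauss q 1).
  by move=> mA; apply: integrableS (integrable_absgauss q0 ltr01).
have dF x : 0 < x -> is_derive x (1 : R) F (absgauss (p + 2) 1 x - (p + 1) * absgauss p 1 x).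
  move=> x0; have d1 : is_derive x (1 : R) (fun y => y `^ (p + 1)) ((p + 1) * x `^ p).
    have x0' : x \in `]0, +oo[ by rewrite in_itv /= andbT.
    apply: DeriveDef; first exact: derivable_powR.
    by rewrite -derive1E powR_derive1 // addrK.
  have d2 : is_derive x (1 : R) (fun y => expR (- (1 * y ^+ 2 / 2))) (- x * expR (- (1 * x ^+ 2 / 2))).
    by apply: is_derive_eq; rewrite /GRing.scale /=; field.
  have d3 := is_deriveN (is_deriveM d1 d2).
  apply: (is_derive_eq d3); rewrite /GRing.scale /= /absgauss gtr0_norm //.
  have -> : x `^ (p + 2) = x * x `^ (p + 1).
    rewrite -{2}[x]powRr1 ?ltW // -powRD ?(gt_eqF x0) ?implybT //; congr (_ `^ _); ring.
  ring.
have L q (q0 : 0 <= q) : \int[leb]_(x in I n) absgauss q 1 x @[n --> \oo] --> \int[leb]_x absgauss q 1 x / 2.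
  have := @ge0_nondecreasing_set_cvg_integral _ (measurableTypeR R) R I (fun x => (absgauss q 1 x)%:E) leb nd_itv0y.
  move=> /(_ (fun n => measurable_itv _)) h.
  have {h} := h (fun n => measurable_funTS ((measurable_EFinP _ _).2 (measurable_absgauss q 1)))
    (fun n x _ => absgauss_ge0 q 1 x).
  rewrite -itv0y_bigcup => h.
  have E := ge0_even_integral (measurable_absgauss q 1) (absgauss_ge0 q 1) (absgaussN q 1).
  rewrite /Rintegral E fineM //; last first.
    apply: integrable_fin_num => //; exact: int.
  rewrite /= mulrAC mulfV // mul1r; apply: fine_cvg; rewrite fineK // .
  apply: integrable_fin_num => //; exact: int.
have p20 : 0 <= p + 2 by lra.
have L' : (\int[leb]_(x in I n) absgauss (p + 2) 1 x -
    (p + 1) * \int[leb]_(x in I n) absgauss p 1 x) @[n --> \oo] -->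
    \int[leb]_x absgauss (p + 2) 1 x / 2 - (p + 1) * (\int[leb]_x absgauss p 1 x / 2).
  by apply: cvgB; [exact: L|apply: cvgM; [exact: cvg_cst|exact: L]].
suff Z : (\int[leb]_(x in I n) absgauss (p + 2) 1 x -
    (p + 1) * \int[leb]_(x in I n) absgauss p 1 x) @[n --> \oo] --> (0 : R).
  have : 0 = \int[leb]_x absgauss (p + 2) 1 x / 2 - (p + 1) * (\int[leb]_x absgauss p 1 x / 2).
    by rewrite -(cvg_lim (@Rhausdorff R) L') (cvg_lim (@Rhausdorff R) Z).
  rewrite mulrA -mulrBl => /esym/eqP.
  by rewrite mulf_eq0 invr_eq0 pnatr_eq0 orbF subr_eq0 => /eqP.
have [C C0 hC] := @powR_norm_le_expR (p + 2) 2^-1 p20 (ltac:(by rewrite invr_gt0)).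
have pS x : 0 < x -> x `^ (p + 2) = x * x `^ (p + 1).
  move=> x0; rewrite -{2}[x]powRr1 ?ltW // -powRD ?(gt_eqF x0) ?implybT //; congr (_ `^ _); ring.
have E n : \int[leb]_(x in I n) absgauss (p + 2) 1 x -
    (p + 1) * \int[leb]_(x in I n) absgauss p 1 x = F n.+1%:R - F n.+1%:R^-1.
  have mI : measurable (I n : set (measurableTypeR R)) by exact: measurable_itv.
  rewrite -(RintegralZl _ mI (int _ p0 _ mI)).
  rewrite -(RintegralB mI (int _ p20 _ mI)); last first.
    by have := integrableZl mI (p + 1) (int _ p0 _ mI); apply: eq_integrable.
  have [->|n0] := posnP n.
    rewrite /I invr1 subrr /Rintegral.
    by rewrite set_itv1 integral_set1.
  have ab : n.+1%:R^-1 < n.+1%:R :> R.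
    rewrite -subr_gt0 (@lt_le_trans _ _ (n.+1%:R - 1)) ?subr_gt0 ?ltr1n // lerB //.
    by rewrite invf_le1 ?ltr0Sn ?ler1n.
  pose f x := absgauss (p + 2) 1 x - (p + 1) * absgauss p 1 x.
  have cP q x : 0 < x -> {for x, continuous (absgauss q 1)}.
    move=> x0; apply/differentiable_continuous/derivable1_diffP.
    apply: (@near_eq_derivable _ _ _ (fun y => y `^ q * expR (- (1 * y ^+ 2 / 2)))) => //.
      by near=> y; rewrite /absgauss gtr0_norm //; near: y; exact: lt_nbhsr.
    apply: derivableM => //; apply: derivable_powR; by rewrite in_itv /= andbT.
  have cF x : 0 < x -> {for x, continuous F}.
    by move=> x0; apply/differentiable_continuous/derivable1_diffP; have [] := dF x x0.
  have := @continuous_FTC2 R f F _ _ ab; rewrite /Rintegral => -> //.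
  - apply: continuous_in_subspaceT => x; rewrite inE /= in_itv /= => /andP[h _].
    have x0 : 0 < x by rewrite (lt_le_trans _ h).
    apply: continuousB; first exact: cP.
    by apply: continuousM; [exact: cst_continuous|exact: cP].
  - split.
    + move=> x; rewrite in_itv /= => /andP[h _].
      by have [] := dF x (lt_trans (inv0 n) h).
    + by apply/cvg_at_right_filter/cF; rewrite inv0.
    + by apply/cvg_at_left_filter/cF; rewrite ltr0Sn.
  - move=> x; rewrite in_itv /= => /andP[h _].
    by rewrite derive1E; have [_ ->] := dF x (lt_trans (inv0 n) h).
(* At n+1 the power is absorbed by half of the Gaussian, one factor x being
   used for the rate 1/(n+1); at 1/(n+1) the power itself is at most 1/(n+1). *)
have bnd n : `|F n.+1%:R - F n.+1%:R^-1| <= (C + 1) * harmonic n.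
  have b0 : 0 < n.+1%:R :> R by rewrite ltr0Sn.
  rewrite (le_trans (ler_normB _ _)) // mulrDl lerD //.
    rewrite normrN ger0_norm ?mulr_ge0 ?powR_ge0 ?expR_ge0 //.
    rewrite /harmonic ler_pdivlMr // mulrAC [_ * n.+1%:R]mulrC -pS //.
    rewrite -[X in X `^ _]gtr0_norm // (le_trans (ler_wpM2r (expR_ge0 _) (hC _))) //.
    by rewrite -(mulrA C) -expRD mul1r (mulrC 2^-1) subrr expR0 mulr1.
  rewrite normrN ger0_norm ?mulr_ge0 ?powR_ge0 ?expR_ge0 // mul1r.
  rewrite -[leRHS]mulr1 ler_pM ?powR_ge0 ?expR_ge0 //.
    rewrite mul1r; apply: ge1r_powR; last by rewrite lerDr.
    by rewrite inv0 /= invf_le1 ?ltr0Sn ?ler1n.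
have H0 : (C + 1) * harmonic n @[n --> \oo] --> (0 : R).
  by rewrite -(mulr0 (C + 1)); apply: cvgM; [exact: cvg_cst|exact: cvg_harmonic].
apply: (@squeeze_cvgr _ _ _ _ (fun n => - ((C + 1) * harmonic n)) (fun n => (C + 1) * harmonic n)).
- by apply: nearW => n; rewrite E -ler_norml.
- by rewrite -oppr0; apply: cvgN.
- exact: H0.
Unshelve. all: by end_near.
Qed.

(** The functional equation, read off from the recursion of Gaussian moments. *)
Lemma GammaD1 s : 2^-1 <= s -> Gamma (s + 1) = s * Gamma s.
Proof.
move=> hs; have p0 : 0 <= 2 * s - 1 by lra.
have p2 : 0 <= 2 * s - 1 + 2 by lra.
have := absgauss_rec p0; rewrite !gauss_moment_fin //.
have -> : (2 * s - 1 + 2 + 1) / 2 = s + 1 by field.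
have -> : (2 * s - 1 + 1) / 2 = s by field.
have t0 : 0 < (2 / 1 : R) by rewrite divr_gt0.
have u0 : 0 < (2 / 1 : R) `^ s by rewrite powR_gt0.
rewrite powRD ?(gt_eqF t0) ?implybT // powRr1 ?(ltW t0) // => h.
apply: (mulfI (lt0r_neq0 u0)); lra.
Qed.
End GaussianMoments.

(** * The Bessel series and the bound of the Dunkl kernel *)

Section BesselKernel.
Variable R : realType.
Implicit Types (a s t d x : R).

(** With a = mu + 1, this is up to sign the coefficient of x^(2 n) in the
    normalized Bessel function j_mu; in terms of a, differentiation and
    contiguity only shift the parameter by 1. *)
Definition bessel_coef a n : R := Gamma a / (n`!%:R * Gamma (n%:R + a) * 4 ^+ n).

Lemma bessel_coef0 a : 2^-1 <= a -> bessel_coef a 0 = 1.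
Proof.
move=> ha; have G0 := Gamma_gt0 ha.
by rewrite /bessel_coef fact0 expr0 mulr1 mul1r add0r divff // gt_eqF.
Qed.

Lemma ge_half_addn a n : 2^-1 <= a -> 2^-1 <= n%:R + a.
Proof. by move=> ha; rewrite (le_trans ha) // lerDr. Qed.

Lemma bessel_coef_gt0 a n : 2^-1 <= a -> 0 < bessel_coef a n.
Proof.
move=> ha; by rewrite divr_gt0 ?mulr_gt0 ?Gamma_gt0 ?ge_half_addn ?exprn_gt0 // ltr0n fact_gt0.
Qed.

Lemma bessel_coefS a n : 2^-1 <= a ->
  bessel_coef a n.+1 = bessel_coef a n / (4 * n.+1%:R * (n%:R + a)).
Proof.
move=> ha; rewrite /bessel_coef factS natrM exprS.
have -> : n.+1%:R + a = (n%:R + a) + 1 by rewrite -natr1; ring.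
have hn := ge_half_addn n ha.
rewrite GammaD1 //.
have e1 := lt0r_neq0 (Gamma_gt0 hn).
have e2 : n%:R + a != 0 by rewrite gt_eqF // (lt_le_trans _ hn) // invr_gt0.
have e3 : n`!%:R != 0 :> R by rewrite pnatr_eq0 -lt0n fact_gt0.
have e4 : n.+1%:R != 0 :> R by rewrite pnatr_eq0.
have e5 : 4 ^+ n != 0 :> R by rewrite expf_neq0.
rewrite -natr1 in e4 *.
by field; rewrite e1 e2 e3 e4 e5.
Qed.

Lemma bessel_coef_shift a n : 2^-1 <= a -> a * bessel_coef a n = (a + n%:R) * bessel_coef (a + 1) n.
Proof.
move=> ha; have hn := ge_half_addn n ha.
rewrite /bessel_coef addrA (GammaD1 ha) (GammaD1 hn).
have e1 := lt0r_neq0 (Gamma_gt0 hn).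
have e2 : n%:R + a != 0 by rewrite gt_eqF // (lt_le_trans _ hn) // invr_gt0.
have e3 : n`!%:R != 0 :> R by rewrite pnatr_eq0 -lt0n fact_gt0.
have e5 : 4 ^+ n != 0 :> R by rewrite expf_neq0.
by field; rewrite e1 e2 e3 e5.
Qed.

(** On coefficients, differentiation in z = x^2 raises the parameter by one. *)
Lemma bessel_coef_diff a n : 2^-1 <= a ->
  n.+1%:R * bessel_coef a n.+1 = bessel_coef (a + 1) n / (4 * a).
Proof.
move=> ha; have hn := ge_half_addn n ha.
have a0 : a != 0 by rewrite gt_eqF // (lt_le_trans _ ha) // invr_gt0.
have e2 : n%:R + a != 0 by rewrite gt_eqF // (lt_le_trans _ hn) // invr_gt0.
have e4 : n.+1%:R != 0 :> R by rewrite pnatr_eq0.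
have -> : bessel_coef (a + 1) n = a * bessel_coef a n / (a + n%:R).
  by rewrite bessel_coef_shift // mulrAC divff ?mul1r // addrC.
rewrite bessel_coefS //; rewrite -natr1 in e4 *.
have e3 : a + n%:R != 0 by rewrite addrC.
by field; rewrite ?a0 ?e2 ?e4 ?e3.
Qed.

(** The extreme case is a = 1/2, where both sides agree and the series is that
    of the cosine. *)
Lemma bessel_coef_le a n : 2^-1 <= a -> bessel_coef a n <= ((2 * n)`!%:R)^-1.
Proof.
move=> ha; elim: n => [|n IH]; first by rewrite bessel_coef0 // muln0 fact0 invr1.
have a0 : 0 < a by rewrite (lt_le_trans _ ha) // invr_gt0.
rewrite bessel_coefS //.
have -> : (2 * n.+1 = (2 * n).+2)%N by rewrite mulnS.
rewrite !factS mulnA natrM [leRHS]invfM [leRHS]mulrC ler_pM //.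
- exact/ltW/bessel_coef_gt0.
- by rewrite invr_ge0 !mulr_ge0 // addr_ge0 // ltW.
- rewrite lef_pV2 ?posrE ?ltr0n ?muln_gt0 // ?mulr_gt0 // ?ltr_wpDl //.
  rewrite natrM -!natr1 natrM.
  have n0 : 0 <= n%:R :> R by [].
  nra.
Qed.

Lemma series_expR_le x N : 0 <= x -> \sum_(0 <= n < N) x ^+ n / n`!%:R <= expR x.
Proof.
move=> x0; have := @nondecreasing_cvgn_le R (series (exp_coeff x)).
rewrite /exp_coeff /= => /(_ _ (is_cvg_series_exp_coeff x) N) h.
apply: h; apply: nondecreasing_series => n _ _.
by rewrite divr_ge0 // exprn_ge0.
Qed.

Lemma sum_even_expR_le x N :
  \sum_(0 <= n < N) `|x| ^+ (2 * n) / (2 * n)`!%:R <= expR `|x|.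
Proof.
apply: le_trans (series_expR_le (2 * N) (normr_ge0 x)).
elim: N => [|N IH]; first by rewrite muln0 !big_nil.
rewrite mulnS add2n !big_nat_recr //= -addrA lerD // lerDl.
by rewrite divr_ge0 // exprn_ge0.
Qed.

(** A bound of the partial sums that is uniform in the number of terms; it
    dominates the series when it is integrated against a Gaussian. *)
Lemma sum_bessel_coef_le a x N (s : nat -> R) : 2^-1 <= a -> (forall n, `|s n| <= 1) ->
  `|\sum_(0 <= n < N) s n * bessel_coef a n * x ^+ (2 * n)| <= expR `|x|.
Proof.
move=> ha hs; apply: le_trans (sum_even_expR_le x N).
rewrite (le_trans (ler_norm_sum _ _ _)) // ler_sum // => n _.
rewrite normrM normrM normrX mulrC ler_wpM2l ?exprn_ge0 // -[leRHS]mul1r ler_pM //.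
by rewrite gtr0_norm ?bessel_coef_gt0 // bessel_coef_le.
Qed.

Definition bessel_ser a : nat -> R := fun n => (-1) ^+ n * bessel_coef a n.

Lemma is_cvg_bessel_ser a z : 2^-1 <= a -> cvgn (pseries (bessel_ser a) z).
Proof.
move=> ha; apply: normed_cvg; rewrite /pseries.
apply: (@series_le_cvg _ _ (exp_coeff `|z|)).
- by move=> n; exact: normr_ge0.
- by move=> n; rewrite /exp_coeff /= divr_ge0 // exprn_ge0.
- move=> n; rewrite /bessel_ser /exp_coeff /= normrM normrM normrX normrN1 expr1n mul1r normrX mulrC.
  rewrite ler_wpM2l ?exprn_ge0 // gtr0_norm ?bessel_coef_gt0 // (le_trans (bessel_coef_le n ha)) //.
  by rewrite lef_pV2 ?posrE ?ltr0n ?fact_gt0 // ler_nat leq_fact // leq_pmull.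
- exact: is_cvg_series_exp_coeff.
Qed.

(** The normalized Bessel function as a function of z = x^2. *)
Definition bessel_fun a z : R := limn (pseries (bessel_ser a) z).

Lemma bessel_ser_term mu x n : bessel_ser (mu + 1) n * (x ^+ 2) ^+ n = Gamma (mu + 1) *
  ((-1) ^+ n / (n`!%:R * Gamma (n%:R + mu + 1)) * (x / 2) ^+ (2 * n)).
Proof.
have -> : (x / 2) ^+ (2 * n) = (x ^+ 2) ^+ n * (4 ^+ n)^-1.
  rewrite exprM expr_div_n expr_div_n; congr (_ / _ ^+ _); ring.
rewrite /bessel_ser /bessel_coef -addrA.
move: (Gamma (mu + 1)) (Gamma _) (_ ^+ n) ((x ^+ 2) ^+ n) (4 ^+ n) => u v w y k.
rewrite !invfM; ring.
Qed.

Lemma bessel_serE a n : bessel_ser a n = (-1) ^+ n * (Gamma a / (n`!%:R * Gamma (n%:R + a) * 4 ^+ n)).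
Proof. by []. Qed.

(** The factor n in the hypothesis on coefficients amounts to z d/dz, so the
    hypothesis reads a b = a c + z c'. The identity is stated for partial sums,
    where it is exact. *)
Lemma pseries_contiguous (b c : nat -> R) a z n :
  (forall n, a * b n = (a + n%:R) * c n) ->
  a * pseries b z n.+1 = a * pseries c z n.+1 + z * pseries (pseries_diffs c) z n.
Proof.
move=> h; rewrite /pseries /series /= !mulr_sumr.
rewrite big_nat_recl // [X in _ = X + _]big_nat_recl // -addrA -big_split /=.
congr (_ + _); first by rewrite !mulrA h addr0.
by apply: eq_bigr => i _; rewrite /pseries_diffs mulrA h exprS; ring.
Qed.

Lemma bessel_ser_shift a n : 2^-1 <= a -> a * bessel_ser a n = (a + n%:R) * bessel_ser (a + 1) n.
Proof. by move=> ha; rewrite /bessel_ser mulrCA bessel_coef_shift // mulrCA. Qed.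

Lemma bessel_funE a z : bessel_fun a z = limn (pseries (bessel_ser a) z). Proof. by []. Qed.

Local Opaque bessel_fun bessel_coef Gamma.

Lemma ge_half_addr1 a : 2^-1 <= a -> 2^-1 <= a + 1.
Proof. lra. Qed.

Lemma bessel_ser_diffs a : 2^-1 <= a ->
  pseries_diffs (bessel_ser a) = (fun n => - (4 * a)^-1 * bessel_ser (a + 1) n).
Proof.
move=> ha; apply/funext => n; rewrite /pseries_diffs /bessel_ser mulrCA bessel_coef_diff //.
by rewrite exprS; ring.
Qed.

Lemma is_cvg_bessel_serZ a z k : 2^-1 <= a -> cvgn (pseries (fun n => k * bessel_ser a n) z).
Proof.
move=> ha; have := @is_cvg_seriesZ _ (fun n => bessel_ser a n * z ^+ n : R^o) k (is_cvg_bessel_ser ha).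
by congr (cvgn (series _)); apply/funext => n; rewrite /= -mulrA.
Qed.

Lemma lim_bessel_serZ a z k : 2^-1 <= a ->
  limn (pseries (fun n => k * bessel_ser a n) z) = k * bessel_fun a z.
Proof.
move=> ha; have := @lim_seriesZ _ (fun n => bessel_ser a n * z ^+ n : R^o) k (@is_cvg_bessel_ser a z ha).
move=> h; apply: etrans h; congr (limn (series _)); apply/funext => n.
by rewrite /= -mulrA.
Qed.

Lemma is_derive_bessel_fun a z : 2^-1 <= a ->
  is_derive z (1 : R) (bessel_fun a) (- (4 * a)^-1 * bessel_fun (a + 1) z).
Proof.
move=> ha; have ha1 := ge_half_addr1 ha; have ha2 := ge_half_addr1 ha1.
have := @pseries_snd_diffs R (bessel_ser a) (`|z| + 1) z (@is_cvg_bessel_ser a _ ha).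
rewrite (bessel_ser_diffs ha) => /(_ (@is_cvg_bessel_serZ _ _ _ ha1)) h.
rewrite -lim_bessel_serZ //; apply: h.
  have -> : pseries_diffs (fun n => - (4 * a)^-1 * bessel_ser (a + 1) n) =
     (fun n => (- (4 * a)^-1 * - (4 * (a + 1))^-1) * bessel_ser (a + 1 + 1) n).
    apply/funext => n; have := congr1 (fun f => f n) (bessel_ser_diffs ha1).
    by move=> h1; rewrite -mulrA -h1 /pseries_diffs mulrCA.
  exact: is_cvg_bessel_serZ.
by rewrite [ltRHS]ger0_norm ?addr_ge0 // ltrDl.
Qed.

Lemma bessel_fun0 a : 2^-1 <= a -> bessel_fun a 0 = 1.
Proof.
move=> ha; apply/cvg_lim => //; rewrite -cvg_shiftS /=.
rewrite (_ : (fun n => _) = cst 1); first exact: cvg_cst.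
apply/funext => n; rewrite /pseries /series /= big_nat_recl //= /bessel_ser expr0 bessel_coef0 //.
rewrite big1 ?addr0 ?mul1r ?expr0 //= => i _.
by rewrite expr0n /= mulr0.
Qed.

(** The contiguity relation a J_a = a J_(a+1) + z (J_(a+1))', which is a first-
    order form of Bessel's equation. *)
Lemma bessel_fun_contiguous a z : 2^-1 <= a ->
  a * bessel_fun a z = a * bessel_fun (a + 1) z + z * (- (4 * (a + 1))^-1 * bessel_fun (a + 1 + 1) z).
Proof.
move=> ha; have ha1 := ge_half_addr1 ha; have ha2 := ge_half_addr1 ha1.
pose S b n := a * pseries (bessel_ser b) z n.
have cS b : 2^-1 <= b -> S b n @[n --> \oo] --> a * bessel_fun b z.
  by move=> hb; apply: cvgM; [exact: cvg_cst|exact: (@is_cvg_bessel_ser b z hb)].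
have c0 : S a n.+1 @[n --> \oo] --> a * bessel_fun a z by rewrite cvg_shiftS; exact: cS.
have c1 : S (a + 1) n.+1 @[n --> \oo] --> a * bessel_fun (a + 1) z by rewrite (cvg_shiftS (S (a + 1))); exact: cS.
have c2 : z * pseries (fun n => - (4 * (a + 1))^-1 * bessel_ser (a + 1 + 1) n) z n @[n --> \oo] -->
    z * (- (4 * (a + 1))^-1 * bessel_fun (a + 1 + 1) z).
  rewrite -lim_bessel_serZ //.
  by apply: cvgM; [exact: cvg_cst|exact: (@is_cvg_bessel_serZ _ z _ ha2)].
apply: (cvg_unique (@Rhausdorff R) c0) => //.
have E n : S a n.+1 = S (a + 1) n.+1 +
    z * pseries (fun n => - (4 * (a + 1))^-1 * bessel_ser (a + 1 + 1) n) z n.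
  by rewrite -(bessel_ser_diffs ha1) /S; apply: pseries_contiguous => k; exact: bessel_ser_shift.
rewrite (_ : (fun n => S a n.+1) = (fun n => S (a + 1) n.+1 +
    z * pseries (fun n => - (4 * (a + 1))^-1 * bessel_ser (a + 1 + 1) n) z n)).
  by apply: cvgD.
by apply/funext => n; exact: E.
Qed.

(** The even and odd parts of y |-> E_mu(q, y): the kernel is their sum with the
    second one multiplied by the unit q. *)
Definition dunkl_even mu x : R := bessel_j mu x.
Definition dunkl_odd mu x : R := x / (2 * (mu + 1)) * bessel_j (mu + 1) x.

Lemma bessel_jE mu x : 2^-1 <= mu + 1 -> bessel_j mu x = bessel_fun (mu + 1) (x ^+ 2).
Proof.
move=> ha; have h := @is_cvg_bessel_ser (mu + 1) (x ^+ 2) ha.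
have G0 := lt0r_neq0 (Gamma_gt0 ha).
have E : pseries (bessel_ser (mu + 1)) (x ^+ 2) = (fun N => Gamma (mu + 1) * series (fun n : nat =>
    (-1) ^+ n / (n`!%:R * Gamma (n%:R + mu + 1)) * (x / 2) ^+ (2 * n)) N).
  apply/funext => N; rewrite /pseries /series /= mulr_sumr; apply: eq_bigr => n _.
  exact: bessel_ser_term.
rewrite bessel_funE E /bessel_j; apply/esym/cvg_lim => //; apply: cvgM; first exact: cvg_cst.
have -> : series (fun n : nat =>
    (-1) ^+ n / (n`!%:R * Gamma (n%:R + mu + 1)) * (x / 2) ^+ (2 * n)) =
    (fun N => (Gamma (mu + 1))^-1 * pseries (bessel_ser (mu + 1)) (x ^+ 2) N).
  by apply/funext => N; rewrite E mulKf.
by apply: is_cvgM => //; exact: is_cvg_cst.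
Qed.

Lemma dunkl_evenE mu x : 2^-1 <= mu + 1 -> dunkl_even mu x = bessel_fun (mu + 1) (x ^+ 2).
Proof. exact: bessel_jE. Qed.

Lemma dunkl_oddE mu x : 2^-1 <= mu + 1 ->
  dunkl_odd mu x = x / (2 * (mu + 1)) * bessel_fun (mu + 1 + 1) (x ^+ 2).
Proof. by move=> h; rewrite /dunkl_odd bessel_jE // ge_half_addr1. Qed.

Lemma dunkl_evenN mu x : 2^-1 <= mu + 1 -> dunkl_even mu (- x) = dunkl_even mu x.
Proof. by move=> h; rewrite !dunkl_evenE // sqrrN. Qed.

Lemma dunkl_oddN mu x : 2^-1 <= mu + 1 -> dunkl_odd mu (- x) = - dunkl_odd mu x.
Proof. by move=> h; rewrite !dunkl_oddE // sqrrN !mulNr. Qed.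

Lemma is_derive_bessel_fun_sqr a x : 2^-1 <= a ->
  is_derive x (1 : R) (fun y => bessel_fun a (y ^+ 2)) (- (2 * a)^-1 * x * bessel_fun (a + 1) (x ^+ 2)).
Proof.
move=> ha; have a0 : a != 0 by rewrite gt_eqF // (lt_le_trans _ ha) // invr_gt0.
have d1 := is_derive_bessel_fun (x ^+ 2) ha.
have d2 : is_derive x (1 : R) (fun y : R => y ^+ 2) (2 * x).
  by apply: is_derive_eq; rewrite /GRing.scale /=; ring.
have := @is_derive1_comp R (bessel_fun a) (fun y => y ^+ 2) x _ _ d1 d2.
move=> h; apply: (is_derive_eq h); move: (bessel_fun _ _) => u; by field.
Qed.

Lemma is_derive_dunkl_even mu x : 2^-1 <= mu + 1 ->
  is_derive x (1 : R) (dunkl_even mu) (- dunkl_odd mu x).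
Proof.
move=> ha; rewrite (_ : dunkl_even mu = (fun y => bessel_fun (mu + 1) (y ^+ 2))); last first.
  by apply/funext => y; exact: dunkl_evenE.
apply: (is_derive_eq (is_derive_bessel_fun_sqr x ha)); rewrite dunkl_oddE // !mulNr.
by congr (- (_ * _)); rewrite mulrC.
Qed.

Lemma is_derive_dunkl_odd mu x : 2^-1 <= mu + 1 ->
  is_derive x (1 : R) (dunkl_odd mu)
   ((2 * (mu + 1))^-1 * (bessel_fun (mu + 1 + 1) (x ^+ 2) -
     x ^+ 2 * ((2 * (mu + 1 + 1))^-1 * bessel_fun (mu + 1 + 1 + 1) (x ^+ 2)))).
Proof.
move=> ha; have ha1 := ge_half_addr1 ha.
rewrite (_ : dunkl_odd mu = (fun y => y / (2 * (mu + 1)) * bessel_fun (mu + 1 + 1) (y ^+ 2))); last first.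
  by apply/funext => y; exact: dunkl_oddE.
have d1 := is_derive_bessel_fun_sqr x ha1.
have d2 : is_derive x (1 : R) (fun y : R => y / (2 * (mu + 1))) (2 * (mu + 1))^-1.
  by apply: is_derive_eq; rewrite /GRing.scale /=; ring.
apply: (is_derive_eq (is_deriveM d2 d1)); rewrite /GRing.scale /=.
by move: (bessel_fun _ _) (bessel_fun _ _) => u v; rewrite !invfM; ring.
Qed.

(** Together with the derivative of the even part this is the eigenvalue
    equation of the Dunkl operator. *)
Lemma dunkl_odd_ode mu x : 2^-1 <= mu + 1 ->
  x * 'D_1 (dunkl_odd mu) x = x * dunkl_even mu x - (2 * mu + 1) * dunkl_odd mu x.
Proof.
move=> ha; have ha1 := ge_half_addr1 ha; have [_ ->] := is_derive_dunkl_odd x ha.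
have a0 : mu + 1 != 0 by rewrite gt_eqF // (lt_le_trans _ ha) // invr_gt0.
have a1 : mu + 1 + 1 != 0 by rewrite gt_eqF // (lt_le_trans _ ha1) // invr_gt0.
rewrite dunkl_oddE // dunkl_evenE //.
have h := bessel_fun_contiguous (x ^+ 2) ha.
move: h a0 a1; move: (bessel_fun (mu + 1) _) (bessel_fun (mu + 1 + 1) _) (bessel_fun (mu + 1 + 1 + 1) _) => u v w h a0 a1.
have {}h : u = v + x ^+ 2 * (- (4 * (mu + 1 + 1))^-1 * w) / (mu + 1).
  by apply: (mulfI a0); rewrite h; field; rewrite ?a0 ?a1.
by rewrite h; field; rewrite ?a0 ?a1.
Qed.

Lemma dunkl_even0 mu : 2^-1 <= mu + 1 -> dunkl_even mu 0 = 1.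
Proof. by move=> ha; rewrite dunkl_evenE // expr0n /= bessel_fun0. Qed.

Lemma dunkl_odd0 mu : dunkl_odd mu 0 = 0.
Proof. by rewrite /dunkl_odd !mul0r. Qed.

(** |E_mu|^2 <= 1. The squared modulus is even, equal to 1 at 0, and its
    derivative at t > 0 is -2 (2 mu + 1) / t times the square of the odd part. *)
Lemma dunkl_kernel_le1 mu x : 2^-1 <= mu + 1 -> dunkl_even mu x ^+ 2 + dunkl_odd mu x ^+ 2 <= 1.
Proof.
move=> ha.
pose P y := dunkl_even mu y ^+ 2 + dunkl_odd mu y ^+ 2.
have dP y : is_derive y (1 : R) P (2 * dunkl_odd mu y * ('D_1 (dunkl_odd mu) y - dunkl_even mu y)).
  have d1 := is_derive_dunkl_even y ha.
  have [d2 _] := is_derive_dunkl_odd y ha.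
  have d3 : is_derive y (1 : R) (dunkl_odd mu) ('D_1 (dunkl_odd mu) y) by exact: DeriveDef.
  rewrite /P (_ : (fun _ => _) = (fun y => dunkl_even mu y * dunkl_even mu y + dunkl_odd mu y * dunkl_odd mu y)).
    apply: (is_derive_eq (is_deriveD (is_deriveM d1 d1) (is_deriveM d3 d3))).
    rewrite /GRing.scale /=; move: (dunkl_even mu y) ('D_1 (dunkl_odd mu) y) (dunkl_odd mu y) => u v w.
    by rewrite mulrDr mulrN; ring.
  by apply/funext => t; rewrite !expr2.
have PN y : P (- y) = P y by rewrite /P dunkl_evenN // dunkl_oddN // sqrrN.
suff H y : 0 <= y -> P y <= 1.
  by rewrite -/(P x); case: (leP 0 x) => x0; [exact: H|rewrite -PN H // oppr_ge0 ltW].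
rewrite le_eqVlt => /predU1P[<-|y0].
  by rewrite /P dunkl_even0 // dunkl_odd0 expr0n /= expr1n addr0.
have -> : 1 = P 0 by rewrite /P dunkl_even0 // dunkl_odd0 expr0n /= expr1n addr0.
apply: (@ler0_derive1_le_cc R P 0 y) => //.
- move=> t; rewrite in_itv /= => /andP[t0 _]; rewrite derive1E; have [_ ->] := dP t.
  (* The sign of the derivative is unchanged by the factor t, which clears
     the denominator of the differential equation. *)
  rewrite -(pmulr_rle0 _ t0).
  have h := dunkl_odd_ode t ha.
  have -> : t * (2 * dunkl_odd mu t * ('D_1 (dunkl_odd mu) t - dunkl_even mu t)) =
     - (2 * (2 * mu + 1) * dunkl_odd mu t ^+ 2).
    rewrite mulrCA mulrBr h; ring.
  by rewrite oppr_le0 mulr_ge0 ?sqr_ge0 // mulr_ge0 //; lra.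
- apply: continuous_subspaceT => t; apply/differentiable_continuous/derivable1_diffP.
  by have [] := dP t.
- by rewrite in_itv /= lexx ltW.
- by rewrite in_itv /= lexx ltW.
- exact: ltW.
Qed.

Lemma continuous_dunkl_even mu : 2^-1 <= mu + 1 -> continuous (dunkl_even mu).
Proof.
move=> ha t; apply/differentiable_continuous/derivable1_diffP.
by have [] := is_derive_dunkl_even t ha.
Qed.

Lemma continuous_dunkl_odd mu : 2^-1 <= mu + 1 -> continuous (dunkl_odd mu).
Proof.
move=> ha t; apply/differentiable_continuous/derivable1_diffP.
by have [] := is_derive_dunkl_odd t ha.
Qed.

Lemma sum_bessel_coef_pseries a N x : \sum_(0 <= n < N) (-1) ^+ n * bessel_coef a n * x ^+ (2 * n) =
  pseries (bessel_ser a) (x ^+ 2) N.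
Proof. by rewrite /pseries /series /=; apply: eq_bigr => n _; rewrite exprM. Qed.

End BesselKernel.

(** * The one-dimensional Hartley transform of Gaussians *)

Section HartleyGaussian.
Variable R : realType.
Implicit Types (p s t d x w mu a : R).
Notation leb := (@lebesgue_measure R).

Lemma ge0_integral_opp (f : R -> \bar R) :
  measurable_fun [set: measurableTypeR R] f -> (forall x, (0 <= f x)%E) ->
  (\int[leb]_x f (- x)%R = \int[leb]_x f x)%E.
Proof.
move=> mf f0.
have mN : measurable_fun [set: measurableTypeR R] (-%R : measurableTypeR R -> measurableTypeR R).
  exact: oppr_measurable.
have := @ge0_integral_pushforward _ _ _ _ R _ mN leb setT f measurableT mf (fun x _ => f0 x).
rewrite preimage_setT => <-.
by apply: eq_measure_integral => A mA _; exact: lebesgue_measureN.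
Qed.

Lemma Rintegral_odd (f : R -> R) :
  leb.-integrable setT (EFin \o f) -> (forall x, f (- x) = - f x) ->
  \int[leb]_x f x = 0.
Proof.
move=> fi fN; rewrite /Rintegral integralE.
have mf : measurable_fun [set: measurableTypeR R] (EFin \o f) := measurable_int _ fi.
have -> : (\int[leb]_x (EFin \o f)^\- x = \int[leb]_x (EFin \o f)^\+ x)%E.
  rewrite -[RHS]ge0_integral_opp //; last exact: measurable_funepos.
  by apply: eq_integral => x _; rewrite funeposE funenegE /= fN.
rewrite subee //; apply: integrable_fin_num => //.
exact: integrable_funepos.
Qed.

(** Valid at 0 as well: for n = 0 the exponents agree, and for n > 0 both sides
    vanish there. *)
Lemma absgaussX n p t x : 0 <= p ->
  x ^+ (2 * n) * absgauss p t x = absgauss (p + 2 * n%:R) t x.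
Proof.
move=> p0; rewrite /absgauss mulrA; congr (_ * _).
have [->|n0] := posnP n; first by rewrite muln0 expr0 mul1r mulr0 addr0.
have [->|x0] := eqVneq x 0.
  rewrite expr0n muln_eq0 /= eqn0Ngt n0 mul0r normr0 powR0 //.
  by rewrite gt_eqF // ltr_wpDl // mulr_gt0 // ltr0n.
rewrite powRD ?normr_eq0 ?x0 ?implybT // mulrC; congr (_ * _).
by rewrite -natrM powR_mulrn // -normrX ger0_norm // exprM exprn_ge0 // sqr_ge0.
Qed.

(** Only exponents n <= 2 occur, in products of two functions [gauss_mono]; the
    domination is |x|^n <= 1 + x^2. *)
Lemma integrable_pow_absgauss n p t : (n <= 2)%N -> 0 <= p -> 0 < t ->
  leb.-integrable setT (EFin \o (fun x => x ^+ n * absgauss p t x)).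
Proof.
move=> n2 p0 t0; have p20 : 0 <= p + 2 * 1%:R by rewrite addr_ge0 // mulr_ge0.
have := integrableD measurableT (integrable_absgauss p0 t0) (integrable_absgauss p20 t0).
apply: le_integrable => //.
  apply/measurable_EFinP; apply: measurable_funM; last exact: measurable_absgauss.
  exact: measurable_funX.
move=> x _; rewrite -EFinD lee_fin [leRHS]ger0_norm ?addr_ge0 ?absgauss_ge0 //.
have -> : absgauss p t x + absgauss (p + 2 * 1%:R) t x = (1 + x ^+ 2) * absgauss p t x.
  by rewrite -(absgaussX 1) // muln1 mulrDl mul1r.
rewrite normrM (ger0_norm (absgauss_ge0 _ _ _)) ler_wpM2r ?absgauss_ge0 // normrX.
have := sqr_ge0 (`|x| - 1).
have -> : x ^+ 2 = `|x| ^+ 2 by rewrite real_normK // num_real.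
have := normr_ge0 x.
by case: n n2 => [|[|[|]]] // _; rewrite ?expr0 ?expr1; nra.
Qed.

Lemma addr2n_ge0 p n : 0 <= p -> 0 <= p + 2 * n%:R.
Proof. by move=> p0; rewrite addr_ge0 // mulr_ge0. Qed.

(** Completing the square: half of the Gaussian absorbs the exponential growth
    of the partial sums of the Bessel series. *)
Lemma expR_absgauss_le p t w x : 0 < t ->
  expR `|w * x| * absgauss p t x <= expR (w ^+ 2 / t) * absgauss p (t / 2) x.
Proof.
move=> t0; rewrite /absgauss mulrCA [leRHS]mulrCA ler_wpM2l ?powR_ge0 // -!expRD ler_expR.
rewrite normrM.
have h : 0 <= (`|w| / t - `|x| / 2) ^+ 2 * t by rewrite mulr_ge0 ?sqr_ge0 // ltW.
have -> : w ^+ 2 = `|w| ^+ 2 by rewrite real_normK // num_real.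
have -> : x ^+ 2 = `|x| ^+ 2 by rewrite real_normK // num_real.
move: h; have -> : (`|w| / t - `|x| / 2) ^+ 2 * t = `|w| ^+ 2 / t - `|w| * `|x| + t * `|x| ^+ 2 / 4.
  by field; rewrite gt_eqF.
move=> h; rewrite -subr_ge0; apply: le_trans h _; apply: le_of_eq.
by field; rewrite gt_eqF.
Qed.

Lemma bessel_fun_gauss_integrable a t w : 2^-1 <= a -> 0 < t ->
  leb.-integrable setT (EFin \o (fun x => bessel_fun a ((w * x) ^+ 2) * absgauss (2 * a - 1) t x)).
Proof.
move=> ha t0; have p0 : 0 <= 2 * a - 1 by lra.
have t20 : 0 < t / 2 by rewrite divr_gt0.
have := integrableZl measurableT (expR (w ^+ 2 / t)) (integrable_absgauss p0 t20).
apply: le_integrable => //.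
  apply/measurable_EFinP/measurable_funM; last exact: measurable_absgauss.
  apply: continuous_measurable_fun => x.
  have cb z : {for z, continuous (bessel_fun a)}.
    apply/differentiable_continuous/derivable1_diffP; by have [] := is_derive_bessel_fun z ha.
  apply: (@continuous_comp _ _ _ (fun x => (w * x) ^+ 2) (bessel_fun a)); last exact: cb.
  apply: (@continuous_comp _ _ _ (fun x => w * x) (fun y => y ^+ 2)); last exact: exprn_continuous.
  by apply: continuousM; [exact: cst_continuous|].
move=> x _; rewrite -EFinM lee_fin [leRHS]ger0_norm; last first.
  by rewrite mulr_ge0 ?expR_ge0 ?absgauss_ge0.
rewrite [leLHS]normrM (ger0_norm (absgauss_ge0 _ _ _)).
apply: le_trans (expR_absgauss_le _ _ _ t0); apply: ler_wpM2r; first exact: absgauss_ge0.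
have cv : pseries (bessel_ser a) ((w * x) ^+ 2) N @[N --> \oo] --> bessel_fun a ((w * x) ^+ 2).
  by rewrite bessel_funE; exact: (@is_cvg_bessel_ser _ a _ ha).
have cvn : `|pseries (bessel_ser a) ((w * x) ^+ 2) N| @[N --> \oo] --> `|bessel_fun a ((w * x) ^+ 2)|.
  exact: (cvg_norm cv).
rewrite -(cvg_lim (@Rhausdorff R) cvn).
apply: limr_le; first by apply/cvg_ex; eexists; exact: cvn.
apply: nearW => N /=; rewrite -sum_bessel_coef_pseries; apply: (sum_bessel_coef_le _ _ ha).
by move=> n; rewrite normrX normrN1 expr1n.
Qed.

(** Termwise integration: the moment of x^(2 n) contributes Gamma(n + a), which
    cancels the denominator of the Bessel coefficient and leaves the exponential
    series in - w^2 / (2 t). *)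
Lemma bessel_fun_gauss_transform a t w : 2^-1 <= a -> 0 < t ->
  \int[leb]_x (bessel_fun a ((w * x) ^+ 2) * absgauss (2 * a - 1) t x) =
  (2 / t) `^ a * Gamma a * expR (- (t^-1 * w ^+ 2 / 2)).
Proof.
move=> ha t0; have p0 : 0 <= 2 * a - 1 by lra.
have a0 : 0 < a by lra.
have t20 : 0 < t / 2 by rewrite divr_gt0.
have t2 : 0 < 2 / t by rewrite divr_gt0.
pose F N x := pseries (bessel_ser a) ((w * x) ^+ 2) N * absgauss (2 * a - 1) t x.
have mF N : measurable_fun [set: measurableTypeR R] (F N).
  apply: measurable_funM; last exact: measurable_absgauss.
  apply: measurable_sum => n; apply: measurable_funM => //.
  by apply: measurable_funX; apply: measurable_funX; exact: measurable_funM.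
have int n : leb.-integrable setT (EFin \o (fun x => x ^+ (2 * n) * absgauss (2 * a - 1) t x)).
  rewrite (_ : (fun x => _) = absgauss (2 * a - 1 + 2 * n%:R) t); last first.
    by apply/funext => x; exact: absgaussX.
  by apply: integrable_absgauss => //; exact: addr2n_ge0.
have intF N : \int[leb]_x F N x = (2 / t) `^ a * Gamma a *
    \sum_(0 <= n < N) (- (t^-1 * w ^+ 2 / 2)) ^+ n / n`!%:R.
  have E n x : bessel_ser a n * (w * x) ^+ 2 ^+ n * absgauss (2 * a - 1) t x =
      (bessel_ser a n * w ^+ (2 * n)) * (x ^+ (2 * n) * absgauss (2 * a - 1) t x).
    have -> : (w * x) ^+ 2 ^+ n = w ^+ (2 * n) * x ^+ (2 * n).
      by rewrite -exprM exprMn.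
    by move: (bessel_ser a n) (absgauss _ _ _) (w ^+ _) (x ^+ _) => u v k l; ring.
  rewrite mulr_sumr.
  transitivity (\sum_(0 <= n < N) (bessel_ser a n * w ^+ (2 * n)) *
     \int[leb]_x (x ^+ (2 * n) * absgauss (2 * a - 1) t x)).
    rewrite /Rintegral /F.
    under eq_integral => x _.
      rewrite /pseries /series /= mulr_suml -sumEFin.
      under eq_bigr do rewrite E EFinM.
      over.
    rewrite integral_sum //; last first.
      by move=> n; exact: (integrableZl measurableT _ (int n)).
    under eq_bigr => n _.
      rewrite (integralZl measurableT (int n)).
      rewrite -(fineK (integrable_fin_num measurableT (int n))) -EFinM.
      over.
    by rewrite sumEFin.
  apply: eq_bigr => n _.
  under eq_Rintegral => x _ do rewrite (absgaussX n t x p0).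
  rewrite gauss_moment_fin //; last exact: addr2n_ge0.
  have -> : (2 * a - 1 + 2 * n%:R + 1) / 2 = n%:R + a by field.
  rewrite powRD ?(gt_eqF t2) ?implybT // powR_mulrn ?(ltW t2) //.
  have G1 := lt0r_neq0 (Gamma_gt0 (ge_half_addn n ha)).
  have f1 : n`!%:R != 0 :> R by rewrite pnatr_eq0 -lt0n fact_gt0.
  have f2 : 4 ^+ n != 0 :> R by rewrite expf_neq0.
  have -> : (- (t^-1 * w ^+ 2 / 2)) ^+ n = (-1) ^+ n * (w ^+ (2 * n) * (2 / t) ^+ n / 4 ^+ n).
    rewrite exprM -exprMn -expr_div_n -exprMn; congr (_ ^+ _); field.
    by rewrite gt_eqF.
  rewrite bessel_serE; move: G1 f1 f2; move: (Gamma (n%:R + a)) (Gamma a) (_ `^ a) ((-1) ^+ n) (4 ^+ n) ((2 / t) ^+ n) (w ^+ (2 * n)) (n`!%:R).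
  by move=> G1 G2 u v k v' w' f h1 h2 h3; field; rewrite h1 h2 h3.
have [] := @dominated_convergence _ _ R leb setT measurableT
  (fun N x => (F N x)%:E)
  (fun x => (bessel_fun a ((w * x) ^+ 2) * absgauss (2 * a - 1) t x)%:E)
  (fun x => ((expR (w ^+ 2 / t))%:E * (absgauss (2 * a - 1) (t / 2) x)%:E)%E).
- by move=> n; apply/measurable_EFinP; exact: mF.
- exact: measurable_int (bessel_fun_gauss_integrable w ha t0).
- apply: aeW => x _; apply/cvg_EFin; first exact: nearW.
  by apply: cvgMl; rewrite bessel_funE; exact: (@is_cvg_bessel_ser _ a _ ha).
- exact: (integrableZl measurableT _ (integrable_absgauss p0 t20)).
- apply: aeW => x n _; rewrite -EFinM lee_fin normrM (ger0_norm (absgauss_ge0 _ _ _)).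
  apply: le_trans (expR_absgauss_le _ _ _ t0); apply: ler_wpM2r; first exact: absgauss_ge0.
  rewrite -sum_bessel_coef_pseries; apply: (sum_bessel_coef_le _ _ ha).
  by move=> k; rewrite normrX normrN1 expr1n.
move=> fi _ cv.
have {}cv : \int[leb]_x F N x @[N --> \oo] -->
    \int[leb]_x (bessel_fun a ((w * x) ^+ 2) * absgauss (2 * a - 1) t x).
  apply: fine_cvg; rewrite fineK //; exact: integrable_fin_num.
apply: (cvg_unique (@Rhausdorff R) cv).
rewrite (_ : (fun N => _) = (fun N => (2 / t) `^ a * Gamma a * series (exp_coeff (- (t^-1 * w ^+ 2 / 2))) N)).
  by apply: cvgM; [exact: cvg_cst|exact: is_cvg_series_exp_coeff].
by apply/funext => N; exact: intF.
Qed.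

Lemma dunkl_cE mu : 2^-1 <= mu + 1 -> dunkl_c mu = (2 `^ (mu + 1) * Gamma (mu + 1))^-1.
Proof.
move=> ha; rewrite /dunkl_c; congr (_^-1).
have p0 : 0 <= 2 * mu + 1 by lra.
have := @gauss_moment_fin R (2 * mu + 1) 1 p0 ltr01.
have -> : (2 * mu + 1 + 1) / 2 = mu + 1 by field.
rewrite divr1 => <-; apply: eq_Rintegral => x _.
by rewrite /absgauss mul1r mulrC.
Qed.

Lemma dunkl_c_gt0 mu : 2^-1 <= mu + 1 -> 0 < dunkl_c mu.
Proof. by move=> ha; rewrite dunkl_cE // invr_gt0 mulr_gt0 ?powR_gt0 ?Gamma_gt0. Qed.

(** The boolean is the parity: these are the two lowest generalized Hermite
    functions, with a dilation parameter. *)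
Definition gauss_mono (b : bool) t x := x ^+ b * expR (- (t * x ^+ 2 / 2)).
(** The kernel E_mu with its imaginary unit replaced by 1; it is cos + sin for
    mu = - 1/2. *)
Definition hartley_kernel mu x := dunkl_even mu x + dunkl_odd mu x.

(** Only the part of the kernel that has the parity of the function contributes;
    the other integrand is odd. *)
Lemma hartley_gauss_mono mu (b : bool) t w : 2^-1 <= mu + 1 -> 0 < t ->
  leb.-integrable setT (EFin \o (fun x => hartley_kernel mu (w * x) * gauss_mono b t x * `|x| `^ (2 * mu + 1))) /\
  dunkl_c mu * \int[leb]_x (hartley_kernel mu (w * x) * gauss_mono b t x * `|x| `^ (2 * mu + 1)) =
  t^-1 `^ (mu + 1 + b%:R) * gauss_mono b t^-1 w.
Proof.
move=> ha t0; have ha1 := ge_half_addr1 ha.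
have a0 : 0 < mu + 1 by lra.
have t2 : 0 < 2 / t by rewrite divr_gt0.
have p0 : 0 <= 2 * mu + 1 by lra.
have t20 : 0 < t / 2 by rewrite divr_gt0.
have pE : 2 * (mu + 1) - 1 = 2 * mu + 1 by ring.
have pE1 : 2 * (mu + 1 + 1) - 1 = 2 * mu + 1 + 2 * 1%:R by ring.
pose fe x := dunkl_even mu (w * x) * gauss_mono b t x * `|x| `^ (2 * mu + 1).
pose fo x := dunkl_odd mu (w * x) * gauss_mono b t x * `|x| `^ (2 * mu + 1).
have bnd1 x : `|dunkl_even mu x| <= 1 /\ `|dunkl_odd mu x| <= 1.
  have h := dunkl_kernel_le1 x ha; split; rewrite -[leRHS]sqrtr1 -sqrtr_sqr ler_sqrt //.
    by rewrite (le_trans _ h) // lerDl sqr_ge0.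
  by rewrite (le_trans _ h) // lerDr sqr_ge0.
have mg : measurable_fun [set: measurableTypeR R] (gauss_mono b t).
  by apply: measurable_funM; [exact: measurable_funX|exact: measurable_expR_sqr].
have mW : measurable_fun [set: measurableTypeR R] (fun x => `|x| `^ (2 * mu + 1)).
  by apply: (measurableT_comp (measurable_powR _)); exact: normr_measurable.
have gW : leb.-integrable setT (EFin \o (fun x => gauss_mono b t x * `|x| `^ (2 * mu + 1))).
  have b2 : (b <= 2)%N by case: (b).
  rewrite (_ : (fun x => _) = (fun x => x ^+ b * absgauss (2 * mu + 1) t x)).
    exact: integrable_pow_absgauss.
  by apply/funext => x; rewrite /gauss_mono /absgauss; ring.
have bint (k : R -> R) : continuous k -> (forall x, `|k x| <= 1) ->
    leb.-integrable setT (EFin \o (fun x => k (w * x) * gauss_mono b t x * `|x| `^ (2 * mu + 1))).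
  move=> ck hk; apply: le_integrable gW => //.
    apply/measurable_EFinP; apply: measurable_funM => //; apply: measurable_funM => //.
    apply: (@measurableT_comp _ _ _ _ _ _ k).
      exact: continuous_measurable_fun.
    exact: measurable_funM.
  move=> x _; rewrite lee_fin -mulrA normrM -[leRHS]mul1r ler_wpM2r //.
have ife := bint _ (continuous_dunkl_even ha) (fun x => (bnd1 x).1).
have ifo := bint _ (continuous_dunkl_odd ha) (fun x => (bnd1 x).2).
have E x : hartley_kernel mu (w * x) * gauss_mono b t x * `|x| `^ (2 * mu + 1) = fe x + fo x.
  by rewrite /hartley_kernel /fe /fo !mulrDl.
split.
  have := integrableD measurableT ife ifo; apply: eq_integrable => // x _.
  by rewrite /= E.
under eq_Rintegral do rewrite E.
rewrite RintegralD //.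
have ti : t^-1 = (2 / t) / 2 by field; rewrite gt_eqF.
have powE c : t^-1 `^ c = (2 / t) `^ c / 2 `^ c.
  have vi : 2^-1 `^ c = (2 `^ c)^-1 :> R.
    rewrite -powRN -(mulN1r c) powRrM powR_inv1 //.
  by rewrite [in LHS]ti powRM ?vi // ltW.
have G0 := lt0r_neq0 (Gamma_gt0 ha).
have P0 : 2 `^ (mu + 1) != 0 :> R by rewrite gt_eqF // powR_gt0.
rewrite dunkl_cE //; case: b @fe @fo mg gW bint ife ifo E => fe fo mg gW bint ife ifo E.
- rewrite (@Rintegral_odd fe) //; last first.
    by move=> x; rewrite /fe /gauss_mono mulrN dunkl_evenN // normrN sqrrN !expr1; ring.
  have -> : \int[leb]_x fo x = w / (2 * (mu + 1)) *
      \int[leb]_x (bessel_fun (mu + 1 + 1) ((w * x) ^+ 2) * absgauss (2 * (mu + 1 + 1) - 1) t x).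
    rewrite -RintegralZl //; last exact: bessel_fun_gauss_integrable.
    apply: eq_Rintegral => x _; rewrite /fo dunkl_oddE // pE1 -absgaussX //.
    by rewrite /gauss_mono /absgauss muln1 expr1; move: (bessel_fun _ _) => u; ring.
  have pS (z : R) : 0 < z -> z `^ (mu + 1 + 1) = z `^ (mu + 1) * z.
    by move=> z0; rewrite powRD ?(gt_eqF z0) ?implybT // powRr1 // ltW.
  have tE : mu + 1 + true%:R = mu + 1 + 1 :> R by [].
  rewrite tE.
  rewrite bessel_fun_gauss_transform //.
  rewrite add0r (GammaD1 ha).
  rewrite (pS _ t2).
  rewrite /gauss_mono expr1 pS ?invr_gt0 //.
  rewrite powE; move: G0 P0; move: (Gamma _) (2 `^ _) ((2 / t) `^ _) (expR _) => G P Q e G0 P0.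
  by field; rewrite G0 P0 !gt_eqF.
- rewrite (@Rintegral_odd fo) //; last first.
    by move=> x; rewrite /fo /gauss_mono mulrN dunkl_oddN // normrN sqrrN !expr0; ring.
  have -> : \int[leb]_x fe x =
      \int[leb]_x (bessel_fun (mu + 1) ((w * x) ^+ 2) * absgauss (2 * (mu + 1) - 1) t x).
    apply: eq_Rintegral => x _; rewrite /fe dunkl_evenE // pE.
    by rewrite /gauss_mono /absgauss expr0; move: (bessel_fun _ _) => u; ring.
  rewrite bessel_fun_gauss_transform // addr0 /gauss_mono expr0 addr0 powE.
  move: G0 P0; move: (Gamma _) (2 `^ _) ((2 / t) `^ _) (expR _) => G P Q e G0 P0.
  by field; rewrite G0 P0.
Qed.

(** Different parities are orthogonal; equal parities give a moment of the
    Gaussian with parameter s + t. *)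
Lemma gauss_mono_dot mu (b c : bool) s t : 2^-1 <= mu + 1 -> 0 < s -> 0 < t ->
  leb.-integrable setT (EFin \o (fun x => gauss_mono b s x * gauss_mono c t x * `|x| `^ (2 * mu + 1))) /\
  \int[leb]_x (gauss_mono b s x * gauss_mono c t x * `|x| `^ (2 * mu + 1)) =
  (b == c)%:R * ((2 / (s + t)) `^ (mu + 1 + b%:R) * Gamma (mu + 1 + b%:R)).
Proof.
move=> ha s0 t0; have st0 : 0 < s + t by rewrite addr_gt0.
have p0 : 0 <= 2 * mu + 1 by lra.
have E x : gauss_mono b s x * gauss_mono c t x * `|x| `^ (2 * mu + 1) =
    x ^+ (b + c) * absgauss (2 * mu + 1) (s + t) x.
  rewrite /gauss_mono /absgauss exprD.
  have -> : expR (- ((s + t) * x ^+ 2 / 2)) = expR (- (s * x ^+ 2 / 2)) * expR (- (t * x ^+ 2 / 2)).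
    by rewrite -expRD; congr expR; ring.
  ring.
have mE : measurable_fun [set: measurableTypeR R] (fun x => x ^+ (b + c) * absgauss (2 * mu + 1) (s + t) x).
  by apply: measurable_funM; [exact: measurable_funX|exact: measurable_absgauss].
have int : leb.-integrable setT (EFin \o (fun x => x ^+ (b + c) * absgauss (2 * mu + 1) (s + t) x)).
  by apply: integrable_pow_absgauss => //; case: (b); case: (c).
split; first by rewrite (_ : (fun x => _) = (fun x => x ^+ (b + c) * absgauss (2 * mu + 1) (s + t) x)) //; apply/funext => x; exact: E.
under eq_Rintegral do rewrite E.
case: b c E mE int => -[] /= E mE int; rewrite ?eqxx ?mul1r ?mul0r ?addn0 ?add0n ?addn1.
- under eq_Rintegral => x _ do rewrite -[2%N]muln1 (absgaussX 1 _ x p0).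
  rewrite (gauss_moment_fin (addr2n_ge0 1 p0) st0).
  by have -> : (2 * mu + 1 + 2 * 1%:R + 1) / 2 = mu + 1 + 1 by field.
- by apply: Rintegral_odd => // x; rewrite absgaussN exprS expr0 mulr1 mulNr.
- by apply: Rintegral_odd => // x; rewrite absgaussN exprS expr0 mulr1 mulNr.
- under eq_Rintegral do rewrite expr0 mul1r.
  by rewrite (gauss_moment_fin p0 st0) addr0; have -> : (2 * mu + 1 + 1) / 2 = mu + 1 by field.
Qed.

(** The one-dimensional isometry on basic functions. It amounts to the identity
    s^-1 t^-1 (2 / (s^-1 + t^-1)) = 2 / (s + t). *)
Lemma hartley_gauss_mono_dot mu (b c : bool) s t : 2^-1 <= mu + 1 -> 0 < s -> 0 < t ->
  s^-1 `^ (mu + 1 + b%:R) * t^-1 `^ (mu + 1 + c%:R) *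
    \int[leb]_x (gauss_mono b s^-1 x * gauss_mono c t^-1 x * `|x| `^ (2 * mu + 1)) =
  \int[leb]_x (gauss_mono b s x * gauss_mono c t x * `|x| `^ (2 * mu + 1)).
Proof.
move=> ha s0 t0; have st0 : 0 < s + t by rewrite addr_gt0.
have [_ ->] := @gauss_mono_dot mu b c s t ha s0 t0.
have [_ ->] := @gauss_mono_dot mu b c s^-1 t^-1 ha (ltac:(by rewrite invr_gt0)) (ltac:(by rewrite invr_gt0)).
have [<-|] := eqVneq b c; last by rewrite !mul0r mulr0.
rewrite !mul1r mulrA; congr (_ * _).
have si : 0 <= s^-1 by rewrite invr_ge0 ltW.
have ti : 0 <= t^-1 by rewrite invr_ge0 ltW.
rewrite -!powRM //; [|by rewrite mulr_ge0|by rewrite divr_ge0 // addr_ge0].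
by congr (_ `^ _); field; rewrite !gt_eqF // addrC.
Qed.
End HartleyGaussian.

(** * The weighted Lebesgue measure of the plane *)

Section DensityIntegral.
Local Open Scope ereal_scope.
Context d (T : measurableType d) (R : realType).
Variables (m nu : {measure set T -> \bar R}) (w : T -> R).
Hypothesis mw : measurable_fun setT w.
Hypothesis w0 : forall x, (0 <= w x)%R.
Hypothesis nuE : forall A, measurable A -> nu A = \int[m]_(x in A) (w x)%:E.

Import HBNNSimple.

(** The formula holds for indicator functions by hypothesis, hence for simple
    functions and, by monotone convergence, in general. *)
Lemma ge0_integral_density (f : T -> \bar R) :
  measurable_fun setT f -> (forall x, 0 <= f x) ->
  \int[nu]_x f x = \int[m]_x (f x * (w x)%:E).
Proof.
move=> mf f0; pose h := nnsfun_approx measurableT mf.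
have cvh x : (h n x)%:E @[n --> \oo] --> f x by apply: cvg_nnsfun_approx.
have ndh x : {homo (fun n => (h n x)%:E) : a b / (a <= b)%N >-> a <= b}.
  by move=> a b ab; rewrite lee_fin; exact/lefP/nd_nnsfun_approx.
transitivity (limn (fun n => \int[nu]_x (h n x)%:E)).
  rewrite -monotone_convergence //=.
  - by apply: eq_integral => x _; apply/esym/cvg_lim.
  - by move=> n; exact/measurable_EFinP.
  - by move=> n x _; rewrite lee_fin.
transitivity (limn (fun n => \int[m]_x ((h n x)%:E * (w x)%:E))); last first.
  rewrite -monotone_convergence //=.
  - apply: eq_integral => x _; apply/cvg_lim => //.
    by apply: cvgeZr => //; exact: cvh.
  - by move=> n; apply: emeasurable_funM; exact/measurable_EFinP.
  - by move=> n x _; rewrite mule_ge0 // lee_fin.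
  - by move=> x _ a b ab; rewrite lee_wpmul2r ?lee_fin //; exact: ndh.
congr (limn _); apply/funext => n.
transitivity (\sum_(r \in range (h n)) \int[m]_x ((r * \1_(h n @^-1` [set r]) x)%:E * (w x)%:E)).
  under eq_integral do rewrite fimfunE -fsumEFin//.
  rewrite ge0_integral_fsum//; last 2 first.
  - by move=> y; exact/measurable_EFinP/measurable_funM.
  - by move=> y x _; rewrite nnfun_muleindic_ge0.
  apply: eq_fsbigr => r _; rewrite integralZl_indic_nnsfun// integral_indic//= setIT nuE //.
  have [r0|r0] := ltP r 0%R.
    rewrite preimage_nnfun0 // integral_set0 mule0.
    by apply/esym/integral0_eq => x _; rewrite indic0 mulr0 mul0e.
  rewrite -ge0_integralZl_EFin //; last 2 first.
  - by move=> x _; rewrite lee_fin.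
  - by apply: measurable_funTS; exact/measurable_EFinP.
  rewrite integral_mkcond; apply: eq_integral => x _; rewrite patchE indicE.
  by case: ifP => _; rewrite ?mulr1 // mulr0 mul0e.
rewrite -ge0_integral_fsum//.
- apply: eq_integral => x _; rewrite fimfunE -fsumEFin // ge0_mule_fsuml //.
  by move=> r; rewrite nnfun_muleindic_ge0.
- move=> r; apply: emeasurable_funM; last exact/measurable_EFinP.
  exact/measurable_EFinP/measurable_funM.
- by move=> r x _; rewrite mule_ge0 ?lee_fin // -lee_fin nnfun_muleindic_ge0.
Qed.
End DensityIntegral.

Section PlaneMeasure.
Variable R : realType.
Implicit Types (mu : R).
Notation leb := (@lebesgue_measure R).
Local Open Scope ereal_scope.

Definition weight1 mu (x : R) : R := (`|x| `^ (2 * mu + 1))%R.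

Lemma weight1_ge0 mu x : (0 <= weight1 mu x)%R. Proof. exact: powR_ge0. Qed.

Lemma measurable_weight1 mu : measurable_fun [set: measurableTypeR R] (weight1 mu).
Proof. by apply: (measurableT_comp (measurable_powR _)); exact: normr_measurable. Qed.

Lemma measurable_dunkl_weight_real mu : measurable_fun [set: plane R] (dunkl_weight mu).
Proof. by have /measurable_EFinP := @measurable_dunkl_weight R mu. Qed.

Lemma ge0_integral_dunkl mu (F : plane R -> \bar R) :
  measurable_fun setT F -> (forall v, 0 <= F v) ->
  \int[dunkl_measure mu]_v F v =
  \int[leb \x leb]_v (F v * (dunkl_weight mu v)%:E).
Proof.
move=> mF F0.
apply: (@ge0_integral_density _ (plane R) R (leb \x leb) (dunkl_measure mu)) => //.
- exact: measurable_dunkl_weight_real.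
- by move=> v; have := dunkl_weight_ge0 mu v; rewrite lee_fin.
Qed.

Lemma ge0_integral_dunkl_iter mu (F : plane R -> \bar R) :
  measurable_fun setT F -> (forall v, 0 <= F v) ->
  \int[dunkl_measure mu]_v F v =
  \int[leb]_x \int[leb]_y (F (x, y) * (weight1 mu x * weight1 mu y)%:E).
Proof.
move=> mF F0; rewrite ge0_integral_dunkl // fubini_tonelli1 //.
- apply: emeasurable_funM => //; exact: measurable_dunkl_weight.
- by move=> v; rewrite mule_ge0 // dunkl_weight_ge0.
Qed.

Lemma measurable_tensor (f g : R -> R) :
  measurable_fun [set: measurableTypeR R] f -> measurable_fun [set: measurableTypeR R] g ->
  measurable_fun [set: plane R] (fun v => f v.1 * g v.2)%R.
Proof.
move=> mf mg; apply: measurable_funM.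
- by apply: (measurableT_comp mf); exact: measurable_fst.
- by apply: (measurableT_comp mg); exact: measurable_snd.
Qed.

Lemma ge0_integral_tensor mu (f g : R -> R) :
  measurable_fun [set: measurableTypeR R] f -> measurable_fun [set: measurableTypeR R] g ->
  (forall x, 0 <= f x)%R -> (forall x, 0 <= g x)%R ->
  \int[dunkl_measure mu]_v (f v.1 * g v.2)%:E =
  (\int[leb]_x (f x * weight1 mu x)%:E) * (\int[leb]_x (g x * weight1 mu x)%:E).
Proof.
move=> mf mg f0 g0; rewrite ge0_integral_dunkl_iter; last 2 first.
- by apply/measurable_EFinP; exact: measurable_tensor.
- by move=> v; rewrite lee_fin mulr_ge0.
rewrite -ge0_integralZr //=.
- apply: eq_integral => x _; rewrite -ge0_integralZl_EFin //=.
  + by apply: eq_integral => y _; rewrite -!EFinM; congr EFin; ring.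
  + by move=> y _; rewrite lee_fin mulr_ge0 ?weight1_ge0.
  + by apply/measurable_EFinP/measurable_funM => //; exact: measurable_weight1.
  + by rewrite mulr_ge0 ?weight1_ge0.
- by apply/measurable_EFinP/measurable_funM => //; exact: measurable_weight1.
- by move=> y _; rewrite lee_fin mulr_ge0 ?weight1_ge0.
- by apply: integral_ge0 => y _; rewrite lee_fin mulr_ge0 ?weight1_ge0.
Qed.

Lemma integrable_tensor mu (f g : R -> R) :
  measurable_fun [set: measurableTypeR R] f -> measurable_fun [set: measurableTypeR R] g ->
  leb.-integrable setT (EFin \o (fun x => f x * weight1 mu x)%R) ->
  leb.-integrable setT (EFin \o (fun x => g x * weight1 mu x)%R) ->
  (dunkl_measure mu).-integrable setT (EFin \o (fun v : plane R => f v.1 * g v.2)%R).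
Proof.
move=> mf mg /integrableP[_ fi] /integrableP[_ gi]; apply/integrableP; split.
  by apply/measurable_EFinP; exact: measurable_tensor.
have -> : \int[dunkl_measure mu]_v `|(EFin \o (fun v : plane R => (f v.1 * g v.2)%R)) v| =
   \int[dunkl_measure mu]_v ((fun x => `|f x|) v.1 * (fun x => `|g x|) v.2)%:E.
  by apply: eq_integral => v _ /=; rewrite normrM.
rewrite (@ge0_integral_tensor mu (fun x => `|f x|%R) (fun x => `|g x|%R)) //; last 2 first.
- exact: measurableT_comp.
- exact: measurableT_comp.
have E (h : R -> R) : \int[leb]_x (`|h x| * weight1 mu x)%:E = \int[leb]_x `|(EFin \o (fun x => h x * weight1 mu x)%R) x|.
  by apply: eq_integral => x _ /=; rewrite normrM (ger0_norm (weight1_ge0 _ _)).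
by rewrite !E lte_mul_pinfty // ?integral_ge0 // ge0_fin_numE // integral_ge0.
Qed.

Local Close Scope ereal_scope.

(** Tonelli covers nonnegative factors. The general case is obtained one factor
    at a time from the nonnegative functions |h| and |h| - h. *)
Lemma integral_tensor mu (f g : R -> R) :
  measurable_fun [set: measurableTypeR R] f -> measurable_fun [set: measurableTypeR R] g ->
  leb.-integrable setT (EFin \o (fun x => f x * weight1 mu x)) ->
  leb.-integrable setT (EFin \o (fun x => g x * weight1 mu x)) ->
  \int[dunkl_measure mu]_v (f v.1 * g v.2) =
  \int[leb]_x (f x * weight1 mu x) * \int[leb]_x (g x * weight1 mu x).
Proof.
pose I (h : R -> R) := \int[leb]_x (h x * weight1 mu x).
pose I2 (h k : R -> R) := \int[dunkl_measure mu]_v (h v.1 * k v.2).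
pose m1 (h : R -> R) := measurable_fun [set: measurableTypeR R] h.
pose i1 (h : R -> R) := leb.-integrable setT (EFin \o (fun x => h x * weight1 mu x)).
rewrite -!/(m1 _) -!/(i1 _) -/(I2 f g) -/(I f) -/(I g).
have mabs h : m1 h -> m1 (fun x => `|h x|) by move=> mh; exact: measurableT_comp.
have msub h : m1 h -> m1 (fun x => `|h x| - h x).
  by move=> mh; apply: measurable_funB => //; exact: mabs.
have iabs h : i1 h -> i1 (fun x => `|h x|).
  move=> ih; have := integrable_abse ih; apply: eq_integrable => // x _ /=.
  by rewrite normrM (ger0_norm (weight1_ge0 _ _)).
have isub h : i1 h -> i1 (fun x => `|h x| - h x).
  move=> ih; have := integrableB measurableT (iabs _ ih) ih; apply: eq_integrable => // x _ /=.
  by rewrite -EFinB mulrBl.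
have sub0 h (x : R) : 0 <= `|h x : R| - h x by rewrite subr_ge0 ler_norm.
have IB h : i1 h -> I (fun x => `|h x| - h x) = I (fun x => `|h x|) - I h.
  move=> ih; rewrite /I -RintegralB //; last exact: iabs.
  by apply: eq_Rintegral => x _; rewrite mulrBl.
have pos f' g' : m1 f' -> m1 g' -> i1 f' -> i1 g' -> (forall x, 0 <= f' x) ->
    (forall x, 0 <= g' x) -> I2 f' g' = I f' * I g'.
  move=> mf mg fi gi f0 g0; rewrite /I2 /I /Rintegral ge0_integral_tensor //.
  by rewrite fineM //; exact: integrable_fin_num.
have semi f' g' : m1 f' -> m1 g' -> i1 f' -> i1 g' -> (forall x, 0 <= f' x) ->
    I2 f' g' = I f' * I g'.
  move=> mf mg fi gi f0.
  have := pos _ _ mf (msub _ mg) fi (isub _ gi) f0 (sub0 g').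
  have -> : I2 f' (fun x => `|g' x| - g' x) = I2 f' (fun x => `|g' x|) - I2 f' g'.
    rewrite /I2 -RintegralB //.
    - by apply: eq_Rintegral => v _; rewrite mulrBr.
    - exact: (integrable_tensor mf (mabs _ mg) fi (iabs _ gi)).
    - exact: (integrable_tensor mf mg fi gi).
  rewrite pos //; [|exact: mabs|exact: iabs].
  rewrite IB // mulrBr => /eqP; rewrite -subr_eq0 opprD opprK addrACA subrr add0r addrC.
  by rewrite subr_eq0 => /eqP ->.
move=> mf mg fi gi.
have := semi _ _ (msub _ mf) mg (isub _ fi) gi (sub0 f).
have -> : I2 (fun x => `|f x| - f x) g = I2 (fun x => `|f x|) g - I2 f g.
  rewrite /I2 -RintegralB //.
  - by apply: eq_Rintegral => v _; rewrite mulrBl.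
  - exact: (integrable_tensor (mabs _ mf) mg (iabs _ fi) gi).
  - exact: (integrable_tensor mf mg fi gi).
rewrite semi //; [|exact: mabs|exact: iabs].
rewrite IB // mulrBl => /eqP; rewrite -subr_eq0 opprD opprK addrACA subrr add0r addrC.
by rewrite subr_eq0 => /eqP ->.
Qed.

Definition axis_refl (b c : bool) (v : plane R) : plane R := ((-1) ^+ b * (v.1 : R), (-1) ^+ c * (v.2 : R)).

Lemma measurable_axis_refl b c : measurable_fun [set: plane R] (axis_refl b c).
Proof.
apply/measurable_fun_pairP; split.
- apply: (@measurable_funM _ _ _ _ (cst ((-1) ^+ b)) fst) => //.
- apply: (@measurable_funM _ _ _ _ (cst ((-1) ^+ c)) snd) => //.
Qed.

Lemma weight1N mu x : weight1 mu (- x) = weight1 mu x.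
Proof. by rewrite /weight1 normrN. Qed.

Lemma ge0_integral_axis_refl mu b c (F : plane R -> \bar R) :
  measurable_fun setT F -> (forall v, 0 <= F v)%E ->
  (\int[dunkl_measure mu]_v F (axis_refl b c v) = \int[dunkl_measure mu]_v F v)%E.
Proof.
move=> mF F0.
have mFr : measurable_fun [set: plane R] (fun v => F (axis_refl b c v)).
  by apply: measurableT_comp => //; exact: measurable_axis_refl.
rewrite (ge0_integral_dunkl_iter mu mF F0) (ge0_integral_dunkl_iter mu mFr (fun v => F0 _)).
pose G (x : R) := (\int[leb]_y (F (x, y) * (weight1 mu x * weight1 mu y)%:E))%E.
have E x : (\int[leb]_y (F (axis_refl b c (x, y)) * (weight1 mu x * weight1 mu y)%:E) = G ((-1) ^+ b * x)%R)%E.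
  rewrite /G; have wE : weight1 mu ((-1) ^+ b * x) = weight1 mu x.
    by rewrite /weight1 normrM normrX normrN1 expr1n mul1r.
  rewrite wE /axis_refl /=; case: c mFr => mFr /=.
    rewrite -[RHS]ge0_integral_opp.
    - by apply: eq_integral => y _; rewrite weight1N expr1 mulN1r.
    - apply: emeasurable_funM.
        apply: (measurableT_comp mF); exact: measurable_pair1.
      apply/measurable_EFinP/measurable_funM => //; exact: measurable_weight1.
    - by move=> y; rewrite mule_ge0 // lee_fin mulr_ge0 ?weight1_ge0.
  by apply: eq_integral => y _; rewrite expr0 mul1r.
under eq_integral do rewrite E.
have mG : measurable_fun [set: measurableTypeR R] G.
  have := @measurable_fun_fubini_tonelli_F _ _ (measurableTypeR R) (measurableTypeR R) R leb
    (fun v => (F v * (dunkl_weight mu v)%:E)%E).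
  apply; last by move=> v; rewrite mule_ge0 // dunkl_weight_ge0.
  by apply: emeasurable_funM => //; exact: measurable_dunkl_weight.
have G0 x : (0 <= G x)%E.
  by apply: integral_ge0 => y _; rewrite mule_ge0 // lee_fin mulr_ge0 ?weight1_ge0.
case: b {mFr E} => /=; last by apply: eq_integral => x _; rewrite expr0 mul1r.
apply: etrans (ge0_integral_opp mG G0).
by apply: eq_integral => x _; rewrite expr1 mulN1r.
Qed.
End PlaneMeasure.

(** * From Gaussians to indicator functions on the line *)

Section StonePoly.
Variable R : realType.
Implicit Types (u v x y : R).

(** The difference quotient of the exponential used to differentiate Gaussians
    in their parameter, with a lower bound showing that it tends to y. *)
Lemma diffquot_expR (y : R) k : 0 <= y ->
  y - y ^+ 2 * harmonic k <= k.+1%:R * (1 - expR (- (y / k.+1%:R))) <= y.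
Proof.
move=> y0; set m : R := k.+1%:R; have m0 : 0 < m by rewrite ltr0Sn.
have ym0 : 0 <= y / m by rewrite divr_ge0 // ltW.
have h1 := expR_ge1Dx (- (y / m)); have h2 := expR_ge1Dx (y / m).
have h3 : expR (- (y / m)) * expR (y / m) = 1 by rewrite -expRD addNr expR0.
have h4 := expR_gt0 (- (y / m)).
apply/andP; split; last first.
  apply: (@le_trans _ _ (m * (y / m))).
    by rewrite ler_pM2l // lerBlDl -lerBlDr.
  by rewrite mulrC divfK // gt_eqF.
rewrite /harmonic -/m; have -> : y - y ^+ 2 / m = m * (y / m - (y / m) ^+ 2).
  by field; rewrite gt_eqF.
rewrite ler_pM2l //; move: ym0 h1 h2 h3 h4; move: (y / m) (expR _) (expR _) => z e e' z0 h1 h2 h3 h4.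
have h5 : e' * (1 + z) <= 1 by rewrite -[leRHS]h3 ler_wpM2l // ltW.
nra.
Qed.

(** Stone's polynomials, indexed from n + 1. They have no constant term, and
    tend to 1 where u >= 1/2 and to 0 where 0 <= u < 1/2. *)
Definition stone n (u : R) := 1 - (1 - u ^+ n.+1) ^+ (n.+1 * 2 ^ n.+1).

Lemma bernoulli_le (v : R) M : 0 <= v <= 1 -> 1 - M%:R * v <= (1 - v) ^+ M.
Proof.
move=> /andP[v0 v1]; elim: M => [|M IH]; first by rewrite mul0r subr0 expr0.
rewrite exprS (le_trans _ (ler_wpM2l _ IH)) ?subr_ge0 // -natr1.
have m0 : 0 <= M%:R :> R by [].
nra.
Qed.

Lemma stone_le n u : 0 <= u <= 1 -> stone n u <= n.+1%:R * (2 * u) ^+ n.+1.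
Proof.
move=> /andP[u0 u1]; have v01 : 0 <= u ^+ n.+1 <= 1 by rewrite exprn_ge0 //= exprn_ile1.
have := bernoulli_le (n.+1 * 2 ^ n.+1) v01.
by move=> h; rewrite /stone exprMn mulrA -natrX -natrM lerBlDr -lerBlDl.
Qed.

Lemma stone_ge0 n u : 0 <= u <= 1 -> 0 <= stone n u.
Proof.
move=> /andP[u0 u1]; rewrite subr_ge0 exprn_ile1 //.
  by rewrite subr_ge0 exprn_ile1.
by rewrite gerBl exprn_ge0.
Qed.

Lemma stone_le1 n u : 0 <= u <= 1 -> stone n u <= 1.
Proof. by move=> /andP[u0 u1]; rewrite gerBl exprn_ge0 // subr_ge0 exprn_ile1. Qed.

(** A bound linear in u and uniform in n, so that the limit is dominated when u
    is a Gaussian. *)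
Lemma stone_le4 n u : 0 <= u <= 1 -> stone n u <= 4 * u.
Proof.
move=> u01; have /andP[u0 u1] := u01.
have [h|h] := leP (4 * u) 1; last by rewrite (le_trans (stone_le1 n u01)) // ltW.
rewrite (le_trans (stone_le n u01)) // exprS mulrCA.
have h2 : (2 * u) ^+ n <= (2^-1) ^+ n by rewrite lerXn2r ?nnegrE ?mulr_ge0 ?invr_ge0 //; lra.
have h3 : n.+1%:R * 2^-1 ^+ n <= 1 :> R.
  by rewrite exprVn ler_pdivrMr ?exprn_gt0 // mul1r -natrX ler_nat ltn_expl.
have h4 : n.+1%:R * (2 * u) ^+ n <= 1 by rewrite (le_trans _ h3) // ler_wpM2l.
rewrite (le_trans (ler_wpM2l _ h4)) ?mulr_ge0 // mulr1; lra.
Qed.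

(** (1 - u^n)^(n 2^n) <= exp(- n (2 u)^n) <= exp(- n). *)
Lemma stone_cvg1 u : 2^-1 <= u <= 1 -> stone n u @[n --> \oo] --> (1 : R).
Proof.
move=> /andP[u0 u1]; have u00 : 0 <= u by rewrite (le_trans _ u0) // invr_ge0.
rewrite -[X in _ --> X]subr0; apply: cvgB; first exact: cvg_cst.
apply: (@squeeze_cvgr _ _ _ _ (fun=> 0) (fun n => expR (- n%:R))); last 2 first.
- exact: cvg_cst.
- exact: cvgn_expR.
apply: nearW => n; rewrite exprn_ge0 ?subr_ge0 ?exprn_ile1 //=.
have h : 1 - u ^+ n.+1 <= expR (- u ^+ n.+1) by exact: expR_ge1Dx.
rewrite (le_trans (lerXn2r _ _ _ h)) ?nnegrE ?expR_ge0 ?subr_ge0 ?exprn_ile1 //.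
rewrite -expRM_natl ler_expR mulrN lerN2 natrM natrX -mulrA -exprMn.
rewrite (le_trans (_ : n%:R <= n.+1%:R)) ?ler_nat // ler_peMr // exprn_ege1 //; lra.
Qed.

(** Bernoulli's inequality bounds the polynomial by n (2 u)^n. With z^2 = 2 u
    this is n z^n times z^n, and n z^n is at most the sum of the geometric
    series. *)
Lemma stone_cvg0 u : 0 <= u < 2^-1 -> stone n u @[n --> \oo] --> (0 : R).
Proof.
move=> /andP[u0 u1]; have u01 : 0 <= u <= 1 by rewrite u0 /=; lra.
pose z := Num.sqrt (2 * u).
have zz : 2 * u = z ^+ 2 by rewrite sqr_sqrtr // mulr_ge0.
have z0 : 0 <= z by rewrite sqrtr_ge0.
have z1 : z < 1 by rewrite -sqrtr1 ltr_sqrt //; lra.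
have sumz n : n%:R * z ^+ n <= (1 - z)^-1.
  have : n%:R * z ^+ n <= \sum_(0 <= i < n) z ^+ i.
    rewrite -[n in n%:R]subn0 -sumr_const_nat mulr_suml big_nat_cond [leRHS]big_nat_cond.
    apply: ler_sum => i /andP[/andP[_ iN] _]; rewrite mul1r.
    exact: (ler_wiXn2l z0 (ltW z1) (ltnW iN)).
  move=> /le_trans; apply.
  have := subrXX 1 z n; rewrite expr1n.
  have -> : \sum_(i < n) 1 ^+ (n.-1 - i) * z ^+ i = \sum_(0 <= i < n) z ^+ i.
    by rewrite big_mkord; apply: eq_bigr => i _; rewrite expr1n mul1r.
  by move=> h; rewrite -[leRHS]mulr1 ler_pdivlMl ?subr_gt0 // -h gerBl exprn_ge0.
apply: (@squeeze_cvgr _ _ _ _ (fun=> 0) (fun n => (1 - z)^-1 * z ^+ n.+1)); last 2 first.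
- exact: cvg_cst.
- rewrite -[X in _ --> X](mulr0 (1 - z)^-1); apply: cvgM; first exact: cvg_cst.
  by rewrite (cvg_shiftS (fun n => z ^+ n)); apply: cvg_expr; rewrite ger0_norm.
apply: nearW => n; rewrite stone_ge0 //= (le_trans (stone_le n u01)) // zz -exprM mulnC exprM expr2.
by rewrite mulrA ler_wpM2r ?exprn_ge0.
Qed.

Lemma indic_le_gauss (A : set R) K x : A `<=` `[-K, K] -> `|\1_A x| <= expR (K ^+ 2) * expR (- (1 * x ^+ 2)).
Proof.
move=> AK; rewrite indicE -expRD; case: (boolP (x \in A)) => [|_]; last by rewrite normr0 expR_ge0.
rewrite inE => /AK; rewrite /= in_itv /= => /andP[h1 h2].
rewrite normr1 -[leLHS]expR0 ler_expR mul1r; nra.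
Qed.

Lemma sum_indic_trivIset (T : Type) (F : nat -> set T) n k (x : T) : trivIset setT F -> F k x ->
  \sum_(0 <= i < n) \1_(F i) x = (k < n)%N%:R :> R.
Proof.
move=> tF Fk; elim: n => [|n IH]; first by rewrite big_nil.
rewrite big_nat_recr //= IH indicE [in RHS]ltnS [in RHS]leq_eqVlt.
have -> : (x \in F n) = (k == n).
  apply/idP/eqP => [|<-]; last by rewrite inE.
  by rewrite inE => Fn; apply: (tF k n I I); exists x.
by case: eqP => [->|_]; rewrite ?ltnn ?add0r ?addr0 ?orbF.
Qed.

Lemma cvg_sum_indic (T : Type) (F : nat -> set T) (x : T) : trivIset setT F ->
  \sum_(0 <= i < n) \1_(F i) x @[n --> \oo] --> (\1_(\bigcup_k F k) x : R).
Proof.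
move=> tF; rewrite indicE; case: (boolP (x \in _)) => [|].
  rewrite inE => -[k _ Fk]; apply: cvg_near_cst; exists k.+1 => // n /= kn.
  by rewrite (sum_indic_trivIset _ tF Fk) kn.
rewrite notin_setE => h; apply: cvg_near_cst; apply: nearW => n.
rewrite big1 // => i _; rewrite indicE; case: (boolP (x \in _)) => //; rewrite inE => Fi.
by exfalso; apply: h; exists i.
Qed.

Lemma sum_indic_le (T : Type) (F : nat -> set T) n (x : T) : trivIset setT F ->
  \sum_(0 <= i < n) \1_(F i) x <= (\1_(\bigcup_k F k) x : R).
Proof.
move=> tF; rewrite [leRHS]indicE; case: (boolP (x \in _)) => [|].
  by rewrite inE => -[k _ Fk]; rewrite (sum_indic_trivIset _ tF Fk) lern1 leq_b1.
rewrite notin_setE => h; rewrite big1 // => i _; rewrite indicE; case: (boolP (x \in _)) => //; rewrite inE => Fi.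
by exfalso; apply: h; exists i.
Qed.
End StonePoly.

Section GaussClass.
Variable R : realType.
Implicit Types (d t c x y : R).

(** Any class of functions on the line that is linear, is stable under pointwise
    limits dominated by a Gaussian, and contains the functions [gauss_mono] also
    contains the indicator functions of all bounded Borel sets. Leaving the
    class abstract allows it to be used for each variable of the plane in turn. *)
Variable W : (R -> R) -> Prop.
Hypothesis Wlin : forall a f g, W f -> W g -> W (fun x => a * f x + g x).
Hypothesis Wcl : forall (f : nat -> R -> R) g C d, 0 < d ->
  (forall n, W (f n)) -> (forall x, f n x @[n --> \oo] --> g x) ->
  (forall n x, `|f n x| <= C * expR (- (d * x ^+ 2))) -> W g.
Hypothesis Wgen : forall b t, 0 < t -> W (gauss_mono b t).

Let Wext f g : W f -> (forall x, f x = g x) -> W g.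
Proof. by move=> wf fg; rewrite (_ : g = f) //; apply/funext => x; rewrite fg. Qed.

Let W0 : W (fun=> 0).
Proof.
have w := Wgen true (@ltr01 R).
by apply: (Wext (Wlin (-1) w w)) => x; rewrite mulN1r addNr.
Qed.

Let WZ a f : W f -> W (fun x => a * f x).
Proof. by move=> wf; apply: (Wext (Wlin a wf W0)) => x; rewrite addr0. Qed.

Let WD f g : W f -> W g -> W (fun x => f x + g x).
Proof. by move=> wf wg; apply: (Wext (Wlin 1 wf wg)) => x; rewrite mul1r. Qed.

Let WB f g : W f -> W g -> W (fun x => f x - g x).
Proof. by move=> wf wg; apply: (Wext (Wlin (-1) wg wf)) => x; rewrite mulN1r addrC. Qed.

Let Wsum (I : Type) (l : seq I) (F : I -> R -> R) : (forall i, W (F i)) ->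
  W (fun x => \sum_(i <- l) F i x).
Proof.
move=> wF; elim: l => [|i l IH]; first by apply: (Wext W0) => x; rewrite big_nil.
by apply: (Wext (WD (wF i) IH)) => x; rewrite big_cons.
Qed.

(** Differentiating the Gaussian in its parameter multiplies it by - x^2 / 2, so
    the difference quotients raise the degree by two, starting from the two
    parities in [gauss_mono]. *)
Lemma W_monomial n t : 0 < t -> W (fun x => x ^+ n * expR (- (t * x ^+ 2 / 2))).
Proof.
have step m : (forall t, 0 < t -> W (fun x => x ^+ m * expR (- (t * x ^+ 2 / 2)))) ->
    forall t, 0 < t -> W (fun x => x ^+ m.+2 * expR (- (t * x ^+ 2 / 2))).
  move=> IH {}t t0.
  have t4 : 0 < t / 4 by rewrite divr_gt0.
  have [C C0 hC] := @powR_norm_le_expR R m.+2%:R (t / 4) (ltac:(by [])) t4.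
  (* The increment of the parameter is 1/(k+1); the factor 2 undoes the 1/2
     in the exponent. *)
  pose f k x := 2 * k.+1%:R * (x ^+ m * expR (- (t * x ^+ 2 / 2)) -
     x ^+ m * expR (- ((t + k.+1%:R^-1) * x ^+ 2 / 2))).
  have fE k x : f k x = 2 * (x ^+ m * expR (- (t * x ^+ 2 / 2))) *
      (k.+1%:R * (1 - expR (- (x ^+ 2 / 2 / k.+1%:R)))).
    rewrite /f; have -> : expR (- ((t + k.+1%:R^-1) * x ^+ 2 / 2)) =
        expR (- (t * x ^+ 2 / 2)) * expR (- (x ^+ 2 / 2 / k.+1%:R)).
      by rewrite -expRD; congr expR; ring.
    by ring.
  have x20 (x : R) : 0 <= x ^+ 2 / 2 by rewrite divr_ge0 // sqr_ge0.
  apply: (@Wcl f _ C (t / 4)) => //.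
  - move=> k; apply: WZ; apply: WB; apply: IH => //.
    by rewrite addr_gt0 // invr_gt0.
  - move=> x; rewrite (_ : (fun n => _) = (fun k => 2 * (x ^+ m * expR (- (t * x ^+ 2 / 2))) *
      (k.+1%:R * (1 - expR (- (x ^+ 2 / 2 / k.+1%:R)))))); last by apply/funext => k; rewrite fE.
    have -> : x ^+ m.+2 * expR (- (t * x ^+ 2 / 2)) =
       2 * (x ^+ m * expR (- (t * x ^+ 2 / 2))) * (x ^+ 2 / 2) by rewrite !exprS; field.
    apply: cvgM; first exact: cvg_cst.
    apply: (@squeeze_cvgr _ _ _ _ (fun k => x ^+ 2 / 2 - (x ^+ 2 / 2) ^+ 2 * harmonic k) (fun=> x ^+ 2 / 2)).
    + by apply: nearW => k; exact: diffquot_expR.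
    + rewrite -[X in _ --> X]subr0 -[X in _ - X](mulr0 ((x ^+ 2 / 2) ^+ 2)).
      apply: cvgB; first exact: cvg_cst.
      by apply: cvgM; [exact: cvg_cst|exact: cvg_harmonic].
    + exact: cvg_cst.
  - move=> k x; rewrite fE.
    have /andP[_ h] := diffquot_expR k (x20 x).
    have h0 : 0 <= k.+1%:R * (1 - expR (- (x ^+ 2 / 2 / k.+1%:R))).
      by rewrite mulr_ge0 // subr_ge0 expR_le1 oppr_le0 divr_ge0.
    rewrite normrM (ger0_norm h0) (le_trans (ler_wpM2l (normr_ge0 _) h)) //.
    have := hC x; rewrite powR_mulrn // => hx.
    have -> : `|2 * (x ^+ m * expR (- (t * x ^+ 2 / 2)))| * (x ^+ 2 / 2) =
      `|x| ^+ m.+2 * expR (- (t * x ^+ 2 / 2)).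
      rewrite !normrM (ger0_norm (expR_ge0 _)) normrX (ger0_norm (ler0n _ 2)).
      have -> : x ^+ 2 = `|x| ^+ 2 by rewrite real_normK // num_real.
      by rewrite !exprS; field.
    rewrite (le_trans (ler_wpM2r (expR_ge0 _) hx)) // -(mulrA C) -expRD.
    by rewrite ler_wpM2l // ler_expR; apply: le_of_eq; field.
(* Induction by steps of two needs two consecutive degrees. *)
suff H m : (forall t, 0 < t -> W (fun x => x ^+ m * expR (- (t * x ^+ 2 / 2)))) /\
    (forall t, 0 < t -> W (fun x => x ^+ m.+1 * expR (- (t * x ^+ 2 / 2)))).
  by move=> t0; apply: (H n).1.
elim: m => [|m [IH1 IH2]]; last by split => //; exact: step.
by split => s s0; [exact: (Wgen false s0)|exact: (Wgen true s0)].
Qed.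

(** The partial sums of the exponential series, times the Gaussian, belong to
    the class and are dominated by a wider Gaussian. *)
Lemma W_exp t c : 0 < t -> W (fun x => expR (c * x) * expR (- (t * x ^+ 2 / 2))).
Proof.
move=> t0.
have h4 : 0 < t / 4 by rewrite divr_gt0.
apply: (@Wcl (fun N x => \sum_(0 <= n < N) (c ^+ n / n`!%:R) * (x ^+ n * expR (- (t * x ^+ 2 / 2)))) _
    (expR (c ^+ 2 / t)) (t / 4)) => //.
- by move=> N; apply: Wsum => n; apply: WZ; exact: W_monomial.
- move=> x; rewrite (_ : (fun n => _) = (fun N => series (exp_coeff (c * x)) N * expR (- (t * x ^+ 2 / 2)))).
    by apply: cvgM; [exact: is_cvg_series_exp_coeff|exact: cvg_cst].
  apply/funext => N; rewrite /series /= mulr_suml; apply: eq_bigr => n _.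
  by rewrite /exp_coeff /= exprMn; ring.
- move=> N x.
  have -> : \sum_(0 <= n < N) (c ^+ n / n`!%:R) * (x ^+ n * expR (- (t * x ^+ 2 / 2))) =
     (\sum_(0 <= n < N) (c * x) ^+ n / n`!%:R) * expR (- (t * x ^+ 2 / 2)).
    by rewrite mulr_suml; apply: eq_bigr => n _; rewrite exprMn; ring.
  have := expR_absgauss_le 0 c x t0; rewrite /absgauss !powRr0 !mul1r => h.
  have -> : t / 4 * x ^+ 2 = t / 2 * x ^+ 2 / 2 by field.
  apply: le_trans h; rewrite normrM (ger0_norm (expR_ge0 _)) ler_wpM2r ?expR_ge0 //.
  rewrite (le_trans (ler_norm_sum _ _ _)) // (le_trans _ (series_expR_le N (normr_ge0 _))) //.
  by apply: ler_sum => n _; rewrite normrM normrX normfV (ger0_norm (ler0n _ _)).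
Qed.

(** Completing the square turns a translated Gaussian into a centred one times
    an exponential. *)
Lemma W_shifted t y : 0 < t -> W (fun x => expR (- (t * (x - y) ^+ 2))).
Proof.
move=> t0; have t20 : 0 < 2 * t by rewrite mulr_gt0.
apply: (Wext (WZ (expR (- (t * y ^+ 2))) (W_exp (2 * t * y) t20))) => x.
by rewrite -!expRD; congr expR; field.
Qed.

(** The polynomial 1 - (1 - u^n)^M has no constant term, so it is a combination
    of positive powers of u. *)
Lemma W_poly (u : R -> R) n M : (forall k, (0 < k)%N -> W (fun x => u x ^+ k)) -> (0 < n)%N ->
  W (fun x => 1 - (1 - u x ^+ n) ^+ M).
Proof.
move=> wu n0.
have H m k : (0 < k)%N -> W (fun x => u x ^+ k * (1 - u x ^+ n) ^+ m).
  elim: m k => [|m IH] k k0; first by apply: (Wext (wu _ k0)) => x; rewrite expr0 mulr1.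
  have k1 : (0 < k + n)%N by rewrite addn_gt0 k0.
  by apply: (Wext (WB (IH _ k0) (IH _ k1))) => x; rewrite exprD exprS; ring.
elim: M => [|M IH]; first by apply: (Wext W0) => x; rewrite expr0 subrr.
by apply: (Wext (WD IH (H M _ n0))) => x; rewrite exprS; ring.
Qed.

Lemma W_itv_center y r : 0 < r -> W (\1_(`[y - r, y + r]%classic)).
Proof.
(* With this s, the Gaussian u is at least 1/2 exactly on the interval. *)
move=> r0; set s := ln 2 / r ^+ 2.
have s0 : 0 < s by rewrite divr_gt0 ?exprn_gt0 // ln_gt0 // ltr1n.
pose u x := expR (- (s * (x - y) ^+ 2)).
have u01 x : 0 <= u x <= 1.
  by rewrite expR_ge0 /= -expR0 ler_expR oppr_le0 mulr_ge0 ?sqr_ge0 // ltW.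
have uE x : (2^-1 <= u x) = (x \in `[y - r, y + r]).
  rewrite /u -[2^-1]lnK ?posrE ?invr_gt0 // ler_expR lnV ?posrE // lerN2.
  have -> : ln 2 = s * r ^+ 2 by rewrite /s divfK // gt_eqF // exprn_gt0.
  rewrite ler_pM2l // -(@real_normK _ (x - y)) ?num_real // ler_pXn2r ?nnegrE ?(ltW r0) //.
  by rewrite in_itv /= ler_norml; apply/andP/andP => -[]; lra.
apply: (@Wcl (fun n x => stone n (u x)) _ (4 * expR (s * y ^+ 2)) (s / 2)).
- by rewrite divr_gt0.
- move=> n; apply: W_poly => // k k0.
  have ks : 0 < k%:R * s by rewrite mulr_gt0 // ltr0n.
  by apply: (Wext (W_shifted y ks)) => x; rewrite /u -expRM_natl; congr expR; ring.
- move=> x; rewrite indicE; have [h|h] := leP (2^-1) (u x).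
    have -> : x \in (`[y - r, y + r]%classic : set R) by rewrite inE /= -uE.
    by apply: stone_cvg1; rewrite h (andP (u01 x)).2.
  have -> : x \in (`[y - r, y + r]%classic : set R) = false.
    by apply/negbTE; rewrite notin_setE /= -uE leNgt h.
  by apply: stone_cvg0; rewrite h (andP (u01 x)).1.
- move=> n x; rewrite ger0_norm ?stone_ge0 // (le_trans (stone_le4 n (u01 x))) //.
  rewrite -mulrA ler_pM2l // /u -expRD ler_expR.
  (* (x - y)^2 >= x^2 / 2 - y^2. *)
  have := sqr_ge0 (x - 2 * y); move: s0; nra.
Qed.

(** A one-point interval is the limit of the proper intervals that shrink to it. *)
Lemma W_itvcc a b : W (\1_(`[a, b]%classic)).
Proof.
have proper a' b' : a' < b' -> W (\1_(`[a', b']%classic)).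
  move=> ab; have r0 : 0 < (b' - a') / 2 by rewrite divr_gt0 // subr_gt0.
  have := W_itv_center ((a' + b') / 2) r0.
  have -> : (a' + b') / 2 - (b' - a') / 2 = a' by field.
  by have -> : (a' + b') / 2 + (b' - a') / 2 = b' by field.
have [ab|ab|<-] := ltgtP a b; first exact: proper.
  apply: (Wext W0) => x; rewrite indicE; case: (boolP (_ \in _)) => //.
  by rewrite inE /= in_itv /= => /andP[h1 h2]; move: (le_lt_trans (le_trans h1 h2) ab); rewrite ltxx.
apply: (@Wcl (fun n => \1_(`[a, a + n.+1%:R^-1]%classic)) _ (expR ((`|a| + 1) ^+ 2)) 1) => //.
- by move=> n; apply: proper; rewrite ltrDl invr_gt0.
- move=> x; have [xa|xa] := eqVneq x a.
    rewrite (_ : (fun n => _) = (fun=> \1_(`[a, a]%classic) x)); first exact: cvg_cst.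
    apply/funext => n; rewrite !indicE xa; congr (_%:R); congr (nat_of_bool _).
    transitivity true; first by apply: mem_set; rewrite /= in_itv /= lexx lerDl invr_ge0 ler0n.
    by apply/esym/mem_set; rewrite /= in_itv /= lexx.
  have -> : \1_(`[a, a]%classic) x = 0 :> R.
    rewrite indicE; case: (boolP (_ \in _)) => //; rewrite inE /= in_itv /= -eq_le => /eqP E.
    by rewrite E eqxx in xa.
  apply: cvg_near_cst.
  have [ax|ax] := ltP a x; last first.
    apply: nearW => n; rewrite indicE; case: (boolP (_ \in _)) => //; rewrite inE /= in_itv /= => /andP[h _].
    by move: xa; rewrite eq_le ax h.
  have xa0 : 0 < x - a by rewrite subr_gt0.
  have := @near_infty_natSinv_lt R (PosNum xa0).
  apply: filterS => n /= h; rewrite indicE; case: (boolP (_ \in _)) => //; rewrite inE /= in_itv /= => /andP[_ h2].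
  by move: h; rewrite ltNge lerBlDl h2.
- move=> n x; apply: indic_le_gauss => z /=; rewrite !in_itv /= => /andP[h1 h2].
  have := ler_norm a; have := ler_norm (- a); rewrite normrN => h3 h4.
  have h5 : n.+1%:R^-1 <= 1 :> R by rewrite invf_le1 ?ltr0Sn ?ler1n.
  move: (n.+1%:R^-1) `|a| h1 h2 h3 h4 h5 => u v h1 h2 h3 h4 h5.
  by apply/andP; split; lra.
Qed.

(** A Dynkin class argument inside the interval from - K to K, with closed rays
    as generators. *)
Lemma W_bounded_measurable K (A : set R) :
  measurable (A : set (measurableTypeR R)) -> A `<=` `[-K, K] -> W (\1_A).
Proof.
move=> mA AK.
(* The interval from - K to K is built into the property, so that complements
   stay bounded. *)
pose P (S : set (measurableTypeR R)) := W (\1_(S `&` `[-K, K]%classic)).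
suff : P A by rewrite /P setIidl.
suff H : forall S, <<s @RGenCInfty.G R >> S -> P S.
  by apply: H; have := mA; rewrite [X in X A -> _](@RGenCInfty.measurableE R).
apply: (@dynkin_induction _ (measurableTypeR R) (@RGenCInfty.G R) P).
- exact: RGenCInfty.measurableE.
- move=> _ _ [a ->] [b ->]; exists (Num.max a b); apply/seteqP; split => x /=; rewrite !in_itv /= !andbT.
    by move=> [h1 h2]; rewrite ge_max h1.
  by rewrite ge_max => /andP[].
- by rewrite /P setTI; exact: W_itvcc.
- move=> _ [a ->]; rewrite /P.
  rewrite (_ : _ `&` _ = `[Num.max a (- K), K]%classic); first exact: W_itvcc.
  apply/seteqP; split => x /=; rewrite !in_itv /= !andbT.
    by move=> [h1 /andP[h2 h3]]; rewrite ge_max h1 h2.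
  by rewrite ge_max => /andP[/andP[h1 h2] h3]; split => //; rewrite h2.
- move=> S mS PS; rewrite /P.
  apply: (Wext (WB (W_itvcc (- K) K) PS)) => x; rewrite !indicE !in_setI in_setC.
  by case: (x \in S); case: (x \in _); rewrite /= ?subrr ?subr0.
- move=> F mF tF PF; rewrite /P.
  have tF' : trivIset setT (fun k => F k `&` `[-K, K]%classic) by exact: trivIset_setIr.
  have UE : \bigcup_k (F k) `&` `[-K, K]%classic = \bigcup_k (F k `&` `[-K, K]%classic).
    by rewrite setI_bigcupl.
  apply: (@Wcl (fun n x => \sum_(0 <= i < n) \1_(F i `&` `[-K, K]%classic) x) _ (expR (K ^+ 2)) 1) => //.
  + by move=> n; apply: Wsum.
  + by move=> x; rewrite UE; exact: cvg_sum_indic.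
  + move=> n x; rewrite ger0_norm; last by apply: sumr_ge0 => i _; rewrite indicE.
    apply: (le_trans (sum_indic_le R n x tF')).
    rewrite -UE; apply: le_trans (indic_le_gauss _ (_ : (\bigcup_k (F k) `&` `[-K, K]%classic) `<=` _)); last exact: subIsetr.
    by rewrite ger0_norm // indicE.
Qed.
End GaussClass.

(** * Approximation in the L^1 norm and the L^2 norm together *)

Section Size12.
Context d (T : measurableType d) (R : realType) (m : {measure set T -> \bar R}).
Implicit Types (f g s : T -> R) (a : R).

(** The sum of the L^1 norm and the square of the L^2 norm. Convergence to 0 of
    this single quantity is convergence in both spaces, and dominated
    convergence applies to it directly. *)
Definition size12 g : \bar R := (\int[m]_v (`|g v| + g v ^+ 2)%:E)%E.

Lemma measurable_size12 g : measurable_fun setT g ->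
  measurable_fun setT (fun v => (`|g v| + g v ^+ 2)%:E).
Proof.
move=> mg; apply/measurable_EFinP; apply: measurable_funD; first exact: measurableT_comp.
exact: measurable_funX.
Qed.

Lemma size12_mono f g : measurable_fun setT f -> measurable_fun setT g ->
  (forall v, `|f v| <= `|g v|) -> (size12 f <= size12 g)%E.
Proof.
move=> mf mg fg; apply: ge0_le_integral => //.
- by move=> v _; rewrite lee_fin addr_ge0 ?sqr_ge0.
- exact: measurable_size12.
- exact: measurable_size12.
- move=> v _; rewrite lee_fin lerD // -(real_normK (num_real (f v))) -(real_normK (num_real (g v))).
  by rewrite ler_pXn2r ?nnegrE.
Qed.

(** A quasi-triangle inequality, coming from (x + y)^2 <= 2 x^2 + 2 y^2. *)
Lemma size12_lin a f g : measurable_fun setT f -> measurable_fun setT g ->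
  (size12 (fun v => a * f v + g v)%R <= (2 * (`|a| + a ^+ 2))%:E * size12 f + 2%:E * size12 g)%E.
Proof.
move=> mf mg.
have c0 : 0 <= 2 * (`|a| + a ^+ 2) by rewrite mulr_ge0 // addr_ge0 ?sqr_ge0.
have h0 h v : (0 <= (`|h v| + h v ^+ 2)%:E :> \bar R)%E by rewrite lee_fin addr_ge0 ?sqr_ge0.
rewrite /size12 -!ge0_integralZl_EFin //; [|exact: measurable_size12|exact: measurable_size12].
rewrite -ge0_integralD //; first last.
- by apply: measurable_funeM; exact: measurable_size12.
- by move=> v _; rewrite mule_ge0.
- by apply: measurable_funeM; exact: measurable_size12.
- by move=> v _; rewrite mule_ge0.
apply: ge0_le_integral => //.

- apply: (@measurable_size12 (fun v => a * f v + g v)); apply: measurable_funD => //; exact: measurable_funM.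
- apply: emeasurable_funD; apply: measurable_funeM; exact: measurable_size12.
- move=> v _; rewrite -!EFinM -EFinD lee_fin.
  have h1 : `|a * f v + g v| <= `|a| * `|f v| + `|g v| by rewrite (le_trans (ler_normD _ _)) // normrM.
  have h2 : (a * f v + g v) ^+ 2 <= 2 * (a ^+ 2 * f v ^+ 2) + 2 * g v ^+ 2.
    by have := sqr_ge0 (a * f v - g v); nra.
  rewrite (le_trans (lerD h1 h2)) //.
  have := normr_ge0 a; have := normr_ge0 (f v); have := normr_ge0 (g v).
  move: (`|a|) (`|f v|) (`|g v|) (f v) (g v) => A F G x y G0 F0 A0.
  have := sqr_ge0 x; have := sqr_ge0 y; have := sqr_ge0 a.
  move: (a ^+ 2) (x ^+ 2) (y ^+ 2) => a2 x2 y2 a20 y20 x20.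
  have := mulr_ge0 A0 F0; have := mulr_ge0 A0 x20; have := mulr_ge0 a20 F0; have := mulr_ge0 a20 x20.
  lra.
Qed.

Lemma size12_dominated (f : nat -> T -> R) g G :
  (forall n, measurable_fun setT (f n)) -> measurable_fun setT g -> measurable_fun setT G ->
  (forall n v, `|f n v| <= G v) -> (forall v, f n v @[n --> \oo] --> g v) ->
  (size12 G < +oo)%E ->
  size12 (fun v => f n v - g v) @[n --> \oo] --> 0%E.
Proof.
move=> mf mg mG fG fg G12.
have G0 v : 0 <= G v := le_trans (normr_ge0 _) (fG 0%N v).
have gG v : `|g v| <= G v.
  have cv : `|f n v| @[n --> \oo] --> `|g v| by exact: (cvg_norm (fg v)).
  rewrite -(cvg_lim (@Rhausdorff R) cv); apply: limr_le; first by apply/cvg_ex; eexists; exact: cv.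
  by apply: nearW => n.
have [] := @dominated_convergence _ T R m setT measurableT
  (fun n v => (`|f n v - g v| + (f n v - g v) ^+ 2)%:E) (cst 0%E)
  (fun v => (4%:E * (`|G v| + G v ^+ 2)%:E)%E).
- by move=> n; apply: measurable_size12; exact: measurable_funB.
- exact: measurable_cst.
- apply: aeW => v _; apply/cvg_EFin; first exact: nearW.
  have d0 : f n v - g v @[n --> \oo] --> (0 : R).
    by rewrite -(subrr (g v)); apply: cvgB => //; exact: cvg_cst.
  have cc : `|f n v - g v| + (f n v - g v) ^+ 2 @[n --> \oo] --> (0 : R).
    have E0 : `|0 : R| + 0 * 0 = 0 by rewrite normr0 mulr0 addr0.
    rewrite -[X in _ --> X]E0; apply: cvgD; first exact: (cvg_norm d0).
    by under eq_fun do rewrite expr2; apply: cvgM.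
  exact: cc.
- apply: integrableZl => //; apply/integrableP; split; first exact: measurable_size12.
  rewrite (eq_integral (fun v => (`|G v| + G v ^+ 2)%:E)) // => v _.
  by rewrite gee0_abs // lee_fin addr_ge0 ?sqr_ge0.
- apply: aeW => v n _; rewrite abse_EFin ger0_norm ?addr_ge0 ?sqr_ge0 // -EFinM lee_fin.
  have h1 : `|f n v - g v| <= 2 * G v.
    by rewrite (le_trans (ler_normB _ _)) // mulr2n mulrDl mul1r lerD.
  have h2 : (f n v - g v) ^+ 2 <= (2 * G v) ^+ 2.
    by rewrite -(real_normK (num_real (f n v - g v))) ler_pXn2r ?nnegrE ?mulr_ge0.
  rewrite (ger0_norm (G0 v)); move: h1 h2 (G0 v).
  by move: `|f n v - g v| ((f n v - g v) ^+ 2) => u w; nra.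
move=> _ + _; rewrite /= => h.
rewrite (_ : (fun n => _) = (fun n => \int[m]_x `|(`|f n x - g x| + (f n x - g x) ^+ 2)%:E - 0|)%E) //.
apply/funext => n; apply: eq_integral => v _.
by rewrite sube0 gee0_abs // lee_fin addr_ge0 ?sqr_ge0.
Qed.

Lemma size12_integrable g : measurable_fun setT g -> (size12 g < +oo)%E ->
  m.-integrable setT (EFin \o g).
Proof.
move=> mg g12; apply/integrableP; split; first exact/measurable_EFinP.
apply: le_lt_trans g12; apply: ge0_le_integral => //.
- by apply: measurableT_comp => //; exact/measurable_EFinP.
- exact: measurable_size12.
- by move=> v _; rewrite lee_fin lerDl sqr_ge0.
Qed.

Lemma size12_sqr_le g : measurable_fun setT g ->
  (\int[m]_v (g v ^+ 2)%:E <= size12 g)%E.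
Proof.
move=> mg; apply: ge0_le_integral => //.
- by move=> v _; rewrite lee_fin sqr_ge0.
- by apply/measurable_EFinP; exact: measurable_funX.
- exact: measurable_size12.
- by move=> v _; rewrite lee_fin lerDr.
Qed.

Lemma integrable_size12 g : m.-integrable setT (EFin \o g) ->
  m.-integrable setT (EFin \o (fun v => g v * g v)) -> (size12 g < +oo)%E.
Proof.
move=> /integrableP[mg ig] /integrableP[mg2 ig2].
have -> : size12 g = (\int[m]_v `|(EFin \o g) v| + \int[m]_v `|(EFin \o (fun v => g v * g v)%R) v|)%E.
  rewrite -ge0_integralD //; [|exact: measurableT_comp|exact: measurableT_comp].
  apply: eq_integral => v _; rewrite -EFinD /=; congr (_ + _)%:E.
  by rewrite -expr2 ger0_norm ?sqr_ge0.
by rewrite lte_add_pinfty.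
Qed.

Lemma size12_norm g : size12 (fun v => `|g v|) = size12 g.
Proof. by apply: eq_integral => v _; rewrite normr_id real_normK // num_real. Qed.

Lemma size12Z_fin a g : measurable_fun setT g -> (size12 g < +oo)%E ->
  (size12 (fun v => a * g v)%R < +oo)%E.
Proof.
move=> mg g12; rewrite (_ : (fun v => _) = (fun v => a * g v + cst 0 v)); last first.
  by apply/funext => v; rewrite addr0.
apply: le_lt_trans (size12_lin _ _ _) _ => //.
have -> : size12 (cst 0) = 0%E.
  by rewrite /size12 integral0_eq // => v _; rewrite /= normr0 expr0n addr0.
rewrite mule0 adde0; apply: lte_mul_pinfty => //.
by rewrite lee_fin mulr_ge0 // addr_ge0 ?sqr_ge0.
Qed.

Variable S : (T -> R) -> Prop.
Hypothesis Smeas : forall s, S s -> measurable_fun setT s.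
Hypothesis Slin : forall a f g, S f -> S g -> S (fun v => a * f v + g v).

Definition closure12 g := measurable_fun setT g /\
  forall e : R, 0 < e -> exists2 s, S s & (size12 (fun v => s v - g v)%R <= e%:E)%E.

Lemma closure12_sub s : S s -> closure12 s.
Proof.
move=> Ss; split; first exact: Smeas.
move=> e e0; exists s => //; rewrite /size12 integral0_eq ?lee_fin ?ltW // => v _.
by rewrite subrr normr0 expr0n addr0.
Qed.

Lemma closure12_lin a f g : closure12 f -> closure12 g -> closure12 (fun v => a * f v + g v).
Proof.
move=> [mf hf] [mg hg]; split; first by apply: measurable_funD => //; exact: measurable_funM.
move=> e e0; set K := 2 * (`|a| + a ^+ 2).
have K0 : 0 <= K by rewrite mulr_ge0 // addr_ge0 ?sqr_ge0.
have [s Ss hs] := hf (e / 2 / (K + 1)) (ltac:(by rewrite divr_gt0 ?divr_gt0 // ltr_wpDl)).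
have [s' Ss' hs'] := hg (e / 4) (ltac:(by rewrite divr_gt0)).
exists (fun v => a * s v + s' v); first exact: Slin.
rewrite (_ : (fun v => _) = (fun v => a * (s v - f v) + (s' v - g v))); last first.
  by apply/funext => v; ring.
apply: le_trans (size12_lin _ _ _) _; try by apply: measurable_funB => //; exact: Smeas.
have -> : e%:E = (e / 2)%:E + (2 * (e / 4))%:E by rewrite -EFinD; congr EFin; field.
apply: leeD.
  apply: (@le_trans _ _ (K%:E * (e / 2 / (K + 1))%:E)%E); first by apply: lee_wpmul2l.
  rewrite -EFinM lee_fin.
  have K1 : K / (K + 1) <= 1 by rewrite ler_pdivrMr ?ltr_wpDl // mul1r lerDl.
  by rewrite mulrCA ler_piMr // divr_ge0 // ltW.
by rewrite EFinM; apply: lee_wpmul2l; rewrite ?lee_fin.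
Qed.

(** Stability under dominated pointwise limits is what makes all the
    approximation steps of this file instances of one lemma. *)
Lemma closure12_lim (f : nat -> T -> R) g G :
  (forall n, closure12 (f n)) -> measurable_fun setT G ->
  (forall n v, `|f n v| <= G v) -> (forall v, f n v @[n --> \oo] --> g v) ->
  (size12 G < +oo)%E -> closure12 g.
Proof.
move=> cf mG fG fg G12.
have mf n : measurable_fun setT (f n) := (cf n).1.
have mg : measurable_fun setT g.
  by apply: (@measurable_fun_cvg _ _ _ _ f) => // v _; exact: fg.
split=> // e e0.
have /fine_cvgP[hfin hcv] := size12_dominated mf mg mG fG fg G12.
have e40 : 0 < e / 4 by rewrite divr_gt0.
have [N _ /(_ N (leqnn N)) [/= fN hN]] := filterI hfin (cvgr0_norm_lt _ hcv _ e40).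
have [s Ss hs] := (cf N).2 (e / 8) (ltac:(by rewrite divr_gt0)).
exists s => //.
(* The coefficient 1 puts the sum in the form of [size12_lin], whose
   constants then become 4 and 2. *)
rewrite (_ : (fun v => _) = (fun v => 1 * (s v - f N v) + (f N v - g v))); last first.
  by apply/funext => v; ring.
apply: le_trans (size12_lin _ _ _) _.
- by apply: measurable_funB => //; exact: Smeas.
- exact: measurable_funB.
have {}hN : (size12 (fun v => f N v - g v)%R <= (e / 4)%:E)%E.
  by rewrite -(fineK fN) lee_fin (le_trans (ler_norm _)) // ltW.
have -> : e%:E = (2 * (`|1| + 1 ^+ 2) * (e / 8))%:E + (2 * (e / 4))%:E :> \bar R.
  by rewrite -EFinD normr1; congr EFin; field.
by rewrite !EFinM; apply: leeD; apply: lee_wpmul2l; rewrite ?lee_fin // mulr_ge0 // addr_ge0 ?sqr_ge0.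
Qed.
End Size12.

(** * Density of the span of Gaussian products *)

Section GaussianSpan.
Variable R : realType.
Variable mu : R.
Hypothesis ha : 2^-1 <= mu + 1.
Notation leb := (@lebesgue_measure R).
Notation m := (dunkl_measure mu).

Let p0 : 0 <= 2 * mu + 1.
Proof. by move: ha; lra. Qed.

Lemma measurable_gauss_mono b t : measurable_fun [set: measurableTypeR R] (gauss_mono b t : R -> R).
Proof. by apply: measurable_funM; [exact: measurable_funX|exact: measurable_expR_sqr]. Qed.

Lemma integrable_gauss_mono_weight1 b t : 0 < t ->
  leb.-integrable setT (EFin \o (fun x => gauss_mono b t x * weight1 mu x)).
Proof.
move=> t0; have b2 : (b <= 2)%N by case: (b).
have := integrable_pow_absgauss b2 p0 t0; apply: eq_integrable => // x _ /=.
by rewrite /gauss_mono /absgauss /weight1; congr EFin; ring.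
Qed.

Definition gatom b c s t (v : plane R) : R := gauss_mono b s v.1 * gauss_mono c t v.2.

Lemma measurable_gatom b c s t : measurable_fun setT (gatom b c s t).
Proof. by apply: measurable_tensor; exact: measurable_gauss_mono. Qed.

Lemma integrable_gatomM b c s t b' c' s' t' : 0 < s -> 0 < t -> 0 < s' -> 0 < t' ->
  m.-integrable setT (EFin \o (fun v => gatom b c s t v * gatom b' c' s' t' v)).
Proof.
move=> s0 t0 s0' t0'.
have mm b1 b2 s1 s2 : measurable_fun [set: measurableTypeR R] (fun x => gauss_mono b1 s1 x * gauss_mono b2 s2 x : R).
  by apply: measurable_funM; exact: measurable_gauss_mono.
have := integrable_tensor (mm b b' s s') (mm c c' t t')
   (@gauss_mono_dot R mu b b' s s' ha s0 s0').1 (@gauss_mono_dot R mu c c' t t' ha t0 t0').1.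
by apply: eq_integrable => // v _; rewrite /= /gatom; congr EFin; ring.
Qed.

Lemma size12_gatom b c s t : 0 < s -> 0 < t -> (size12 m (gatom b c s t) < +oo)%E.
Proof.
move=> s0 t0; apply: integrable_size12; last exact: integrable_gatomM.
apply: integrable_tensor; try exact: measurable_gauss_mono; exact: integrable_gauss_mono_weight1.
Qed.

(** The linear span of the functions [gatom], presented so that linear and
    bilinear identities are proved by induction on the terms of a combination. *)
Inductive gspan : (plane R -> R) -> Prop :=
| gspan0 : gspan (cst 0)
| gspanD a b c s t f : 0 < s -> 0 < t -> gspan f ->
    gspan (fun v => a * gatom b c s t v + f v).

Let gspan_ext f g : gspan f -> (forall x, f x = g x) -> gspan g.
Proof. by move=> wf fg; rewrite (_ : g = f) //; apply/funext => x; rewrite fg. Qed.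

Lemma gspan_lin a f g : gspan f -> gspan g -> gspan (fun v => a * f v + g v).
Proof.
move=> Sf Sg; elim: Sf => [|a' b c s t {}f s0 t0 _ IH].
  by apply: (gspan_ext Sg) => v; rewrite /= mulr0 add0r.
by apply: (gspan_ext (gspanD (a * a') b c s0 t0 IH)) => v; ring.
Qed.

Lemma gspan_gatom b c s t : 0 < s -> 0 < t -> gspan (gatom b c s t).
Proof.
by move=> s0 t0; apply: (gspan_ext (gspanD 1 b c s0 t0 gspan0)) => v; rewrite mul1r addr0.
Qed.

Lemma gspan_measurable f : gspan f -> measurable_fun setT f.
Proof.
elim=> [|a b c s t {}f s0 t0 _ IH]; first exact: measurable_cst.
by apply: measurable_funD => //; apply: measurable_funM => //; exact: measurable_gatom.
Qed.

Lemma gspan_size12 f : gspan f -> (size12 m f < +oo)%E.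
Proof.
elim=> [|a b c s t {}f s0 t0 Sf IH].
  rewrite /size12 integral0_eq ?ltry // => v _.
  by rewrite /= normr0 expr0n addr0.
apply: le_lt_trans (size12_lin _ _ _ _) _; first exact: measurable_gatom.
  exact: gspan_measurable.
rewrite lte_add_pinfty // lte_mul_pinfty ?lee_fin //; last exact: size12_gatom.
by rewrite mulr_ge0 // addr_ge0 ?sqr_ge0.
Qed.

Notation V := (closure12 m gspan).

Let V_ext f g : V f -> (forall x, f x = g x) -> V g.
Proof. by move=> wf fg; rewrite (_ : g = f) //; apply/funext => x; rewrite fg. Qed.

Let V_lin a f g : V f -> V g -> V (fun v => a * f v + g v).
Proof. by apply: closure12_lin; [exact: gspan_measurable|exact: gspan_lin]. Qed.

Let V_lim (f : nat -> plane R -> R) g G : (forall n, V (f n)) -> measurable_fun setT G ->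
  (forall n v, `|f n v| <= G v) -> (forall v, f n v @[n --> \oo] --> g v) ->
  (size12 m G < +oo)%E -> V g.
Proof. by apply: closure12_lim; exact: gspan_measurable. Qed.

Let V0 : V (cst 0).
Proof. by apply: closure12_sub; [exact: gspan_measurable|exact: gspan0]. Qed.

(** The class argument on the line, applied to the first factor with the second
    one fixed. *)
Lemma closure12_indic_gauss_mono A K c t : measurable (A : set (measurableTypeR R)) ->
  A `<=` `[-K, K]%classic -> 0 < t -> V (fun v : plane R => \1_A (v.1 : R) * gauss_mono c t v.2).
Proof.
move=> mA AK t0.
apply: (@W_bounded_measurable R (fun f => V (fun v : plane R => f (v.1 : R) * gauss_mono c t v.2)) _ _ _ K A mA AK).
- by move=> a f g Vf Vg; apply: (V_ext (V_lin a Vf Vg)) => v; ring.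
- move=> f g C d d0 Vf fg fC.
  have d20 : 0 < 2 * d by rewrite mulr_gt0.
  apply: (@V_lim (fun n v => f n v.1 * gauss_mono c t v.2) _ (fun v => `|C * gatom false c (2 * d) t v|) Vf).
  + by apply: measurableT_comp => //; apply: measurable_funM => //; exact: measurable_gatom.
  + move=> n v; rewrite /gatom mulrA !normrM ler_wpM2r // (le_trans (fC n v.1)) //.
    rewrite /gauss_mono expr0 normr1 mul1r (ger0_norm (expR_ge0 _)).
    have -> : 2 * d * (v.1 : R) ^+ 2 / 2 = d * (v.1 : R) ^+ 2 by field.
    by rewrite ler_wpM2r ?expR_ge0 // ler_norm.
  + by move=> v; apply: cvgMl; exact: fg.
  + rewrite size12_norm; apply: size12Z_fin; first exact: measurable_gatom.
    exact: size12_gatom.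
- move=> b s s0; apply: closure12_sub; first exact: gspan_measurable.
  exact: gspan_gatom.
Qed.

(** The class argument on the line again, for the second factor. *)
Lemma closure12_indic_rect A B K : measurable (A : set (measurableTypeR R)) ->
  measurable (B : set (measurableTypeR R)) ->
  A `<=` `[-K, K]%classic -> B `<=` `[-K, K]%classic ->
  V (fun v : plane R => \1_A (v.1 : R) * \1_B (v.2 : R)).
Proof.
move=> mA mB AK BK.
apply: (@W_bounded_measurable R (fun f => V (fun v : plane R => \1_A (v.1 : R) * f (v.2 : R))) _ _ _ K B mB BK).
- by move=> a f g Vf Vg; apply: (V_ext (V_lin a Vf Vg)) => v; ring.
- move=> f g C d d0 Vf fg fC.
  have d20 : 0 < 2 * d by rewrite mulr_gt0.
  apply: (@V_lim (fun n v => \1_A v.1 * f n v.2) _ (fun v => `|(expR (K ^+ 2) * C) * gatom false false 2 (2 * d) v|) Vf).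
  + by apply: measurableT_comp => //; apply: measurable_funM => //; exact: measurable_gatom.
  + move=> n v; rewrite normrM (le_trans (ler_pM _ _ (indic_le_gauss v.1 AK) (fC n v.2))) //.
    rewrite /gatom /gauss_mono !expr0 !mul1r.
    have -> : 2 * d * (v.2 : R) ^+ 2 / 2 = d * (v.2 : R) ^+ 2 by field.
    have -> : 2 * (v.1 : R) ^+ 2 / 2 = (v.1 : R) ^+ 2 by field.
    by rewrite (le_trans _ (ler_norm _)) //; apply: le_of_eq; ring.
  + by move=> v; apply: cvgMr; exact: fg.
  + rewrite size12_norm; apply: size12Z_fin; first exact: measurable_gatom.
    exact: size12_gatom.
- by move=> b s s0; exact: (closure12_indic_gauss_mono _ mA AK).
Qed.

Definition plane_box K : set (plane R) := `[-K, K]%classic `*` `[-K, K]%classic.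

Lemma plane_box_le_gauss (E : set (plane R)) K v : E `<=` plane_box K ->
  `|\1_E v| <= `|(expR (K ^+ 2) * expR (K ^+ 2)) * gatom false false 2 2 v|.
Proof.
move=> EK; rewrite indicE; case: (boolP (v \in E)) => [|_]; last by rewrite normr0.
rewrite inE => /EK [v1 v2].
have i1 := @indic_le_gauss R `[-K, K]%classic K v.1 (fun _ => id).
have i2 := @indic_le_gauss R `[-K, K]%classic K v.2 (fun _ => id).
have := ler_pM (normr_ge0 _) (normr_ge0 _) i1 i2; rewrite !indicE !mem_set // normr1 mulr1.
move/le_trans; apply; rewrite (le_trans _ (ler_norm _)) //; apply: le_of_eq.
rewrite /gatom /gauss_mono !expr0 !mul1r.
have e (x : R) : 2 * x ^+ 2 / 2 = x ^+ 2 by field.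
by rewrite !e; ring.
Qed.

Lemma measurable_plane_box K : measurable (plane_box K).
Proof. by apply: measurableX. Qed.

(** A Dynkin class argument in the plane, with measurable rectangles as
    generators and everything intersected with a fixed square. *)
Lemma closure12_indic_bounded E K : measurable E -> E `<=` plane_box K -> V (\1_E).
Proof.
move=> mE EK.
pose P (S : set (plane R)) := V (\1_(S `&` plane_box K)).
suff : P E by rewrite /P setIidl.
pose G : set_system (plane R) := [set A `*` B | A in measurable & B in measurable].
suff H : forall S, <<s G >> S -> P S.
  by apply: H; have := mE; rewrite [X in X E -> _]measurable_prod_measurableType.
have Vbox : V (\1_(plane_box K)).
  apply: (V_ext (@closure12_indic_rect `[-K, K]%classic `[-K, K]%classic K _ _ _ _)) => // v.
  by rewrite !indicE in_setX; case: (_ \in _); case: (_ \in _); rewrite /= ?mulr1 ?mulr0.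
apply: (@dynkin_induction _ (plane R) G P).
- exact: measurable_prod_measurableType.
- move=> _ _ [A1 mA1 [A2 mA2 <-]] [B1 mB1 [B2 mB2 <-]].
  exists (A1 `&` B1); first exact: measurableI.
  exists (A2 `&` B2); first exact: measurableI.
  by rewrite setXI.
- by rewrite /P setTI.
- move=> _ [A mA [B mB <-]]; rewrite /P /plane_box -setXI.
  have V' := @closure12_indic_rect (A `&` `[-K, K]%classic) (B `&` `[-K, K]%classic) K
     (measurableI _ _ mA (measurable_itv _)) (measurableI _ _ mB (measurable_itv _)) (@subIsetr _ _ _) (@subIsetr _ _ _).
  apply: (V_ext V') => v.
  by rewrite !indicE in_setX; case: (_ \in _); case: (_ \in _); rewrite /= ?mulr1 ?mulr0.
- move=> S mS PS; rewrite /P.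
  apply: (V_ext (V_lin (-1) PS Vbox)) => v; rewrite !indicE (in_setI v S) (in_setI v (~` S)) in_setC.
  move: (v \in S) (v \in plane_box K) => [] [];
  by rewrite /= !(mulN1r, mulr1, mulr0, oppr0, add0r, addr0, addNr).
- move=> F mF tF PF; rewrite /P.
  have tF' : trivIset setT (fun k => F k `&` plane_box K) by exact: trivIset_setIr.
  have UE : \bigcup_k (F k) `&` plane_box K = \bigcup_k (F k `&` plane_box K).
    by rewrite setI_bigcupl.
  apply: (@V_lim (fun n v => \sum_(0 <= i < n) \1_(F i `&` plane_box K) v) _
     (fun v => `|(expR (K ^+ 2) * expR (K ^+ 2)) * gatom false false 2 2 v|)).
  + elim=> [|n IH]; first by apply: (V_ext V0) => v; rewrite big_nil.
    by apply: (V_ext (V_lin 1 (PF n) IH)) => v; rewrite big_nat_recr //= mul1r addrC.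
  + by apply: measurableT_comp => //; apply: measurable_funM => //; exact: measurable_gatom.
  + move=> n v; rewrite ger0_norm; last by apply: sumr_ge0 => i _; rewrite indicE.
    apply: (le_trans (sum_indic_le R n v tF')).
    by rewrite -UE (le_trans (ler_norm _)) // plane_box_le_gauss //; exact: subIsetr.
  + by move=> v; rewrite UE; exact: cvg_sum_indic.
  + rewrite size12_norm; apply: size12Z_fin; first exact: measurable_gatom.
    exact: size12_gatom.
Qed.

Import HBNNSimple.

Let V_sum (I : Type) (l : seq I) (F : I -> plane R -> R) : (forall i, V (F i)) ->
  V (fun v => \sum_(i <- l) F i v).
Proof.
move=> VF; elim: l => [|i l IH]; first by apply: (V_ext V0) => x; rewrite big_nil.
by apply: (V_ext (V_lin 1 (VF i) IH)) => x; rewrite big_cons mul1r.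
Qed.

(** Increasing simple functions, cut off to growing squares, converge to the
    function and are dominated by it. *)
Lemma gspan_dense_ge0 (g : plane R -> R) : measurable_fun setT g -> (forall v, 0 <= g v) ->
  (size12 m g < +oo)%E -> V g.
Proof.
move=> mg g0 g12.
have mEg : measurable_fun [set: plane R] (EFin \o g) by exact/measurable_EFinP.
pose h n : plane R -> R := nnsfun_approx measurableT mEg n.
have hg v : h n v @[n --> \oo] --> g v.
  have := @cvg_nnsfun_approx _ _ R setT measurableT _ mEg (fun v _ => g0 v) v I.
  by move=> /fine_cvgP[_].
have hle n v : 0 <= h n v <= g v.
  apply/andP; split; first by rewrite /h.
  have nd : nondecreasing_seq (h ^~ v).
    by move=> i j ij; have /lefP := nd_nnsfun_approx measurableT mEg ij; apply.
  rewrite -(cvg_lim (@Rhausdorff R) (hg v)); apply: nondecreasing_cvgn_le => //.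
  by apply/cvg_ex; eexists; exact: hg.
apply: (@V_lim (fun n v => h n v * \1_(plane_box n%:R) v) _ g).
- move=> n; rewrite /h; move: (nnsfun_approx _ _ n) => k.
  pose F (y : R) (v : plane R) : R := y * \1_(k @^-1` [set y] `&` plane_box n%:R) v.
  have VF y : V (F y).
    have V1 : V (\1_(k @^-1` [set y] `&` plane_box n%:R)).
      apply: (@closure12_indic_bounded _ n%:R); last exact: subIsetr.
      by apply: measurableI; [exact: measurable_sfunP|exact: measurable_plane_box].
    by apply: (V_ext (V_lin y V1 V0)) => v; rewrite addr0.
  rewrite (_ : (fun v => _) = (fun v => \sum_(y <- finmap.enum_fset (fset_set (range k))) F y v)); first exact: V_sum.
  apply/funext => v; rewrite fimfunE fsbig_finite //= mulr_suml; apply: eq_bigr => y _; rewrite /F.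
  rewrite !indicE (in_setI v (_ @^-1` _)) -mulrA; congr (_ * _).
  by case: (v \in _); case: (v \in _); rewrite /= ?mulr0 ?mulr1.
- exact: mg.
- move=> n v; have /andP[h0 h1] := hle n v.
  rewrite normrM (ger0_norm h0) indicE; case: (_ \in _); rewrite ?normr1 ?mulr1 //.
  by rewrite normr0 mulr0.
- move=> v; rewrite -[X in _ --> X]mulr1; apply: cvgM; first exact: hg.
  apply: cvg_near_cst; near=> n; rewrite indicE mem_set //.
  split; rewrite /= in_itv /= -ler_norml; near: n; exact: nbhs_infty_ger.
- exact: g12.
Unshelve. all: by end_near.
Qed.

(** Decompose into positive and negative parts, written as (|g| + g) / 2 and
    (|g| - g) / 2. *)
Lemma gspan_dense g : measurable_fun setT g -> (size12 m g < +oo)%E -> V g.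
Proof.
move=> mg g12.
have mpos (k : plane R -> R) : measurable_fun setT k -> measurable_fun setT (fun v => 2^-1 * (`|k v| + k v)).
  move=> mk; apply: measurable_funM => //; apply: measurable_funD => //; exact: measurableT_comp.
have pos0 (k : plane R -> R) v : 0 <= 2^-1 * (`|k v| + k v).
  by rewrite mulr_ge0 ?invr_ge0 // -[k v in X in _ + X]opprK subr_ge0 -normrN ler_norm.
have pos (k : plane R -> R) : measurable_fun setT k -> (size12 m k < +oo)%E -> V (fun v => 2^-1 * (`|k v| + k v)).
  move=> mk k12; apply: gspan_dense_ge0 => //; first exact: mpos.
  apply: le_lt_trans (size12_mono _ _ _ _) k12 => //; first exact: mpos.
  by move=> v; rewrite ger0_norm //; have := ler_norm (k v); move: (pos0 k v); lra.
have mN : measurable_fun setT (fun v => (-1) * g v) by apply: measurable_funM.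
have P1 := pos _ mg g12; have P2 := pos _ mN (size12Z_fin (-1) mg g12).
apply: (V_ext (V_lin (-1) P2 P1)) => v.
by rewrite !mulN1r normrN; move: `|_| => u; lra.
Qed.
End GaussianSpan.

(** * The Hartley transform of the plane *)

Section Size12More.
Context d (T : measurableType d) (R : realType) (m : {measure set T -> \bar R}).
Implicit Types (f g : T -> R).

Definition sqint f : \bar R := (\int[m]_v (f v ^+ 2)%:E)%E.

Lemma sqint_ge0 f : (0 <= sqint f)%E.
Proof. by apply: integral_ge0 => v _; rewrite lee_fin sqr_ge0. Qed.

(** It replaces the triangle inequality of the L^2 norm: with e tending to 0
    after the approximation, no square root is needed. *)
Lemma sqint_quasi (e : R) f g : 0 < e -> measurable_fun setT f -> measurable_fun setT g ->
  (sqint f <= (1 + e)%:E * sqint g + (1 + e^-1)%:E * sqint (fun v => f v - g v)%R)%E.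
Proof.
move=> e0 mf mg.
have msq (h : T -> R) : measurable_fun setT h -> measurable_fun setT (fun v : T => (h v ^+ 2)%:E : \bar R).
  by move=> mh; apply/measurable_EFinP; exact: measurable_funX.
have e1 : 0 <= 1 + e by rewrite addr_ge0 // ltW.
have e2 : 0 <= 1 + e^-1 by rewrite addr_ge0 // invr_ge0 ltW.
have mfg : measurable_fun setT (fun v => f v - g v) by exact: measurable_funB.
rewrite /sqint -!ge0_integralZl_EFin //; try (by move=> v _; rewrite lee_fin sqr_ge0); try exact: msq.
rewrite -ge0_integralD //; try (by move=> v _; rewrite mule_ge0 // lee_fin sqr_ge0);
  try (by apply: measurable_funeM; exact: msq).
apply: ge0_le_integral => //.
- by move=> v _; rewrite lee_fin sqr_ge0.
- exact: msq.
- by apply: emeasurable_funD; apply: measurable_funeM; exact: msq.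
- move=> v _; rewrite -!EFinM -EFinD lee_fin.
  move: (f v) (g v) => x y.
  have : 0 <= e^-1 * (x - y - e * y) ^+ 2 by rewrite mulr_ge0 ?sqr_ge0 // invr_ge0 ltW.
  have -> : e^-1 * (x - y - e * y) ^+ 2 = (1 + e) * y ^+ 2 + (1 + e^-1) * (x - y) ^+ 2 - x ^+ 2.
    by field; rewrite gt_eqF.
  by rewrite subr_ge0.
Qed.

Lemma size12_integrableM f g : measurable_fun setT f -> measurable_fun setT g ->
  (size12 m f < +oo)%E -> (size12 m g < +oo)%E -> m.-integrable setT (EFin \o (fun v => f v * g v)).
Proof.
move=> mf mg f12 g12.
have isq h : measurable_fun setT h -> (size12 m h < +oo)%E -> m.-integrable setT (EFin \o (fun v => h v ^+ 2)).
  move=> mh h12; apply/integrableP; split; first by apply/measurable_EFinP; exact: measurable_funX.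
  apply: le_lt_trans h12; apply: le_trans (size12_sqr_le _ mh).
  by apply: le_of_eq; apply: eq_integral => v _; rewrite /= ger0_norm ?sqr_ge0.
have := integrableD measurableT (isq _ mf f12) (isq _ mg g12).
apply: le_integrable => //.
  by apply/measurable_EFinP; exact: measurable_funM.
move=> v _; rewrite -EFinD lee_fin normrM [leRHS]ger0_norm ?addr_ge0 ?sqr_ge0 //.
rewrite -(real_normK (num_real (f v))) -(real_normK (num_real (g v))).
have := normr_ge0 (f v); have := normr_ge0 (g v); move: `|f v| `|g v| => x y; nra.
Qed.
Lemma integrable_scale (a : R) f : m.-integrable setT (EFin \o f) ->
  m.-integrable setT (EFin \o (fun v => a * f v)).
Proof.
by move=> fi; have := integrableZl measurableT a fi; apply: eq_integrable => // v _ /=; rewrite EFinM.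
Qed.

Lemma Rintegral_lin4 (f1 f2 f3 f4 : T -> R) (e2 e3 e4 : R) :
  m.-integrable setT (EFin \o f1) -> m.-integrable setT (EFin \o f2) ->
  m.-integrable setT (EFin \o f3) -> m.-integrable setT (EFin \o f4) ->
  m.-integrable setT (EFin \o (fun v => f1 v + e2 * f2 v + e3 * f3 v + e4 * f4 v)) /\
  \int[m]_v (f1 v + e2 * f2 v + e3 * f3 v + e4 * f4 v) =
  \int[m]_v f1 v + e2 * \int[m]_v f2 v + e3 * \int[m]_v f3 v + e4 * \int[m]_v f4 v.
Proof.
move=> i1 i2 i3 i4.
have step (a : R) (k l : T -> R) : m.-integrable setT (EFin \o k) -> m.-integrable setT (EFin \o l) ->
   m.-integrable setT (EFin \o (fun v => k v + a * l v)) /\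
   \int[m]_v (k v + a * l v) = \int[m]_v k v + a * \int[m]_v l v.
  move=> ki li; have ali := integrable_scale a li.
  split; first by have := integrableD measurableT ki ali; apply: eq_integrable.
  by rewrite RintegralD // RintegralZl.
have [j1 E1] := step e2 _ _ i1 i2; have [j2 E2] := step e3 _ _ j1 i3; have [j3 E3] := step e4 _ _ j2 i4.
by split => //; rewrite E3 E2 E1.
Qed.
End Size12More.

Section Hartley.
Variable R : realType.
Variable mu : R.
Hypothesis ha : 2^-1 <= mu + 1.
Notation leb := (@lebesgue_measure R).
Notation m := (dunkl_measure mu).
Implicit Types (g h f : plane R -> R) (a b c : bool).

(** Indexing the two parts of the kernel by their parity makes the effect of a
    reflection a sign, computed from booleans. *)
Definition dunkl_half a (x : R) := if a then dunkl_odd mu x else dunkl_even mu x.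

Lemma dunkl_half_le1 a x : `|dunkl_half a x| <= 1.
Proof.
have h := dunkl_kernel_le1 x ha; rewrite -[leRHS]sqrtr1 -sqrtr_sqr ler_sqrt //.
by case: a; rewrite (le_trans _ h) // ?lerDl ?lerDr sqr_ge0.
Qed.

Lemma continuous_dunkl_half a : continuous (dunkl_half a).
Proof. by case: a; [exact: continuous_dunkl_odd|exact: continuous_dunkl_even]. Qed.

Lemma dunkl_halfN a x : dunkl_half a (- x) = (-1) ^+ a * dunkl_half a x.
Proof. by case: a; rewrite /dunkl_half ?dunkl_oddN ?dunkl_evenN ?expr1 ?mulN1r ?expr0 ?mul1r. Qed.

Lemma measurable_dunkl_half a (y : R) : measurable_fun [set: measurableTypeR R] (fun x => dunkl_half a (y * x)).
Proof.
apply: (@measurableT_comp _ _ _ _ _ _ (dunkl_half a)); last exact: measurable_funM.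
by apply: continuous_measurable_fun; exact: continuous_dunkl_half.
Qed.

Definition dunkl_half2 a b (w v : plane R) : R := dunkl_half a ((w.1 : R) * v.1) * dunkl_half b ((w.2 : R) * v.2).

Lemma measurable_dunkl_half2 a b w : measurable_fun setT (dunkl_half2 a b w).
Proof.
exact: (measurable_tensor (measurable_dunkl_half a w.1) (measurable_dunkl_half b w.2)).
Qed.

Lemma dunkl_half2_le1 a b w v : `|dunkl_half2 a b w v| <= 1.
Proof. by rewrite normrM mulr_ile1 ?dunkl_half_le1. Qed.

Lemma integrable_dunkl_half2 a b w g : m.-integrable setT (EFin \o g) ->
  m.-integrable setT (EFin \o (fun v => dunkl_half2 a b w v * g v)).
Proof.
move=> ig; have mg := measurable_int _ ig; move: mg => /measurable_EFinP mg.
apply: le_integrable ig => //.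
  by apply/measurable_EFinP/measurable_funM => //; exact: measurable_dunkl_half2.
by move=> v _; rewrite lee_fin normrM ler_piMl // dunkl_half2_le1.
Qed.

(** The integrals from which both the scalar and the quaternion transform are
    built; each has a definite parity in each variable of the frequency. *)
Definition half_transform a b g w : R := \int[m]_v (dunkl_half2 a b w v * g v).

Lemma half_transform_axis_refl a b c e g w : m.-integrable setT (EFin \o g) ->
  half_transform a b g (axis_refl c e w) = (-1) ^+ (a && c) * (-1) ^+ (b && e) * half_transform a b g w.
Proof.
move=> ig.
have E v : dunkl_half2 a b (axis_refl c e w) v * g v = (-1) ^+ (a && c) * (-1) ^+ (b && e) * (dunkl_half2 a b w v * g v).
  have kE a' c' (x y : R) : dunkl_half a' ((-1) ^+ c' * x * y) = (-1) ^+ (a' && c') * dunkl_half a' (x * y).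
    case: c'; last by rewrite expr0 mul1r andbF mul1r.
    by rewrite expr1 mulN1r mulNr dunkl_halfN andbT.
  by rewrite /dunkl_half2 /axis_refl /= !kE; ring.
rewrite /half_transform -RintegralZl //; last exact: integrable_dunkl_half2.
by apply: eq_Rintegral => v _; exact: E.
Qed.

Definition hartley g w : R := dunkl_c mu ^+ 2 *
  \int[m]_v (hartley_kernel mu ((w.1 : R) * v.1) * hartley_kernel mu ((w.2 : R) * v.2) * g v).

Lemma hartley_kernel2E w v : hartley_kernel mu ((w.1 : R) * v.1) * hartley_kernel mu ((w.2 : R) * v.2) =
  dunkl_half2 false false w v + dunkl_half2 false true w v + dunkl_half2 true false w v + dunkl_half2 true true w v :> R.
Proof. by rewrite /hartley_kernel /dunkl_half2 /dunkl_half; ring. Qed.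

Lemma hartley_kernel2_lin4 g w : m.-integrable setT (EFin \o g) ->
  m.-integrable setT (EFin \o (fun v => hartley_kernel mu ((w.1 : R) * v.1) * hartley_kernel mu ((w.2 : R) * v.2) * g v)) /\
  \int[m]_v (hartley_kernel mu ((w.1 : R) * v.1) * hartley_kernel mu ((w.2 : R) * v.2) * g v) =
  half_transform false false g w + half_transform false true g w + half_transform true false g w + half_transform true true g w.
Proof.
move=> ig; have I a b := integrable_dunkl_half2 a b w ig.
have [] := Rintegral_lin4 1 1 1 (I false false) (I false true) (I true false) (I true true).
rewrite !mul1r; rewrite (_ : (fun v => _) =
  (fun v => hartley_kernel mu ((w.1 : R) * v.1) * hartley_kernel mu ((w.2 : R) * v.2) * g v)) //.
by apply/funext => v; rewrite hartley_kernel2E; ring.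
Qed.

Lemma hartley_half_transform g w : m.-integrable setT (EFin \o g) ->
  hartley g w = dunkl_c mu ^+ 2 * (half_transform false false g w + half_transform false true g w +
    half_transform true false g w + half_transform true true g w).
Proof. by move=> ig; rewrite /hartley (hartley_kernel2_lin4 w ig).2. Qed.

Lemma integrable_hartley_kernel2 g w : m.-integrable setT (EFin \o g) ->
  m.-integrable setT (EFin \o (fun v => hartley_kernel mu ((w.1 : R) * v.1) * hartley_kernel mu ((w.2 : R) * v.2) * g v)).
Proof. by move=> ig; have [] := hartley_kernel2_lin4 w ig. Qed.

Lemma hartley_lin (a : R) f g w : m.-integrable setT (EFin \o f) -> m.-integrable setT (EFin \o g) ->
  hartley (fun v => a * f v + g v) w = a * hartley f w + hartley g w.
Proof.
move=> fi gi; rewrite /hartley mulrCA -mulrDr; congr (_ * _).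
have If := integrable_hartley_kernel2 w fi; have Ig := integrable_hartley_kernel2 w gi.
rewrite -RintegralZl // -RintegralD //; last exact: integrable_scale.
by apply: eq_Rintegral => v _; ring.
Qed.

(** The transform is uniformly small when [size12] is small, since each of the
    four products of halves of the kernel is bounded by 1. *)
Lemma hartley_le g w : measurable_fun setT g -> (size12 m g < +oo)%E ->
  (`|hartley g w|%:E <= (dunkl_c mu ^+ 2 * 4)%:E * size12 m g)%E.
Proof.
move=> mg g12; have ig := size12_integrable mg g12.
rewrite /hartley normrM (ger0_norm (sqr_ge0 _)) [X in (X <= _)%E]EFinM [X in (_ <= X * _)%E]EFinM -muleA.
apply: lee_wpmul2l; first by rewrite lee_fin sqr_ge0.
have Ig := integrable_hartley_kernel2 w ig.
rewrite /Rintegral -abse_EFin fineK; last exact: integrable_fin_num.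
apply: le_trans (le_abse_integral _ measurableT (measurable_int _ Ig)) _.
rewrite /size12 -ge0_integralZl_EFin //; last 2 first.
- by move=> v _; rewrite lee_fin addr_ge0 ?sqr_ge0.
- exact: measurable_size12.
apply: ge0_le_integral => //.
- by apply: measurableT_comp => //; exact: measurable_int Ig.
- by apply: measurable_funeM; exact: measurable_size12.
move=> v _; rewrite -EFinM lee_fin normrM hartley_kernel2E.
have h : `|dunkl_half2 false false w v + dunkl_half2 false true w v + dunkl_half2 true false w v + dunkl_half2 true true w v| <= 4.
  have H a b := dunkl_half2_le1 a b w v.
  have -> : 4 = 1 + 1 + 1 + 1 :> R by ring.
  by do 3! (apply: (le_trans (ler_normD _ _)); apply: lerD; last exact: H).
apply: le_trans (ler_wpM2r _ h) _ => //; apply: ler_wpM2l => //.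
by rewrite lerDl sqr_ge0.
Qed.

Lemma hartley_gatom b c s t w : 0 < s -> 0 < t ->
  hartley (gatom b c s t) w =
  s^-1 `^ (mu + 1 + b%:R) * t^-1 `^ (mu + 1 + c%:R) * gatom b c s^-1 t^-1 w.
Proof.
move=> s0 t0.
have [i1 e1] := hartley_gauss_mono b w.1 ha s0; have [i2 e2] := hartley_gauss_mono c w.2 ha t0.
have mD (b' : bool) s' (y : R) : measurable_fun [set: measurableTypeR R] (fun x => hartley_kernel mu (y * x) * gauss_mono b' s' x : R).
  apply: measurable_funM; last exact: measurable_gauss_mono.
  exact: (measurable_funD (measurable_dunkl_half false y) (measurable_dunkl_half true y)).
have := integral_tensor (mD b s w.1) (mD c t w.2) i1 i2.
rewrite /hartley => E.
rewrite (_ : \int[m]_v _ = \int[m]_v ((hartley_kernel mu ((w.1 : R) * v.1) * gauss_mono b s v.1) * (hartley_kernel mu ((w.2 : R) * v.2) * gauss_mono c t v.2))); last first.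
  by apply: eq_Rintegral => v _; rewrite /gatom; ring.
rewrite E expr2 mulrACA e1 e2 /gatom; ring.
Qed.

Lemma gspan_integrable f : gspan f -> m.-integrable setT (EFin \o f).
Proof. by move=> Sf; apply: size12_integrable; [exact: gspan_measurable|exact: gspan_size12]. Qed.

Lemma gatom_integrable b c s t : 0 < s -> 0 < t -> m.-integrable setT (EFin \o gatom b c s t).
Proof. by move=> s0 t0; apply: gspan_integrable; exact: gspan_gatom. Qed.

(** The span is stable under the transform, because the transform inverts the
    parameters of each atom. *)
Lemma gspan_hartley f : gspan f -> gspan (hartley f).
Proof.
elim=> [|a b c s t {}f s0 t0 Sf IH].
  rewrite (_ : hartley _ = cst 0); first exact: gspan0.
  apply/funext => w; rewrite /hartley /Rintegral integral0_eq ?mulr0 // => v _.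
  by rewrite mulr0.
rewrite (_ : hartley _ = (fun w => (a * (s^-1 `^ (mu + 1 + b%:R) * t^-1 `^ (mu + 1 + c%:R))) * gatom b c s^-1 t^-1 w + hartley f w)).
  by apply: gspanD => //; rewrite invr_gt0.
apply/funext => w; rewrite hartley_lin ?hartley_gatom //; first by ring.
  exact: gatom_integrable.
exact: gspan_integrable.
Qed.

Lemma gspan_integrableM f g : gspan f -> gspan g -> m.-integrable setT (EFin \o (fun v => f v * g v)).
Proof.
move=> Sf Sg; apply: size12_integrableM; try exact: gspan_measurable; exact: gspan_size12.
Qed.

Lemma hartley_gatom_dot b c s t b' c' s' t' : 0 < s -> 0 < t -> 0 < s' -> 0 < t' ->
  \int[m]_v (hartley (gatom b c s t) v * hartley (gatom b' c' s' t') v) =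
  \int[m]_v (gatom b c s t v * gatom b' c' s' t' v).
Proof.
move=> s0 t0 s0' t0'.
have mm b1 b2 s1 s2 : measurable_fun [set: measurableTypeR R] (fun x => gauss_mono b1 s1 x * gauss_mono b2 s2 x : R).
  by apply: measurable_funM; exact: measurable_gauss_mono.
have T s1 t1 s2 t2 : 0 < s1 -> 0 < t1 -> 0 < s2 -> 0 < t2 ->
    \int[m]_v (gatom b c s1 t1 v * gatom b' c' s2 t2 v) =
    \int[leb]_x (gauss_mono b s1 x * gauss_mono b' s2 x * weight1 mu x) * \int[leb]_x (gauss_mono c t1 x * gauss_mono c' t2 x * weight1 mu x).
  move=> s10 t10 s20 t20.
  rewrite -(integral_tensor (mm b b' s1 s2) (mm c c' t1 t2)
    (@gauss_mono_dot R mu b b' s1 s2 ha s10 s20).1 (@gauss_mono_dot R mu c c' t1 t2 ha t10 t20).1).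
  by apply: eq_Rintegral => v _; rewrite /gatom; ring.
rewrite T // -(hartley_gauss_mono_dot b b' ha s0 s0') -(hartley_gauss_mono_dot c c' ha t0 t0').
rewrite mulrACA -T ?invr_gt0 // -RintegralZl //.
  by apply: eq_Rintegral => v _; rewrite !hartley_gatom //; ring.
by apply: gspan_integrableM; apply: gspan_gatom; rewrite invr_gt0.
Qed.

(** Bilinearity reduces the identity to atoms; the two inductions treat the two
    factors. *)
Lemma gspan_dot f g : gspan f -> gspan g ->
  \int[m]_v (hartley f v * hartley g v) = \int[m]_v (f v * g v).
Proof.
have dotlin (a : R) h f1 f2 : gspan h -> gspan f1 -> gspan f2 ->
    \int[m]_v ((a * h v + f1 v) * f2 v) = a * \int[m]_v (h v * f2 v) + \int[m]_v (f1 v * f2 v).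
  move=> Sh S1 S2; rewrite -RintegralZl //; last exact: gspan_integrableM.
  rewrite -RintegralD //; [|by apply: integrable_scale; exact: gspan_integrableM|exact: gspan_integrableM].
  by apply: eq_Rintegral => v _; ring.
have hart0 : hartley (cst 0) = cst 0.
  apply/funext => w; rewrite /hartley /Rintegral integral0_eq ?mulr0 // => v _.
  by rewrite mulr0.
have dot0 (k : plane R -> R) : \int[m]_v (cst 0 v * k v) = 0.
  by rewrite /Rintegral integral0_eq // => v _; rewrite mul0r.
have dotC (h k : plane R -> R) : \int[m]_v (h v * k v) = \int[m]_v (k v * h v).
  by apply: eq_Rintegral => v _; rewrite mulrC.
have hartD (a : R) b c s t f' : 0 < s -> 0 < t -> gspan f' ->
   hartley (fun v => a * gatom b c s t v + f' v) = (fun w => a * hartley (gatom b c s t) w + hartley f' w).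
  move=> s0 t0 Sf'; apply/funext => w; rewrite hartley_lin //; first exact: gatom_integrable.
  exact: gspan_integrable.
move=> Sf; elim: Sf g => [g Sg|a b c s t {}f s0 t0 Sf IH g Sg]; first by rewrite hart0 !dot0.
rewrite hartD // !dotlin //; try exact: gspan_gatom; try exact: gspan_hartley;
  try (by apply: gspan_hartley; exact: gspan_gatom).
rewrite IH //; congr (_ * _ + _).
rewrite dotC [RHS]dotC; elim: Sg => [|a' b' c' s' t' {}g s0' t0' Sg IHg]; first by rewrite hart0 !dot0.
rewrite hartD // !dotlin //; try exact: gspan_gatom; try exact: gspan_hartley;
  try (by apply: gspan_hartley; exact: gspan_gatom).
by rewrite IHg hartley_gatom_dot.
Qed.

Lemma gspan_sqint f : gspan f -> sqint m (hartley f) = sqint m f.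
Proof.
move=> Sf; have Sh := gspan_hartley Sf.
have := gspan_dot Sf Sf; rewrite /Rintegral => E.
have E' k : sqint m k = (\int[m]_v (k v * k v)%:E)%E by apply: eq_integral => v _; rewrite expr2.
rewrite !E' -[LHS]fineK; last by apply: integrable_fin_num => //; exact: gspan_integrableM.
rewrite -[RHS]fineK; last by apply: integrable_fin_num => //; exact: gspan_integrableM.
by rewrite E.
Qed.
End Hartley.
Section Isometry.
Variable R : realType.
Variable mu : R.
Hypothesis ha : 2^-1 <= mu + 1.
Notation m := (dunkl_measure mu).
Notation H := (hartley mu).
Implicit Types (g s : plane R -> R).

Lemma hartleyB g s w : measurable_fun setT g -> measurable_fun setT s ->
  (size12 m g < +oo)%E -> (size12 m s < +oo)%E ->
  H (fun v => s v - g v) w = H s w - H g w.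
Proof.
move=> mg ms g12 s12.
have := hartley_lin ha (-1) w (size12_integrable mg g12) (size12_integrable ms s12).
rewrite mulN1r [RHS]addrC => <-; congr (H _ w).
by apply/funext => v; rewrite mulN1r addrC.
Qed.

Lemma gspan_approx g (e : R) : measurable_fun setT g -> (size12 m g < +oo)%E -> 0 < e ->
  exists s, gspan s /\ (size12 m (fun v => s v - g v)%R <= e%:E)%E.
Proof. by move=> mg g12 e0; have [_ /(_ e e0)[s Ss hs]] := gspan_dense ha mg g12; exists s. Qed.

Lemma size12_diff_fin g s : measurable_fun setT g -> measurable_fun setT s ->
  (size12 m g < +oo)%E -> (size12 m s < +oo)%E -> (size12 m (fun v => s v - g v)%R < +oo)%E.
Proof.
move=> mg ms g12 s12; rewrite (_ : (fun v => _) = (fun v => (-1) * g v + s v)); last first.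
  by apply/funext => v; ring.
apply: le_lt_trans (size12_lin _ _ _ _) _ => //.
by rewrite lte_add_pinfty // lte_mul_pinfty // lee_fin mulr_ge0 // addr_ge0 ?sqr_ge0.
Qed.

Lemma limn_einf_le (u : nat -> \bar R) c : (forall n, u n <= c)%E -> (limn_einf u <= c)%E.
Proof.
move=> uc; rewrite limn_einf_lim; apply: lime_le; first exact: is_cvg_einfs.
apply: nearW => n; apply: le_trans (uc n); apply: ereal_inf_lbound.
by exists n => /=.
Qed.

(** Along a sequence in the span that tends to g, the transforms converge
    everywhere, so measurability passes to the limit and Fatou's lemma gives the
    inequality. *)
Lemma hartley_measurable_le g : measurable_fun setT g -> (size12 m g < +oo)%E ->
  measurable_fun setT (H g) /\ (sqint m (H g) <= sqint m g)%E.
Proof.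
move=> mg g12.
have qfin : sqint m g \is a fin_num.
  by rewrite ge0_fin_numE ?sqint_ge0 // (le_lt_trans (size12_sqr_le _ mg)).
have key (d : R) : 0 < d -> measurable_fun setT (H g) /\ (sqint m (H g) <= (1 + d)%:E * sqint m g + d%:E)%E.
  move=> d0.
  have d1 : 0 < 1 + d^-1 by rewrite addr_gt0 // invr_gt0.
  (* The tolerance is chosen so that the second term of [sqint_quasi] is at
     most d for every n, while it still tends to 0. *)
  have dn n : 0 < d / (1 + d^-1) * harmonic n by rewrite mulr_gt0 ?divr_gt0 // invr_gt0.
  have [s hs] := choice (fun n => gspan_approx mg g12 (dn n)).
  have Ss n := (hs n).1.
  have ms n : measurable_fun setT (s n) := gspan_measurable (Ss n).
  have s12 n := gspan_size12 ha (Ss n).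
  have mH n : measurable_fun setT (H (s n)) := gspan_measurable (gspan_hartley ha (Ss n)).
  have cH w : H (s n) w @[n --> \oo] --> H g w.
    apply/cvgrPdist_le => e e0.
    pose K := dunkl_c mu ^+ 2 * 4 * (d / (1 + d^-1)).
    have K0 : K * harmonic n @[n --> \oo] --> (0 : R).
      by rewrite -(mulr0 K); apply: cvgM; [exact: cvg_cst|exact: cvg_harmonic].
    near=> n.
    have h1 : `|H g w - H (s n) w| <= K * harmonic n.
      rewrite distrC -hartleyB // -lee_fin.
      apply: le_trans (hartley_le ha w _ _) _; [exact: measurable_funB|exact: size12_diff_fin|].
      have -> : K * harmonic n = dunkl_c mu ^+ 2 * 4 * (d / (1 + d^-1) * harmonic n) by rewrite /K -mulrA.
      rewrite [X in (_ <= X)%E]EFinM; apply: lee_wpmul2l; last exact: (hs n).2.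
      by rewrite lee_fin mulr_ge0 // sqr_ge0.
    apply: (le_trans h1).
    have : `|0 - K * harmonic n| <= e.
      by near: n; apply: (@cvgr_dist_le _ _ _ _ _ _ _ K0).
    by rewrite sub0r normrN; exact: le_trans (ler_norm _).
  have mHg : measurable_fun setT (H g).
    by apply: (@measurable_fun_cvg _ _ _ _ (fun n => H (s n))) => // v _; exact: cH.
  split => //.
  have F := @fatou _ (plane R) R m setT measurableT (fun n (w : plane R) => (H (s n) w ^+ 2)%:E) _ _.
  have mS n : measurable_fun [set: plane R] (fun w : plane R => (H (s n) w ^+ 2)%:E).
    by apply/measurable_EFinP; apply: measurable_funX; exact: mH.
  have {}F := F mS (fun n w _ => (ltac:(by rewrite lee_fin sqr_ge0))).
  apply: le_trans (le_trans _ F) _.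
    apply: le_of_eq; apply: eq_integral => w _.
    have c2 : (H (s n) w ^+ 2)%:E @[n --> \oo] --> (H g w ^+ 2)%:E.
      have c1 : H (s n) w * H (s n) w @[n --> \oo] --> H g w * H g w by apply: cvgM; exact: cH.
      by apply/cvg_EFin; [exact: nearW|exact: c1].
    rewrite is_cvg_limn_einfE; last by apply/cvg_ex; eexists; exact: c2.
    by apply/esym/cvg_lim.
  apply: limn_einf_le => n; rewrite -/(sqint m (H (s n))) gspan_sqint //.
  apply: le_trans (sqint_quasi m d0 (ms n) mg) _; rewrite leeD2l //.
  apply: (@le_trans _ _ ((1 + d^-1)%:E * (d / (1 + d^-1))%:E)%E); last first.
    by rewrite -EFinM lee_fin mulrC divfK // gt_eqF.
  apply: lee_wpmul2l; first by rewrite lee_fin ltW.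
  apply: le_trans (size12_sqr_le _ (measurable_funB (ms n) mg)) _.
  have hn1 : harmonic n <= 1 :> R by rewrite /harmonic /= invf_le1 ?ltr0Sn // ler1n.
  by apply: le_trans (hs n).2 _; rewrite lee_fin ler_piMr // divr_ge0 // ltW.
split; first by have [] := key 1 ltr01.
have q0 : 0 <= fine (sqint m g) by rewrite fine_ge0 ?sqint_ge0.
apply/lee_addgt0Pr => e e0.
have e1 : 0 < e / (fine (sqint m g) + 1) by rewrite divr_gt0 // ltr_wpDl.
have [_ h] := key _ e1; apply: (le_trans h).
rewrite -(fineK qfin) -EFinM -!EFinD lee_fin fineK //.
rewrite mulrDl mul1r -addrA lerD2l -[X in _ + X]mulr1 -mulrDr divfK // gt_eqF // ltr_wpDl //.
Unshelve. all: by end_near.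
Qed.

(** For the reverse inequality, g is compared with an element s of the span, on
    which the transform is isometric, and the previous inequality is applied to
    the difference s - g. *)
Theorem hartley_isometry g : measurable_fun setT g -> (size12 m g < +oo)%E ->
  sqint m (H g) = sqint m g.
Proof.
move=> mg g12; have [mH hle] := hartley_measurable_le mg g12.
apply/eqP; rewrite eq_le hle /=.
have qfin : sqint m g \is a fin_num.
  by rewrite ge0_fin_numE ?sqint_ge0 // (le_lt_trans (size12_sqr_le _ mg)).
have hfin : sqint m (H g) \is a fin_num.
  by rewrite ge0_fin_numE ?sqint_ge0 // (le_lt_trans hle) // -ge0_fin_numE ?sqint_ge0.
rewrite -(fineK qfin) -(fineK hfin) lee_fin.
set q := fine (sqint m g); set h := fine (sqint m (H g)).
have h0 : 0 <= h by rewrite fine_ge0 ?sqint_ge0.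
have key (d : R) : 0 < d -> q <= (1 + d) * ((1 + d) * h + d) + d.
  move=> d0.
  have d1 : 0 < 1 + d^-1 by rewrite addr_gt0 // invr_gt0.
  have dd : 0 < d / (1 + d^-1) by rewrite divr_gt0.
  have [s [Ss hs]] := gspan_approx mg g12 dd.
  have ms := gspan_measurable Ss; have s12 := gspan_size12 ha Ss.
  have mB := measurable_funB ms mg.
  have B12 := size12_diff_fin mg ms g12 s12.
  have b1 : (sqint m (fun v => s v - g v)%R <= (d / (1 + d^-1))%:E)%E.
    exact: le_trans (size12_sqr_le _ mB) hs.
  have [mHB hB] := hartley_measurable_le mB B12.
  have b2 := le_trans hB b1.
  have fold e : (e <= (d / (1 + d^-1))%:E)%E -> ((1 + d^-1)%:E * e <= d%:E)%E.
    move=> he; apply: (@le_trans _ _ ((1 + d^-1)%:E * (d / (1 + d^-1))%:E)%E).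
      by apply: lee_wpmul2l => //; rewrite lee_fin ltW.
    by rewrite -EFinM lee_fin mulrC divfK // gt_eqF.
  have c1 : (sqint m g <= (1 + d)%:E * sqint m s + d%:E)%E.
    apply: le_trans (sqint_quasi m d0 mg ms) _; rewrite leeD2l //; apply: fold.
    rewrite (_ : sqint m _ = sqint m (fun v => s v - g v)%R) //.
    by apply: eq_integral => v _; rewrite -sqrrN opprB.
  have mHs := gspan_measurable (gspan_hartley ha Ss).
  have c2 : (sqint m s <= (1 + d)%:E * sqint m (H g) + d%:E)%E.
    rewrite -gspan_sqint //; apply: le_trans (sqint_quasi m d0 mHs mH) _; rewrite leeD2l //; apply: fold.
    rewrite (_ : sqint m _ = sqint m (H (fun v => s v - g v)%R)) //.
    by apply: eq_integral => v _; rewrite hartleyB.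
  rewrite -lee_fin fineK //; apply: (le_trans c1).
  rewrite [X in (_ <= X)%E]EFinD leeD2r // EFinM; apply: lee_wpmul2l; first by rewrite lee_fin addr_ge0 // ltW.
  by rewrite EFinD EFinM fineK.
apply/ler_addgt0Pr => e e0.
(* For d <= 1 the bound exceeds h by at most 3 d (h + 1). *)
pose d := Num.min 1 (e / (3 * (h + 1))).
have h1 : 0 < 3 * (h + 1) by rewrite mulr_gt0 // ltr_wpDl.
have d0 : 0 < d by rewrite lt_min ltr01 divr_gt0.
have d1 : d <= 1 by rewrite ge_min lexx.
have d2 : d * (3 * (h + 1)) <= e by rewrite -ler_pdivlMr // ge_min lexx orbT.
have k := key d d0; clear key; clearbody d; clearbody h q; move: d0 d1 d2 h0 k e0; nra.
Qed.
End Isometry.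

(** * Norms of quaternions and of quaternion functions *)

Section QuatNorm.
Variable R : realType.
Implicit Types p q : quat R.

Definition qsq q := q0 q ^+ 2 + q1 q ^+ 2 + q2 q ^+ 2 + q3 q ^+ 2.

Lemma qsq_ge0 q : 0 <= qsq q.
Proof. by rewrite !addr_ge0 ?sqr_ge0. Qed.

Lemma qnormE q : qnorm q = Num.sqrt (qsq q).
Proof. by rewrite /qnorm mul_qconj. Qed.

Lemma qnorm_ge0 q : 0 <= qnorm q.
Proof. by rewrite qnormE sqrtr_ge0. Qed.

Lemma sqr_qnorm q : qnorm q ^+ 2 = qsq q.
Proof. by rewrite qnormE sqr_sqrtr // qsq_ge0. Qed.

Lemma qnormM p q : qnorm (p * q) = qnorm p * qnorm q.
Proof.
rewrite !qnormE -sqrtrM ?qsq_ge0 //; congr Num.sqrt.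
by case: p q => [????] [????]; rewrite /qsq /=; ring.
Qed.

Lemma qnorm_real (a : R) : qnorm (quat_real a) = `|a|.
Proof. by rewrite qnormE -sqrtr_sqr /qsq /= expr0n /= !addr0. Qed.

Lemma ler_qnorm_re q : q0 q <= qnorm q.
Proof.
rewrite qnormE (le_trans (ler_norm _)) // -sqrtr_sqr ler_wsqrtr //.
by rewrite /qsq -!addrA lerDl !addr_ge0 ?sqr_ge0.
Qed.

Lemma qnorm_conj q : qnorm (qconj q) = qnorm q.
Proof. by rewrite !qnormE /qsq /= !sqrrN. Qed.

(** The left-hand side is the real part of the product of p with the conjugate
    of q. *)
Lemma qnorm_cauchy p q :
  q0 p * q0 q + q1 p * q1 q + q2 p * q2 q + q3 p * q3 q <= qnorm p * qnorm q.
Proof.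
rewrite -(qnorm_conj q) -qnormM; apply: le_trans (ler_qnorm_re _).
by apply: le_of_eq; rewrite /=; ring.
Qed.

Lemma qnormD p q : qnorm (p + q) <= qnorm p + qnorm q.
Proof.
rewrite -(@ler_pXn2r _ 2) ?nnegrE ?addr_ge0 ?qnorm_ge0 // sqrrD !sqr_qnorm.
have := qnorm_cauchy p q; rewrite /qsq /=; set c := qnorm p * qnorm q; lra.
Qed.

Lemma qnormN q : qnorm (- q) = qnorm q.
Proof. by rewrite !qnormE /qsq /= !sqrrN. Qed.

Lemma ler_coef_qnorm q : [/\ `|q0 q| <= qnorm q, `|q1 q| <= qnorm q,
  `|q2 q| <= qnorm q & `|q3 q| <= qnorm q].
Proof.
have H (x : R) : x ^+ 2 <= qsq q -> `|x| <= qnorm q.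
  by move=> h; rewrite qnormE -sqrtr_sqr ler_wsqrtr.
have := sqr_ge0 (q0 q); have := sqr_ge0 (q1 q); have := sqr_ge0 (q2 q); have := sqr_ge0 (q3 q) => s0 s1 s2 s3.
by split; apply: H; rewrite /qsq; lra.
Qed.
End QuatNorm.

Section QuatNormFun.
Variable R : realType.
Variable mu : R.
Notation m := (dunkl_measure mu).
Implicit Types (f g h : plane R -> quat R).

Lemma quat_measurable_qnorm f : quat_measurable f -> measurable_fun setT (@qnorm R \o f).
Proof.
move=> [f0 f1 f2 f3].
rewrite (_ : _ \o f = Num.sqrt \o (fun v => q0 (f v) ^+ 2 + q1 (f v) ^+ 2 + q2 (f v) ^+ 2 + q3 (f v) ^+ 2)).
  apply: measurableT_comp.
    by apply: continuous_measurable_fun; exact: sqrt_continuous.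
  by repeat apply: measurable_funD; apply: measurable_funX.
by apply/funext => v; rewrite /= qnormE.
Qed.

Lemma quat_measurableD f g : quat_measurable f -> quat_measurable g ->
  quat_measurable (fun v => f v + g v).
Proof. by move=> [? ? ? ?] [? ? ? ?]; split; exact: measurable_funD. Qed.

Lemma quat_measurableB f g : quat_measurable f -> quat_measurable g ->
  quat_measurable (fun v => f v - g v).
Proof. by move=> [? ? ? ?] [? ? ? ?]; split; exact: measurable_funB. Qed.

Lemma quat_measurable_realM (k : plane R -> R) f : measurable_fun setT k -> quat_measurable f ->
  quat_measurable (fun v => quat_real (k v) * f v).
Proof.
move=> mk [f0 f1 f2 f3].
have E v : [/\ q0 (quat_real (k v) * f v) = k v * q0 (f v), q1 (quat_real (k v) * f v) = k v * q1 (f v),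
   q2 (quat_real (k v) * f v) = k v * q2 (f v) & q3 (quat_real (k v) * f v) = k v * q3 (f v)].
  by split; rewrite /=; ring.
split.
- by rewrite (_ : _ \o _ = fun v => k v * q0 (f v)); [exact: measurable_funM|apply/funext => v; case: (E v)].
- by rewrite (_ : _ \o _ = fun v => k v * q1 (f v)); [exact: measurable_funM|apply/funext => v; case: (E v)].
- by rewrite (_ : _ \o _ = fun v => k v * q2 (f v)); [exact: measurable_funM|apply/funext => v; case: (E v)].
- by rewrite (_ : _ \o _ = fun v => k v * q3 (f v)); [exact: measurable_funM|apply/funext => v; case: (E v)].
Qed.

Lemma quat_measurable_indic (A : set (plane R)) f : measurable A -> quat_measurable f ->
  quat_measurable (fun v => quat_real (\1_A v) * f v).
Proof. by move=> mA; apply: quat_measurable_realM; exact: measurable_indic. Qed.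

Lemma dunkl_norm1E f : dunkl_norm mu 1%:E f = (\int[m]_v (qnorm (f v))%:E)%E.
Proof.
rewrite /dunkl_norm Lnorm1; apply: eq_integral => v _ /=.
by rewrite ger0_norm // qnorm_ge0.
Qed.

Lemma dunkl_norm2E f : dunkl_norm mu 2%:E f = sqrte (sqint m (@qnorm R \o f)).
Proof.
rewrite /dunkl_norm unlock poweR12_sqrt; last by apply: integral_ge0 => v _; exact: poweR_ge0.
congr sqrte; apply: eq_integral => v _ /=.
by rewrite powR_mulrn // ger0_norm ?qnorm_ge0.
Qed.

Lemma dunkl_norm_ge0 p f : (0 <= dunkl_norm mu p f)%E.
Proof. exact: Lnorm_ge0. Qed.

Lemma dunkl_norm2_le f g : quat_measurable f -> quat_measurable g ->
  (forall v, qnorm (f v) <= qnorm (g v)) -> (dunkl_norm mu 2%:E f <= dunkl_norm mu 2%:E g)%E.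
Proof.
move=> mf mg fg; rewrite !dunkl_norm2E lee_sqrt ?sqint_ge0 //; apply: ge0_le_integral => //.
- by move=> v _; rewrite lee_fin sqr_ge0.
- by apply/measurable_EFinP; apply: measurable_funX; exact: quat_measurable_qnorm.
- by apply/measurable_EFinP; apply: measurable_funX; exact: quat_measurable_qnorm.
- by move=> v _; rewrite lee_fin /= ler_pXn2r ?nnegrE ?qnorm_ge0.
Qed.

Lemma dunkl_norm2D f g : quat_measurable f -> quat_measurable g ->
  (dunkl_norm mu 2%:E (fun v => f v + g v)%R <= dunkl_norm mu 2%:E f + dunkl_norm mu 2%:E g)%E.
Proof.
move=> mf mg.
have mfg := quat_measurableD mf mg.
have nf := quat_measurable_qnorm mf; have ng := quat_measurable_qnorm mg.
apply: (@le_trans _ _ ('N[m]_2%:E[EFin \o ((@qnorm R \o f) \+ (@qnorm R \o g))%R])%E); last first.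
  by apply: minkowski_EFin => //; rewrite ler1n.

rewrite dunkl_norm2E unlock poweR12_sqrt; last by apply: integral_ge0 => v _; exact: poweR_ge0.
have -> : (\int[m]_x `|(EFin \o ((@qnorm R \o f) \+ (@qnorm R \o g))%R) x| `^ 2 = sqint m ((@qnorm R \o f) \+ (@qnorm R \o g))%R)%E.
  apply: eq_integral => v _ /=.
  by rewrite powR_mulrn // ger0_norm ?addr_ge0 ?qnorm_ge0.
rewrite lee_sqrt ?sqint_ge0 //; apply: ge0_le_integral => //.
- by move=> v _; rewrite lee_fin sqr_ge0.
- by apply/measurable_EFinP; apply: measurable_funX; exact: quat_measurable_qnorm.
- by apply/measurable_EFinP; apply: measurable_funX; exact: measurable_funD.
- by move=> v _; rewrite lee_fin /= ler_pXn2r ?nnegrE ?addr_ge0 ?qnorm_ge0 // qnormD.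
Qed.

Lemma dunkl_norm_distC p f g : dunkl_norm mu p (fun v => f v - g v) = dunkl_norm mu p (fun v => g v - f v).
Proof.
rewrite /dunkl_norm; congr (Lnorm _ _ _); apply/funext => v /=.
by rewrite -qnormN opprB.
Qed.

Lemma dunkl_norm2_dist f g h : quat_measurable f -> quat_measurable g -> quat_measurable h ->
  (dunkl_norm mu 2%:E (fun v => f v - h v)%R <=
   dunkl_norm mu 2%:E (fun v => f v - g v)%R + dunkl_norm mu 2%:E (fun v => g v - h v)%R)%E.
Proof.
move=> mf mg mh.
rewrite (_ : (fun v => f v - h v) = (fun v => (f v - g v) + (g v - h v))); last first.
  by apply/funext => v; rewrite addrA subrK.
by apply: dunkl_norm2D; exact: quat_measurableB.
Qed.

Lemma dunkl_norm2_le_dist f g : quat_measurable f -> quat_measurable g ->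
  (dunkl_norm mu 2%:E f <= dunkl_norm mu 2%:E (fun v => f v - g v)%R + dunkl_norm mu 2%:E g)%E.
Proof.
move=> mf mg; rewrite [in leLHS](_ : f = (fun v => (f v - g v) + g v)); last first.
  by apply/funext => v; rewrite subrK.
by apply: dunkl_norm2D => //; exact: quat_measurableB.
Qed.

Lemma dunkl_L12_size12 f : dunkl_Lp mu 1%:E f -> dunkl_Lp mu 2%:E f ->
  (size12 m (@qnorm R \o f) < +oo)%E.
Proof.
move=> [mf f1] [_ f2]; have nf := quat_measurable_qnorm mf.
rewrite /size12; under eq_integral do rewrite EFinD.
rewrite ge0_integralD //.
- rewrite lte_add_pinfty //.
    move: f1; rewrite dunkl_norm1E; congr (_ < _)%E; apply: eq_integral => v _ /=.
    by rewrite ger0_norm ?qnorm_ge0.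
  move: f2; rewrite dunkl_norm2E -/(sqint m (@qnorm R \o f)) -!ge0_fin_numE ?sqint_ge0 ?sqrte_ge0 //.
  by rewrite sqrte_fin_num // sqint_ge0.
- by apply/measurable_EFinP; exact: measurableT_comp.
- by move=> v _; rewrite lee_fin sqr_ge0.
- by apply/measurable_EFinP; exact: measurable_funX.
Qed.

Lemma dunkl_L12_coef f : dunkl_Lp mu 1%:E f -> dunkl_Lp mu 2%:E f ->
  [/\ (size12 m (q0 \o f) < +oo)%E, (size12 m (q1 \o f) < +oo)%E,
      (size12 m (q2 \o f) < +oo)%E & (size12 m (q3 \o f) < +oo)%E].
Proof.
move=> L1 L2; have [mf _] := L1; have nf := quat_measurable_qnorm mf.
have h := dunkl_L12_size12 L1 L2; have [f0 f1 f2 f3] := mf.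
split; (apply: le_lt_trans (size12_mono _ _ nf _) h; first by []) => v;
  rewrite /= (ger0_norm (qnorm_ge0 _)); by case: (ler_coef_qnorm (f v)).
Qed.
End QuatNormFun.

(** * Plancherel formula for the quaternion transform *)

Section Transform.
Variable R : realType.
Variable mu : R.
Hypothesis ha : 2^-1 <= mu + 1.
Notation m := (dunkl_measure mu).
Notation H := (hartley mu).
Notation t a b k g := (half_transform mu a b (k \o g)).
Implicit Types (g h : plane R -> quat R) (w v : plane R).

(** By parity, each half transform is a signed average of the Hartley transform
    over the four reflections of the frequency, so it inherits measurability
    from there. *)
Lemma measurable_half_transform a b (g : plane R -> R) : measurable_fun setT g -> (size12 m g < +oo)%E ->
  measurable_fun setT (half_transform mu a b g).
Proof.
move=> mg g12; have ig := size12_integrable mg g12.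
have [mH _] := hartley_measurable_le ha mg g12.
have mHr c e : measurable_fun setT (fun w => H g (axis_refl c e w)).
  by apply: measurableT_comp => //; exact: measurable_axis_refl.
have c0 : dunkl_c mu != 0 by rewrite gt_eqF // dunkl_c_gt0.
rewrite (_ : half_transform mu a b g = fun w => (4 * dunkl_c mu ^+ 2)^-1 *
    (H g w + (-1) ^+ b * H g (axis_refl false true w) + (-1) ^+ a * H g (axis_refl true false w)
     + (-1) ^+ a * (-1) ^+ b * H g (axis_refl true true w))); last first.
  apply/funext => w; rewrite !hartley_half_transform // !half_transform_axis_refl //.
  by case: a; case: b;
    move: (half_transform mu false false g w) (half_transform mu false true g w) (half_transform mu true false g w) (half_transform mu true true g w) c0
      => t00 t01 t10 t11 c0 /=; field.
have mm (x : R) c e : measurable_fun setT (fun w => x * H g (axis_refl c e w)).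
  exact: (measurable_funM (measurable_cst x) (mHr c e)).
exact: (measurable_funM (measurable_cst _)
  (measurable_funD (measurable_funD (measurable_funD mH (mm _ _ _)) (mm _ _ _)) (mm _ _ _))).
Qed.

Lemma dunkl_E_qi w v : dunkl_E mu qi (- w.1) v.1 =
  Quat (dunkl_even mu (w.1 * v.1 : R)) (- dunkl_odd mu (w.1 * v.1 : R)) 0 0 :> quat R.
Proof.
rewrite /dunkl_E -/(dunkl_even mu (- w.1 * v.1)) -/(dunkl_odd mu (- w.1 * v.1)).
by rewrite mulNr dunkl_evenN // dunkl_oddN //; congr Quat; rewrite /=; ring.
Qed.

Lemma dunkl_E_qj w v : dunkl_E mu qj (- w.2) v.2 =
  Quat (dunkl_even mu (w.2 * v.2 : R)) 0 (- dunkl_odd mu (w.2 * v.2 : R)) 0 :> quat R.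
Proof.
rewrite /dunkl_E -/(dunkl_even mu (- w.2 * v.2)) -/(dunkl_odd mu (- w.2 * v.2)).
by rewrite mulNr dunkl_evenN // dunkl_oddN //; congr Quat; rewrite /=; ring.
Qed.

Lemma qnorm_dunkl_E w v : qnorm (dunkl_E mu qi (- w.1) v.1) <= 1 /\
  qnorm (dunkl_E mu qj (- w.2) v.2) <= 1.
Proof.
rewrite dunkl_E_qi dunkl_E_qj !qnormE /qsq /= !sqrrN expr0n /= !addr0.
by split; rewrite -[leRHS]sqrtr1 ler_wsqrtr // dunkl_kernel_le1.
Qed.

Notation kern g w v := (dunkl_E mu qi (- w.1) v.1 * g v * dunkl_E mu qj (- w.2) v.2).

Definition quat_integrable g := [/\ m.-integrable setT (EFin \o (q0 \o g)),
  m.-integrable setT (EFin \o (q1 \o g)), m.-integrable setT (EFin \o (q2 \o g)) &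
  m.-integrable setT (EFin \o (q3 \o g))].

(** Multiplication by the unit i on the left and by j on the right permutes the
    coordinates of g, so each coordinate of the product involves every
    coordinate of g once, each with a different pair of halves of the kernel. *)
Lemma kern_coef g w v : let k a b := dunkl_half2 mu a b w v in
  [/\ q0 (kern g w v) = k false false * q0 (g v) + 1 * (k true false * q1 (g v)) + 1 * (k false true * q2 (g v)) + 1 * (k true true * q3 (g v)),
      q1 (kern g w v) = k false false * q1 (g v) + -1 * (k true false * q0 (g v)) + 1 * (k false true * q3 (g v)) + -1 * (k true true * q2 (g v)),
      q2 (kern g w v) = k false false * q2 (g v) + 1 * (k true false * q3 (g v)) + -1 * (k false true * q0 (g v)) + -1 * (k true true * q1 (g v)) &
      q3 (kern g w v) = k false false * q3 (g v) + -1 * (k true false * q2 (g v)) + -1 * (k false true * q1 (g v)) + 1 * (k true true * q0 (g v))].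
Proof.
by move=> k; rewrite dunkl_E_qi dunkl_E_qj /k /dunkl_half2 /dunkl_half; split; rewrite /=; ring.
Qed.

Lemma kern_integrable g w : quat_integrable g -> quat_integrable (fun v => kern g w v).
Proof.
move=> [i0 i1 i2 i3].
have I a b (k : plane R -> R) : m.-integrable setT (EFin \o k) -> _ := integrable_dunkl_half2 ha a b w (g := k).
split.
- have [+ _] := Rintegral_lin4 1 1 1 (I false false _ i0) (I true false _ i1) (I false true _ i2) (I true true _ i3).
  by apply: eq_integrable => // v _; have [e _ _ _] := kern_coef g w v; rewrite /comp e.
- have [+ _] := Rintegral_lin4 (-1) 1 (-1) (I false false _ i1) (I true false _ i0) (I false true _ i3) (I true true _ i2).
  by apply: eq_integrable => // v _; have [_ e _ _] := kern_coef g w v; rewrite /comp e.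
- have [+ _] := Rintegral_lin4 1 (-1) (-1) (I false false _ i2) (I true false _ i3) (I false true _ i0) (I true true _ i1).
  by apply: eq_integrable => // v _; have [_ _ e _] := kern_coef g w v; rewrite /comp e.
- have [+ _] := Rintegral_lin4 (-1) (-1) 1 (I false false _ i3) (I true false _ i2) (I false true _ i1) (I true true _ i0).
  by apply: eq_integrable => // v _; have [_ _ _ e] := kern_coef g w v; rewrite /comp e.
Qed.

Lemma dunkl_transformE g w : quat_integrable g ->
  dunkl_transform mu g w = quat_real (dunkl_c mu ^+ 2) *
  Quat (t false false q0 g w + t true false q1 g w + t false true q2 g w + t true true q3 g w)
       (t false false q1 g w - t true false q0 g w + t false true q3 g w - t true true q2 g w)
       (t false false q2 g w + t true false q3 g w - t false true q0 g w - t true true q1 g w)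
       (t false false q3 g w - t true false q2 g w - t false true q1 g w + t true true q0 g w).
Proof.
move=> [i0 i1 i2 i3].
have I a b (k : plane R -> R) : m.-integrable setT (EFin \o k) -> _ := integrable_dunkl_half2 ha a b w (g := k).
rewrite /dunkl_transform; congr (_ * _); rewrite /quat_integral; congr Quat.
- have [_ E] := Rintegral_lin4 1 1 1 (I false false _ i0) (I true false _ i1) (I false true _ i2) (I true true _ i3).
  rewrite /half_transform -[X in _ = _ + X + _ + _]mul1r -[X in _ = _ + X + _]mul1r -[X in _ = _ + X]mul1r -E.
  by apply: eq_Rintegral => v _; have [-> _ _ _] := kern_coef g w v.
- have [_ E] := Rintegral_lin4 (-1) 1 (-1) (I false false _ i1) (I true false _ i0) (I false true _ i3) (I true true _ i2).
  rewrite /half_transform -[X in _ = _ + X + _ + _]mulN1r -[X in _ = _ + X + _]mul1r -[X in _ = _ + X]mulN1r -E.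
  by apply: eq_Rintegral => v _; have [_ -> _ _] := kern_coef g w v.
- have [_ E] := Rintegral_lin4 1 (-1) (-1) (I false false _ i2) (I true false _ i3) (I false true _ i0) (I true true _ i1).
  rewrite /half_transform -[X in _ = _ + X + _ + _]mul1r -[X in _ = _ + X + _]mulN1r -[X in _ = _ + X]mulN1r -E.
  by apply: eq_Rintegral => v _; have [_ _ -> _] := kern_coef g w v.
- have [_ E] := Rintegral_lin4 (-1) (-1) 1 (I false false _ i3) (I true false _ i2) (I false true _ i1) (I true true _ i0).
  rewrite /half_transform -[X in _ = _ + X + _ + _]mulN1r -[X in _ = _ + X + _]mulN1r -[X in _ = _ + X]mul1r -E.
  by apply: eq_Rintegral => v _; have [_ _ _ ->] := kern_coef g w v.
Qed.

(** Half transforms with different parities are orthogonal for the sum over the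
    four sign changes. On both sides this leaves 4 times the sum of the squares
    of the sixteen half transforms. *)
Lemma sum_axis_refl_dunkl g w : quat_integrable g ->
  qsq (dunkl_transform mu g w) + qsq (dunkl_transform mu g (axis_refl false true w)) +
  qsq (dunkl_transform mu g (axis_refl true false w)) + qsq (dunkl_transform mu g (axis_refl true true w)) =
  let h w := qsq (Quat (H (q0 \o g) w) (H (q1 \o g) w) (H (q2 \o g) w) (H (q3 \o g) w)) in
  h w + h (axis_refl false true w) + h (axis_refl true false w) + h (axis_refl true true w).
Proof.
move=> ig; have [i0 i1 i2 i3] := ig.
rewrite !dunkl_transformE // /qsq /= !hartley_half_transform // !half_transform_axis_refl //=.
move: (t false false q0 g w) (t false true q0 g w) (t true false q0 g w) (t true true q0 g w) => a0 a1 a2 a3.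
move: (t false false q1 g w) (t false true q1 g w) (t true false q1 g w) (t true true q1 g w) => b0 b1 b2 b3.
move: (t false false q2 g w) (t false true q2 g w) (t true false q2 g w) (t true true q2 g w) => c0 c1 c2 c3.
move: (t false false q3 g w) (t false true q3 g w) (t true false q3 g w) (t true true q3 g w) => d0 d1 d2 d3.
move: (dunkl_c mu ^+ 2) => c.
rewrite ?expr0 ?expr1 ?mul1r ?mulN1r ?mul0r ?subr0.
ring.
Qed.

(** Reflections of the axes preserve the measure. *)
Lemma ge0_integral_axis_refl_avg (F : plane R -> R) : measurable_fun setT F -> (forall v, 0 <= F v) ->
  (\int[m]_v (F v)%:E = \int[m]_v (4^-1 * (F v + F (axis_refl false true v) + F (axis_refl true false v)
     + F (axis_refl true true v)))%:E)%E.
Proof.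
move=> mF F0.
have mR c e : measurable_fun setT (fun v => F (axis_refl c e v)).
  by apply: measurableT_comp => //; exact: measurable_axis_refl.
have IR c e : (\int[m]_v (F (axis_refl c e v))%:E = \int[m]_v (F v)%:E)%E.
  by apply: (ge0_integral_axis_refl mu c e (F := fun v => (F v)%:E)) => //; exact/measurable_EFinP.
under [RHS]eq_integral do rewrite EFinM !EFinD.
rewrite ge0_integralZl_EFin //; last 2 first.
- by move=> v _; rewrite -!EFinD lee_fin !addr_ge0.
- by repeat apply: emeasurable_funD; apply/measurable_EFinP.
rewrite !ge0_integralD //; try (by move=> v _; rewrite -?EFinD lee_fin ?addr_ge0);
  try (by repeat apply: emeasurable_funD; apply/measurable_EFinP).
rewrite !IR; have : (0 <= \int[m]_v (F v)%:E)%E by apply: integral_ge0 => v _; rewrite lee_fin.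
case: (\int[m]_v (F v)%:E)%E => [r _||//].
  by rewrite -!EFinD -EFinM; congr EFin; field.
by rewrite !addye // gt0_muley // lte_fin invr_gt0.
Qed.

Lemma dunkl_Lp_integrable g : dunkl_Lp mu 1%:E g -> quat_integrable g.
Proof.
move=> [mg g1]; have nf := quat_measurable_qnorm mg.
have ig : m.-integrable setT (EFin \o (@qnorm R \o g)).
  apply/integrableP; split; first exact/measurable_EFinP.
  move: g1; rewrite dunkl_norm1E; congr (_ < _)%E; apply: eq_integral => v _ /=.
  by rewrite ger0_norm // qnorm_ge0.
have [m0 m1 m2 m3] := mg.
by split; apply: le_integrable ig => //; try exact/measurable_EFinP; move=> v _;
  rewrite /= lee_fin (ger0_norm (qnorm_ge0 _)); case: (ler_coef_qnorm (g v)).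
Qed.

Lemma measurable_dunkl_transform g : dunkl_Lp mu 1%:E g -> dunkl_Lp mu 2%:E g ->
  quat_measurable (dunkl_transform mu g).
Proof.
move=> L1 L2; have ig := dunkl_Lp_integrable L1.
have [k0 k1 k2 k3] := dunkl_L12_coef L1 L2; have [[m0 m1 m2 m3] _] := L1.
have T0 a b := measurable_half_transform a b m0 k0; have T1 a b := measurable_half_transform a b m1 k1.
have T2 a b := measurable_half_transform a b m2 k2; have T3 a b := measurable_half_transform a b m3 k3.
pose D w := Quat (t false false q0 g w + t true false q1 g w + t false true q2 g w + t true true q3 g w)
       (t false false q1 g w - t true false q0 g w + t false true q3 g w - t true true q2 g w)
       (t false false q2 g w + t true false q3 g w - t false true q0 g w - t true true q1 g w)
       (t false false q3 g w - t true false q2 g w - t false true q1 g w + t true true q0 g w).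
have -> : dunkl_transform mu g = fun w => quat_real (dunkl_c mu ^+ 2) * D w.
  by apply/funext => w; exact: dunkl_transformE.
apply: quat_measurable_realM; first exact: measurable_cst.
split.
- exact: (measurable_funD (measurable_funD (measurable_funD (T0 _ _) (T1 _ _)) (T2 _ _)) (T3 _ _)).
- exact: (measurable_funB (measurable_funD (measurable_funB (T1 _ _) (T0 _ _)) (T3 _ _)) (T2 _ _)).
- exact: (measurable_funB (measurable_funB (measurable_funD (T2 _ _) (T3 _ _)) (T0 _ _)) (T1 _ _)).
- exact: (measurable_funD (measurable_funB (measurable_funB (T3 _ _) (T2 _ _)) (T1 _ _)) (T0 _ _)).
Qed.

Lemma measurable_qsq g : quat_measurable g -> measurable_fun setT (fun v => qsq (g v)).
Proof.
by move=> [? ? ? ?]; repeat apply: measurable_funD; apply: measurable_funX.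
Qed.

Lemma integral_qsq g : quat_measurable g ->
  (\int[m]_v (qsq (g v))%:E = sqint m (q0 \o g) + sqint m (q1 \o g) + sqint m (q2 \o g) + sqint m (q3 \o g))%E.
Proof.
move=> [m0 m1 m2 m3].
have mE (k : plane R -> R) : measurable_fun setT k -> measurable_fun setT (fun v => (k v ^+ 2)%:E).
  by move=> mk; apply/measurable_EFinP; exact: measurable_funX.
rewrite (eq_integral (fun v => ((q0 (g v) ^+ 2)%:E + (q1 (g v) ^+ 2)%:E + (q2 (g v) ^+ 2)%:E + (q3 (g v) ^+ 2)%:E)%E)) //.
rewrite !ge0_integralD //; try (by move=> v _; rewrite -?EFinD lee_fin ?addr_ge0 ?sqr_ge0);
  by repeat apply: emeasurable_funD; apply: mE.
Qed.

Theorem dunkl_plancherel g : dunkl_Lp mu 1%:E g -> dunkl_Lp mu 2%:E g ->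
  dunkl_norm mu 2%:E (dunkl_transform mu g) = dunkl_norm mu 2%:E g.
Proof.
move=> L1 L2; have ig := dunkl_Lp_integrable L1.
have [k0 k1 k2 k3] := dunkl_L12_coef L1 L2; have [mg _] := L1; have [m0 m1 m2 m3] := mg.
rewrite !dunkl_norm2E; congr sqrte.
have E (k : plane R -> quat R) : sqint m (@qnorm R \o k) = (\int[m]_v (qsq (k v))%:E)%E.
  by apply: eq_integral => v _; rewrite /= sqr_qnorm.
pose G w := Quat (H (q0 \o g) w) (H (q1 \o g) w) (H (q2 \o g) w) (H (q3 \o g) w).
have mG : quat_measurable G.
  by split; [exact: (hartley_measurable_le ha m0 k0).1|exact: (hartley_measurable_le ha m1 k1).1
    |exact: (hartley_measurable_le ha m2 k2).1|exact: (hartley_measurable_le ha m3 k3).1].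
have mD := measurable_dunkl_transform L1 L2.
rewrite !E; transitivity (\int[m]_v (qsq (G v))%:E)%E.
  rewrite (ge0_integral_axis_refl_avg (measurable_qsq mD) (fun v => qsq_ge0 _)).
  rewrite (ge0_integral_axis_refl_avg (measurable_qsq mG) (fun v => qsq_ge0 _)).
  by apply: eq_integral => w _; rewrite sum_axis_refl_dunkl.
rewrite !integral_qsq // /G /comp /=.
rewrite (hartley_isometry ha m0 k0) (hartley_isometry ha m1 k1).
by rewrite (hartley_isometry ha m2 k2) (hartley_isometry ha m3 k3).
Qed.

(** For I the integral of F, |I|^2 is the integral of the inner product of I
    with F, which is at most |I| |F|. *)
Lemma qnorm_quat_integral (F : plane R -> quat R) : quat_measurable F -> dunkl_Lp mu 1%:E F ->
  ((qnorm (quat_integral mu F))%:E <= \int[m]_v (qnorm (F v))%:E)%E.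
Proof.
move=> mF L1; have [i0 i1 i2 i3] := dunkl_Lp_integrable L1.
have nF := quat_measurable_qnorm mF.
have iN : m.-integrable setT (EFin \o (@qnorm R \o F)).
  apply/integrableP; split; first exact/measurable_EFinP.
  case: L1 => _; rewrite dunkl_norm1E; congr (_ < _)%E; apply: eq_integral => v _ /=.
  by rewrite ger0_norm // qnorm_ge0.
set I := quat_integral mu F; set N := qnorm I.
have E : N ^+ 2 = \int[m]_v (q0 I * q0 (F v) + q1 I * q1 (F v) + q2 I * q2 (F v) + q3 I * q3 (F v)).
  have [_] := Rintegral_lin4 (q1 I) (q2 I) (q3 I) (integrable_scale (q0 I) i0) i1 i2 i3.
  by move=> ->; rewrite RintegralZl // sqr_qnorm /qsq !expr2.
rewrite -(fineK (integrable_fin_num measurableT iN)) lee_fin -/(Rintegral m setT (@qnorm R \o F)).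
have NN : N ^+ 2 <= N * \int[m]_v qnorm (F v).
  rewrite -RintegralZl // E; apply: le_Rintegral => //.
  - by have [+ _] := Rintegral_lin4 (q1 I) (q2 I) (q3 I) (integrable_scale (q0 I) i0) i1 i2 i3.
  - exact: integrable_scale.
  - by move=> v _; exact: qnorm_cauchy.
have [N0|N0] := eqVneq N 0.
  by rewrite N0; apply: Rintegral_ge0 => v _; exact: qnorm_ge0.
have Npos : 0 < N by rewrite lt_neqAle eq_sym N0 qnorm_ge0.
by move: NN; rewrite expr2 ler_pM2l.
Qed.

Lemma qnorm_dunkl_transform_le g w : dunkl_Lp mu 1%:E g ->
  ((qnorm (dunkl_transform mu g w))%:E <= (dunkl_c mu ^+ 2)%:E * dunkl_norm mu 1%:E g)%E.
Proof.
move=> L1; have ig := dunkl_Lp_integrable L1; have [mg g1] := L1.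
have ik := kern_integrable w ig.
have mk : quat_measurable (fun v => kern g w v).
  case: ik => j0 j1 j2 j3.
  by split; apply/measurable_EFinP; [exact: measurable_int j0|exact: measurable_int j1|exact: measurable_int j2|exact: measurable_int j3].
have le v : qnorm (kern g w v) <= qnorm (g v).
  have [h1 h2] := qnorm_dunkl_E w v; rewrite !qnormM.
  rewrite (le_trans (ler_piMr _ h2)) ?mulr_ge0 ?qnorm_ge0 //.
  by rewrite ler_piMl ?qnorm_ge0.
have leI : (dunkl_norm mu 1%:E (fun v => kern g w v) <= dunkl_norm mu 1%:E g)%E.
  rewrite !dunkl_norm1E; apply: ge0_le_integral => //.
  - by move=> v _; rewrite lee_fin qnorm_ge0.
  - by apply/measurable_EFinP; exact: quat_measurable_qnorm mk.
  - by apply/measurable_EFinP; exact: quat_measurable_qnorm mg.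
  - by move=> v _; rewrite lee_fin.
have Lk : dunkl_Lp mu 1%:E (fun v => kern g w v) by split => //; exact: le_lt_trans leI g1.
rewrite /dunkl_transform qnormM qnorm_real ger0_norm ?sqr_ge0 // EFinM.
apply: lee_wpmul2l; first by rewrite lee_fin sqr_ge0.
by apply: le_trans leI; rewrite dunkl_norm1E; exact: qnorm_quat_integral.
Qed.

Lemma quat_integralB (F G : plane R -> quat R) : quat_integrable F -> quat_integrable G ->
  quat_integral mu (fun v => F v - G v) = quat_integral mu F - quat_integral mu G.
Proof.
move=> [g0 g1 g2 g3] [h0 h1 h2 h3]; rewrite -[RHS]/(quat_add _ (quat_opp _)) /quat_add /quat_opp /=.
by congr Quat; rewrite -RintegralB //; apply: eq_Rintegral => v _.
Qed.

Lemma dunkl_transformB g h w : dunkl_Lp mu 1%:E g -> dunkl_Lp mu 1%:E h ->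
  dunkl_transform mu (fun v => g v - h v) w = dunkl_transform mu g w - dunkl_transform mu h w.
Proof.
move=> /dunkl_Lp_integrable ig /dunkl_Lp_integrable ih.
rewrite /dunkl_transform -mulrBr -quat_integralB; try exact: kern_integrable.
by congr (_ * quat_integral _ _); apply/funext => v; rewrite mulrBr mulrBl.
Qed.
End Transform.

(** * Concentration and the uncertainty inequality *)

Section Concentration.
Variable R : realType.
Variable mu : R.
Notation m := (dunkl_measure mu).
Notation N2 := (dunkl_norm mu 2%:E).
Notation chi A f := (fun v => quat_real (\1_A v) * f v).
Implicit Types (f g : plane R -> quat R) (A : set (plane R)).

Lemma qnorm_chi A f v : qnorm (quat_real (\1_A v) * f v) = \1_A v * qnorm (f v).
Proof. by rewrite qnormM qnorm_real ger0_norm // indicE. Qed.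

(** Hoelder's inequality with the indicator function of the set. *)
Lemma dunkl_norm1_chi A f : measurable A -> quat_measurable f ->
  (dunkl_norm mu 1%:E (chi A f) <= sqrte (m A) * N2 f)%E.
Proof.
move=> mA mf; have nf := quat_measurable_qnorm mf.
have mi : measurable_fun setT (\1_A : plane R -> R) by exact: measurable_indic.
have h2 : 2^-1 + 2^-1 = 1 :> R by lra.
have := hoelder m mi nf (ltr0Sn R 1) (ltr0Sn R 1) h2.
rewrite -/(dunkl_norm mu 2%:E f).
have -> : ('N[m]_2%:E[EFin \o (\1_A : plane R -> R)] = sqrte (m A))%E.
  rewrite unlock poweR12_sqrt; last by apply: integral_ge0 => v _; exact: poweR_ge0.
  rewrite -[in RHS](setIT A) -(integral_indic m measurableT mA); congr sqrte.
  apply: eq_integral => v _ /=; rewrite indicE.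
  by case: (_ \in _); rewrite /= ?normr1 ?powR1 // normr0 powR0.
apply: le_trans; rewrite /dunkl_norm !Lnorm1; apply: le_of_eq.
by apply: eq_integral => v _; rewrite /= qnorm_chi.
Qed.

Lemma dunkl_norm2_chi A f (K : R) : measurable A -> quat_measurable f -> 0 <= K ->
  (forall v, qnorm (f v) <= K) -> (N2 (chi A f) <= K%:E * sqrte (m A))%E.
Proof.
move=> mA mf K0 fK; have mc := quat_measurable_indic mA mf.
rewrite dunkl_norm2E.
have -> : (K%:E * sqrte (m A) = sqrte ((K ^+ 2)%:E * m A))%E.
  by rewrite sqrteM ?lee_fin ?sqr_ge0 // /sqrte sqrtr_sqr ger0_norm.
rewrite lee_sqrt; last by rewrite mule_ge0 // lee_fin sqr_ge0.
rewrite -(setIT A) -(integral_indic m measurableT mA) setIT -ge0_integralZl_EFin //; last 2 first.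
- by apply/measurable_EFinP; exact: measurable_indic.
- exact: sqr_ge0.
apply: ge0_le_integral => //.
- by move=> v _; rewrite lee_fin sqr_ge0.
- by apply/measurable_EFinP/measurable_funX; exact: quat_measurable_qnorm.
- by apply: measurable_funeM; apply/measurable_EFinP; exact: measurable_indic.
- move=> v _; rewrite -EFinM lee_fin /= qnorm_chi indicE.
  case: (_ \in _); rewrite ?mul0r ?mulr0 ?expr0n // mul1r mulr1.
  by rewrite ler_pXn2r ?nnegrE ?qnorm_ge0.
Qed.

Lemma dunkl_norm2_chi_le A f : measurable A -> quat_measurable f -> (N2 (chi A f) <= N2 f)%E.
Proof.
move=> mA mf; apply: dunkl_norm2_le => //; first exact: quat_measurable_indic.
move=> v; rewrite qnorm_chi indicE; case: (_ \in _); rewrite ?mul1r ?mul0r ?qnorm_ge0 //.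
Qed.

(** On a null set the cut-off function is 0 almost everywhere, so all the mass
    of f is outside. *)
Lemma concentrated_null (e : R) A f : measurable A -> dunkl_Lp mu 2%:E f -> N2 f != 0%E ->
  m A = 0%E -> concentrated mu e A f -> 1 <= e.
Proof.
move=> mA [mf f2] f0 A0 fA.
have mc := quat_measurable_indic mA mf.
have h0 : N2 (chi A f) = 0%E.
  rewrite dunkl_norm2E (_ : sqint _ _ = 0%E) ?sqrte0 //.
  rewrite /sqint -(setUv A) ge0_integral_setU //; [|exact: measurableC| |by move=> v _; rewrite lee_fin sqr_ge0|by apply/disj_setPCl].
    rewrite null_set_integral // ?add0e; last first.
      by apply/measurable_EFinP/measurable_funX; apply: measurable_funTS; exact: quat_measurable_qnorm.
    apply: integral0_eq => v; rewrite /= => Av.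
    by rewrite qnorm_chi indicE memNset // mul0r expr0n.
  rewrite setUv; apply/measurable_EFinP/measurable_funX; exact: quat_measurable_qnorm.
have fin : N2 f \is a fin_num by rewrite ge0_fin_numE // dunkl_norm_ge0.
have := le_trans (dunkl_norm2_le_dist mu mf mc) (leeD2r _ fA).
rewrite h0 adde0 -(fineK fin) -EFinM lee_fin.
have : 0 < fine (N2 f) by rewrite fine_gt0 // lt_neqAle eq_sym f0 dunkl_norm_ge0 -ge0_fin_numE ?dunkl_norm_ge0.
by move=> h; rewrite -[X in X <= _]mul1r ler_pM2r.
Qed.
End Concentration.

Section DonohoStark.
Variable R : realType.
Variable mu : R.
Hypothesis ha : 2^-1 <= mu + 1.
Notation m := (dunkl_measure mu).
Notation N2 := (dunkl_norm mu 2%:E).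
Notation chi A f := (fun v => quat_real (\1_A v) * f v).
Notation D := (dunkl_transform mu).
Implicit Types (f F g : plane R -> quat R) (A : set (plane R)).

(** One function that approximates well on both sides, extracted from the
    sequence that defines the extension to L^2. *)
Lemma dunkl_L2_approx f F (e : R) : dunkl_Lp mu 2%:E f -> is_dunkl_transform_L2 mu f F -> 0 < e ->
  exists g, [/\ dunkl_Lp mu 1%:E g, dunkl_Lp mu 2%:E g,
    (N2 (fun v => g v - f v)%R <= e%:E)%E & (N2 (fun v => D g v - F v)%R <= e%:E)%E].
Proof.
move=> f2 [F2 [g [gL /fine_cvgP[g1 g2] /fine_cvgP[d1 d2]]]] e0.
have [N _ /(_ N (leqnn N)) [/= [fg hg] [fd hd]]] := filterI
  (filterI g1 (cvgr0_norm_lt _ g2 _ e0)) (filterI d1 (cvgr0_norm_lt _ d2 _ e0)).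
exists (g N); case: (gL N) => L1 L2; split => //.
  by rewrite -(fineK fg) lee_fin (le_trans (ler_norm _)) // ltW.
by rewrite -(fineK fd) lee_fin (le_trans (ler_norm _)) // ltW.
Qed.

Theorem dunkl_plancherel_L2 f F : dunkl_Lp mu 2%:E f -> is_dunkl_transform_L2 mu f F ->
  N2 F = N2 f.
Proof.
move=> f2 FE; have [mf _] := f2; have [[mF _] _] := FE.
apply/eqP; rewrite eq_le; apply/andP; split; apply/lee_addgt0Pr => e e0.
  have [g [L1 L2 h1 h2]] := dunkl_L2_approx f2 FE (ltac:(by rewrite divr_gt0) : 0 < e / 2).
  have [mg _] := L1; have mD := measurable_dunkl_transform ha L1 L2.
  apply: le_trans (dunkl_norm2_le_dist mu mF mD) _; rewrite dunkl_norm_distC dunkl_plancherel //.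
  apply: le_trans (leeD h2 (dunkl_norm2_le_dist mu mg mf)) _.
  rewrite addeA [leRHS]addeC leeD2r // (le_trans (leeD2l _ h1)) // -EFinD lee_fin; lra.
have [g [L1 L2 h1 h2]] := dunkl_L2_approx f2 FE (ltac:(by rewrite divr_gt0) : 0 < e / 2).
have [mg _] := L1; have mD := measurable_dunkl_transform ha L1 L2.
apply: le_trans (dunkl_norm2_le_dist mu mf mg) _.
rewrite dunkl_norm_distC -[X in (_ + X <= _)%E](dunkl_plancherel ha L1 L2).
apply: le_trans (leeD h1 (dunkl_norm2_le_dist mu mD mF)) _.
rewrite addeA [leRHS]addeC leeD2r // (le_trans (leeD2l _ h2)) // -EFinD lee_fin; lra.
Qed.

(** The extension to L^2 is not linear by definition, but it inherits from the
    approximating functions the isometry inequality against a function of L^1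
    and L^2. *)
Lemma dunkl_transform_dist f F h : dunkl_Lp mu 2%:E f -> is_dunkl_transform_L2 mu f F ->
  dunkl_Lp mu 1%:E h -> dunkl_Lp mu 2%:E h ->
  (N2 (fun v => F v - D h v)%R <= N2 (fun v => f v - h v)%R)%E.
Proof.
move=> f2 FE h1 h2; have [mf _] := f2; have [[mF _] _] := FE; have [mh _] := h1.
have mDh := measurable_dunkl_transform ha h1 h2.
apply/lee_addgt0Pr => e e0.
have [g [L1 L2 k1 k2]] := dunkl_L2_approx f2 FE (ltac:(by rewrite divr_gt0) : 0 < e / 2).
have [mg _] := L1; have mD := measurable_dunkl_transform ha L1 L2.
apply: le_trans (dunkl_norm2_dist mu mF mD mDh) _; rewrite dunkl_norm_distC.
have -> : (fun v => D g v - D h v) = D (fun v => g v - h v).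
  by apply/funext => v; rewrite dunkl_transformB.
have mgh := quat_measurableB mg mh.
have gh1 : dunkl_Lp mu 1%:E (fun v => g v - h v).
  split => //; apply: (@le_lt_trans _ _ (dunkl_norm mu 1%:E g + dunkl_norm mu 1%:E h)%E).
    rewrite !dunkl_norm1E -ge0_integralD //; try (by move=> v _; rewrite lee_fin qnorm_ge0);
      try (by apply/measurable_EFinP; exact: quat_measurable_qnorm).
    apply: ge0_le_integral => //.
    - by move=> v _; rewrite lee_fin qnorm_ge0.
    - by apply/measurable_EFinP; exact: quat_measurable_qnorm mgh.
    - by apply: emeasurable_funD; apply/measurable_EFinP; exact: quat_measurable_qnorm.
    - by move=> v _; rewrite -EFinD lee_fin (le_trans (qnormD _ _)) // qnormN.
  by rewrite lte_add_pinfty //; [case: L1|case: h1].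
have gh2 : dunkl_Lp mu 2%:E (fun v => g v - h v).
  split => //; have mNh : quat_measurable (fun v => - h v).
    rewrite (_ : (fun v => _) = (fun v => (fun=> 0) v - h v)); last by apply/funext => v; rewrite sub0r.
    by apply: quat_measurableB => //; split; exact: measurable_cst.
  apply: le_lt_trans (dunkl_norm2D mu mg mNh) _.
  rewrite lte_add_pinfty //; first by case: L2.
  case: h2 => _; rewrite (_ : N2 (fun v => - h v) = N2 h) //.
  by rewrite /dunkl_norm; congr (Lnorm _ _ _); apply/funext => v /=; rewrite qnormN.
rewrite dunkl_plancherel //.
apply: le_trans (leeD k2 (dunkl_norm2_dist mu mg mf mh)) _.
rewrite addeA [leRHS]addeC leeD2r // (le_trans (leeD2l _ k1)) // -EFinD lee_fin; lra.
Qed.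

(** The estimate of the mass of F on N, where h is the cut-off of f to M: F is
    within eM |f| of Dh, and Dh is uniformly bounded. *)
Lemma donoho_stark f F M N (eM eN : R) :
  dunkl_Lp mu 2%:E f -> N2 f != 0%E -> is_dunkl_transform_L2 mu f F ->
  measurable M -> measurable N -> (m M < +oo)%E -> (m N < +oo)%E ->
  concentrated mu eM M f -> concentrated mu eN N F ->
  1 - eM - eN <= dunkl_c mu ^+ 2 * (Num.sqrt (fine (m M)) * Num.sqrt (fine (m N))).
Proof.
move=> f2 f0 FE mM mN M_fin N_fin fM FN.
have [mf ff] := f2; have [[mF _] _] := FE.
have nfin : N2 f \is a fin_num by rewrite ge0_fin_numE // dunkl_norm_ge0.
have n0 : 0 < fine (N2 f).
  by rewrite fine_gt0 // lt_neqAle eq_sym f0 dunkl_norm_ge0.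
have sqrte_fin (x : \bar R) : (0 <= x)%E -> (x < +oo)%E -> sqrte x = (Num.sqrt (fine x))%:E.
  by case: x.
have mc := quat_measurable_indic mM mf.
pose h := chi M f.
have hb : (dunkl_norm mu 1%:E h <= (Num.sqrt (fine (m M)) * fine (N2 f))%:E)%E.
  by rewrite EFinM fineK // -sqrte_fin //; exact: dunkl_norm1_chi.
have h1 : dunkl_Lp mu 1%:E h by split => //; apply: (le_lt_trans hb); rewrite ltry.
have h2 : dunkl_Lp mu 2%:E h by split => //; exact: le_lt_trans (dunkl_norm2_chi_le mu mM mf) ff.
have mDh := measurable_dunkl_transform ha h1 h2.
have K0 : 0 <= dunkl_c mu ^+ 2 * (Num.sqrt (fine (m M)) * fine (N2 f)).
  by rewrite mulr_ge0 ?sqr_ge0 // mulr_ge0 ?sqrtr_ge0 // ltW.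
have sup w : qnorm (D h w) <= dunkl_c mu ^+ 2 * (Num.sqrt (fine (m M)) * fine (N2 f)).
  rewrite -lee_fin; apply: le_trans (qnorm_dunkl_transform_le ha w h1) _.
  by rewrite [leRHS]EFinM; apply: lee_wpmul2l => //; rewrite lee_fin sqr_ge0.
have b1 := dunkl_norm2_chi mu mN mDh K0 sup.
have b2 : (N2 (fun v => F v - D h v)%R <= eM%:E * N2 f)%E.
  exact: le_trans (dunkl_transform_dist f2 FE h1 h2) fM.
have mB := quat_measurableB mF mDh.
have b3 : (N2 (chi N F) <= eM%:E * N2 f + (dunkl_c mu ^+ 2 * (Num.sqrt (fine (m M)) * fine (N2 f)))%:E * sqrte (m N))%E.
  rewrite (_ : (fun v => _) = (fun v => quat_real (\1_N v) * (F v - D h v) + quat_real (\1_N v) * D h v)); last first.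
    by apply/funext => v; rewrite -mulrDr subrK.
  apply: le_trans (dunkl_norm2D mu (quat_measurable_indic mN mB) (quat_measurable_indic mN mDh)) _.
  by apply: leeD => //; exact: le_trans (dunkl_norm2_chi_le mu mN mB) b2.
have b4 := dunkl_norm2_le_dist mu mF (quat_measurable_indic mN mF).
have := le_trans b4 (leeD FN b3).
rewrite (dunkl_plancherel_L2 f2 FE) sqrte_fin // -(fineK nfin) -!EFinM -!EFinD lee_fin /=.
move: (Num.sqrt _) (Num.sqrt _) (dunkl_c mu ^+ 2) n0; move: (fine _) => n a b c n0 H.
rewrite -(ler_pM2r n0); lra.
Qed.
End DonohoStark.

Theorem theorem5p1 (R : realType) (mu : R) (hmu : - 2^-1 <= mu)
    (f Df : plane R -> quat R)
    (f_L2 : dunkl_Lp mu 2%:E f)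
    (f_neq0 : dunkl_norm mu 2%:E f != 0%E)
    (DfE : is_dunkl_transform_L2 mu f Df)
    (M N : set (plane R)) (mM : measurable M) (mN : measurable N)
    (eM eN : R) (eM_ge0 : 0 <= eM) (eN_ge0 : 0 <= eN)
    (eMN : eM + eN <= 1)
    (fM : concentrated mu eM M f)
    (DfN : concentrated mu eN N Df) :
  (dunkl_measure mu M * dunkl_measure mu N >=
     ((dunkl_c mu ^+ 4)^-1 * (1 - eM - eN) ^+ 2)%:E)%E.
Proof.
have ha : 2^-1 <= mu + 1 by lra.
have c0 := dunkl_c_gt0 ha.
have Df0 : dunkl_norm mu 2%:E Df != 0%E by rewrite (dunkl_plancherel_L2 ha f_L2 DfE).
have [Df_L2 _] := DfE.
(* A null set has epsilon at least 1, which by [eMN] is only possible when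
   the right-hand side is 0. *)
have zero : 1 <= eM \/ 1 <= eN -> (1 - eM - eN) ^+ 2 = 0.
  by move=> h; rewrite (_ : 1 - eM - eN = 0) ?expr0n //; case: h; lra.
have [M0|M0] := eqVneq (dunkl_measure mu M) 0%E.
  by rewrite M0 mul0e zero ?mulr0 //; left; exact: (concentrated_null mM f_L2 f_neq0 M0 fM).
have [N0|N0] := eqVneq (dunkl_measure mu N) 0%E.
  by rewrite N0 mule0 zero ?mulr0 //; right; exact: (concentrated_null mN Df_L2 Df0 N0 DfN).
have Mpos : (0 < dunkl_measure mu M)%E by rewrite lt_neqAle eq_sym M0 measure_ge0.
have Npos : (0 < dunkl_measure mu N)%E by rewrite lt_neqAle eq_sym N0 measure_ge0.
have [Mfin|] := boolP (dunkl_measure mu M \is a fin_num); last first.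
  by rewrite ge0_fin_numE ?measure_ge0 // -leNgt leye_eq => /eqP ->; rewrite gt0_mulye // leey.
have [Nfin|] := boolP (dunkl_measure mu N \is a fin_num); last first.
  by rewrite ge0_fin_numE ?measure_ge0 // -leNgt leye_eq => /eqP ->; rewrite gt0_muley // leey.
have h := donoho_stark ha f_L2 f_neq0 DfE mM mN (ltac:(by rewrite -ge0_fin_numE))
  (ltac:(by rewrite -ge0_fin_numE)) fM DfN.
rewrite -(fineK Mfin) -(fineK Nfin) -EFinM lee_fin.
have a0 : 0 <= fine (dunkl_measure mu M) by rewrite fine_ge0.
have b0 : 0 <= fine (dunkl_measure mu N) by rewrite fine_ge0.
rewrite ler_pdivrMl ?exprn_gt0 //.
have e0 : 0 <= 1 - eM - eN by lra.
apply: (le_trans (lerXn2r 2 _ _ h)); rewrite ?nnegrE ?(le_trans e0 h) //.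
rewrite -[X in _ <= _ * (X * _)](sqr_sqrtr a0) -[X in _ <= _ * (_ * X)](sqr_sqrtr b0).
by apply: le_of_eq; ring.
Qed.
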